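(* Let $G$ be a compact quantum group and let $F:\mathrm{Rep}(G)\to\mathrm{Hilb}$ be the canonical fibre functor. There is a bijective correspondence (assigning to a fibre functor $F'$ with a UPT $\alpha:F\to F'$ the special Frobenius monoid $\alpha\otimes\alpha^*$) between the following structures: \begin{itemize} \item unitary monoidal natural isomorphism classes of fibre functors accessible from $F$ by a (nonzero) unitary pseudonatural transformation, i.e. fibre functors $F'$ such that there exists a nonzero unitary pseudonatural transformation $\alpha:F\to F'$; \item Morita equivalence classes of simple Frobenius monoids in $\mathrm{End}(F)\cong\mathrm{Rep}(A_G)$. \end{itemize}
   Context: $\mathrm{Rep}(G)$ is the pivotal dagger category of continuous finite-dimensional unitary representations of the compact quantum group $G$; $\mathrm{Hilb}$ is the pivotal dagger category of finite-dimensional Hilbert spaces and linear maps (with the standard pivotal dagger structure). Monoidal categories are treated as strict. A fibre functor is a $\mathbb{C}$-linear unitary monoidal functor $F':\mathrm{Rep}(G)\to\mathrm{Hilb}$, with multiplicators $m_{X,Y}:F'(X)\otimes F'(Y)\to F'(X\otimes Y)$ and unitor $u:\mathbb{C}\to F'(\mathbb{1})$ (unitary: $F'(f^\dagger)=F'(f)^\dagger$ and $m,u$ unitary). The canonical fibre functor $F$ is the one sending a representation to its underlying Hilbert space. A unitary pseudonatural transformation (UPT) $(\alpha,H):F_1\to F_2$ between fibre functors is a Hilbert space $H\in\mathrm{Hilb}$ together with, for every object $X$ of $\mathrm{Rep}(G)$, a unitary $\alpha_X:F_1(X)\otimes H\to H\otimes F_2(X)$ such that $(\mathrm{id}_H\otimes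 F_2(f))\circ\alpha_X=\alpha_Y\circ(F_1(f)\otimes\mathrm{id}_H)$ for $f:X\to Y$; $\alpha_{X\otimes Y}\circ(m^{F_1}_{X,Y}\otimes\mathrm{id}_H)=(\mathrm{id}_H\otimes m^{F_2}_{X,Y})\circ(\alpha_X\otimes\mathrm{id}_{F_2(Y)})\circ(\mathrm{id}_{F_1(X)}\otimes\alpha_Y)$; and $\alpha_{\mathbb{1}}\circ(u^{F_1}\otimes\mathrm{id}_H)=\mathrm{id}_H\otimes u^{F_2}$. It is nonzero if $H\neq0$. Composition: $(\alpha,H)\otimes(\beta,K)$ has Hilbert space $H\otimes K$ and components $(\mathrm{id}_H\otimes\beta_X)\circ(\alpha_X\otimes\mathrm{id}_K)$. A modification $f:(\alpha,H)\to(\beta,H')$ is a linear map $f:H\to H'$ with $\beta_X\circ(\mathrm{id}_{F_1(X)}\otimes f)=(f\otimes\mathrm{id}_{F_2(X)})\circ\alpha_X$ for all $X$; its dagger is the adjoint. $\mathrm{End}(F)$ is the monoidal dagger category of UPTs $F\to F$ and modifications; it has split dagger idempotents, and is isomorphic to the category $\mathrm{Rep}(A_G)$ of finite-dimensional $*$-representations of the compact quantum group algebra $A_G$ (the Hopf $*$-algebra of matrix coefficients of finite-dimensional representations of $G$). The right dual of $(\alpha,H):F_1\to F_2$ is $(\alpha^*,H^* ):F_2\to F_1$ with $(\alpha^* )_X=(\mathrm{id}_{H^*}\otimes\mathrm{id}_{F_1(X)}\otimes\epsilon)\circ(\mathrm{id}_{H^*}\otimes\alpha_X^\dagger\otimes\mathrm{id}_{H^*})\circ(\eta\otimes\mathrm{id}_{F_2(X)}\otimes\mathrm{id}_{H^*})$,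 where $\eta:\mathbb{C}\to H^*\otimes H$ and $\epsilon:H\otimes H^*\to\mathbb{C}$ are the standard coevaluation and evaluation. In a monoidal dagger category, a monoid $(A,m,u)$ is Frobenius if $(m\otimes\mathrm{id})\circ(\mathrm{id}\otimes m^\dagger)=m^\dagger\circ m=(\mathrm{id}\otimes m)\circ(m^\dagger\otimes\mathrm{id})$, and special if $m\circ m^\dagger=\mathrm{id}_A$. A unitary $*$-isomorphism of Frobenius monoids $f:A\to B$ is a unitary morphism with $f\circ m_A=m_B\circ(f\otimes f)$ and $f\circ u_A=u_B$. For a nonzero UPT $(\alpha,H)$ with source $F$ and $d=\dim H$, $\alpha\otimes\alpha^*$ is a special Frobenius monoid in $\mathrm{End}(F)$ with multiplication $\frac{1}{\sqrt d}(\mathrm{id}_H\otimes\eta^\dagger\otimes\mathrm{id}_{H^*})$ and unit $\sqrt d\,\epsilon^\dagger$; for a nonzero Hilbert space $H$ the same formulas define a special Frobenius monoid $H\otimes H^*$ in $\mathrm{Hilb}$. A special Frobenius monoid in $\mathrm{End}(F)$ is simple if its underlying Frobenius monoid in $\mathrm{Hilb}$ is unitarily $*$-isomorphic to $H\otimes H^*$ for some nonzero finite-dimensional Hilbert space $H$. Morita equivalence. Let $A,B$ be special Frobenius monoids; write $\mathrm{cup}_A=m_A^\dagger\circ u_A$ and $\mathrm{cap}_A=u_A^\dagger\circ m_A$. An $A$-$B$-dagger bimodule ${}_AM_B$ is an object $M$ with $\rho:A\otimes M\otimes B\to M$ such that $\rho\circ(m_A\otimes\mathrm{id}_M\otimes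 m_B)=\rho\circ(\mathrm{id}_A\otimes\rho\otimes\mathrm{id}_B)$, $\rho\circ(u_A\otimes\mathrm{id}_M\otimes u_B)=\mathrm{id}_M$ and $(\mathrm{cap}_A\otimes\mathrm{id}_M\otimes\mathrm{cap}_B)\circ(\mathrm{id}_A\otimes\rho^\dagger\otimes\mathrm{id}_B)=\rho$. A morphism of dagger bimodules is a morphism $f:M\to N$ with $f\circ\rho_M=\rho_N\circ(\mathrm{id}_A\otimes f\otimes\mathrm{id}_B)$; bimodules are isomorphic ($\cong$) if there is a unitary such morphism. ${}_AA_A$ denotes $A$ with action $m\circ(m\otimes\mathrm{id}_A)$. For ${}_AM_B$ and ${}_BN_C$, the endomorphism $(\rho_M\otimes\rho_N)\circ(u_A\otimes\mathrm{id}_M\otimes\mathrm{cup}_B\otimes\mathrm{id}_N\otimes u_C)$ of $M\otimes N$ is a dagger idempotent; the relative tensor product $M\otimes_BN$ is its splitting, with isometry $i:M\otimes_BN\to M\otimes N$ such that $i\circ i^\dagger$ is this idempotent, and it is an $A$-$C$-dagger bimodule with action $i^\dagger\circ(\lambda_M\otimes\varrho_N)\circ(\mathrm{id}_A\otimes i\otimes\mathrm{id}_C)$, where $\lambda_M=\rho_M\circ(\mathrm{id}_A\otimes\mathrm{id}_M\otimes u_B)$ and $\varrho_N=\rho_N\circ(u_B\otimes\mathrm{id}_N\otimes\mathrm{id}_C)$. $A$ and $B$ are Morita equivalent if there are dagger bimodules ${}_AM_B$, ${}_BN_A$ with ${}_AM\otimes_BN_A\cong{}_AA_A$ and ${}_BN\otimes_AM_B\cong{}_BB_B$.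 *)

(* Defs.v *)
From mathcomp Require Import all_boot all_order all_algebra.
From mathcomp Require Import reals.
From mathcomp.real_closed Require Import complex mxtens.

Set Implicit Arguments.
Unset Strict Implicit.
Unset Printing Implicit Defensive.

Import Order.TTheory GRing.Theory Num.Theory.
Local Open Scope ring_scope.
Local Open Scope sesquilinear_scope.

(* Hilb is modelled by the equivalent strict monoidal dagger category of the
   spaces C^n: its objects are natural numbers n, a morphism C^n -> C^m is a
   matrix in 'M[R[i]]_(m, n) acting on column vectors, composition is *m, the
   dagger is ^t*, and the tensor product is multiplication of dimensions on
   objects and the Kronecker product *t on morphisms.  The object H^* is C^n
   with the dual basis.  In this category the equations a * (b * c) = a * b * c
   and 1 * a = a = a * 1 between objects hold, but only propositionally: [*s]
   is the composition, [=s] the equality and [scast] the identity function on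
   morphisms whose domains and codomains agree up to such equations. *)

Ltac strict_dim :=
  lazymatch goal with |- ?e => assert_fails (has_evar e) end;
  by rewrite /= ?mulnA ?mul1n ?muln1 ?mulnA ?mul1n ?muln1.

Definition strict_comp (T : pzRingType) (p m n q : nat)
  (g : 'M[T]_(p, m)) (f : 'M[T]_(n, q)) (e : n = m) : 'M[T]_(p, q) :=
  g *m castmx (e, erefl q) f.

Definition strict_cast (T : Type) (m n m' n' : nat)
  (f : 'M[T]_(m, n)) (em : m = m') (en : n = n') : 'M[T]_(m', n') :=
  castmx (em, en) f.
Arguments strict_cast {T m n m' n'} & f em en.

Definition strict_eq (T : Type) (m n m' n' : nat)
  (f : 'M[T]_(m, n)) (g : 'M[T]_(m', n')) (em : m = m') (en : n = n') : Prop :=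
  castmx (em, en) f = g.

Notation "g *s f" := (strict_comp g f ltac:(strict_dim))
  (at level 40, left associativity, only parsing) : ring_scope.
Notation scast f := (strict_cast f ltac:(strict_dim) ltac:(strict_dim))
  (only parsing).
Notation "f =s g" := (strict_eq f g ltac:(strict_dim) ltac:(strict_dim))
  (at level 70, no associativity, only parsing) : ring_scope.

Definition is_unitary (C : numClosedFieldType) (m n : nat) (U : 'M[C]_(m, n)) :=
  U^t* *m U = 1%:M /\ U *m U^t* = 1%:M.

Section CompactQuantumGroups.
Variable R : realType.
Local Notation C := R[i].

Section TensorPowers.
Variable A : algType C.

Definition bilinear_form (b : A -> A -> C) :=
  (forall c x y z, b (c *: x + y) z = c * b x z + b y z) /\
  (forall c x y z, b z (c *: x + y) = c * b z x + b z y).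

Definition trilinear_form (t : A -> A -> A -> C) :=
  [/\ forall c x y z w, t (c *: x + y) z w = c * t x z w + t y z w,
      forall c x y z w, t z (c *: x + y) w = c * t z x w + t z y w &
      forall c x y z w, t z w (c *: x + y) = c * t z w x + t z w y].

(* A list [:: (x1, y1); ..; (xk, yk)] stands for the element
   x1 (x) y1 + .. + xk (x) yk of the algebraic tensor product of A with itself;
   two elements of a tensor product of vector spaces are equal if and only if
   all bilinear forms take the same value on them. *)
Definition tensor_eq (s s' : seq (A * A)) :=
  forall b, bilinear_form b ->
    \sum_(p <- s) b p.1 p.2 = \sum_(p <- s') b p.1 p.2.

End TensorPowers.

Record hopf_star_algebra := HopfStarAlgebra {
  hopf_alg :> algType C;
  hopf_star : hopf_alg -> hopf_alg;
  hopf_comul : hopf_alg -> seq (hopf_alg * hopf_alg);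
  hopf_counit : hopf_alg -> C;
  hopf_antipode : hopf_alg -> hopf_alg;
  hopf_star_antilinear : forall c x y,
    hopf_star (c *: x + y) = (c^*)%R *: hopf_star x + hopf_star y;
  hopf_starM : forall x y, hopf_star (x * y) = hopf_star y * hopf_star x;
  hopf_starK : involutive hopf_star;
  hopf_comul_linear : forall c x y, tensor_eq (hopf_comul (c *: x + y))
    ([seq (c *: p.1, p.2) | p <- hopf_comul x] ++ hopf_comul y);
  hopf_comulM : forall x y, tensor_eq (hopf_comul (x * y))
    [seq (p.1 * q.1, p.2 * q.2) | p <- hopf_comul x, q <- hopf_comul y];
  hopf_comul1 : tensor_eq (hopf_comul 1) [:: (1, 1)];
  hopf_comul_star : forall x, tensor_eq (hopf_comul (hopf_star x))
    [seq (hopf_star p.1, hopf_star p.2) | p <- hopf_comul x];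
  hopf_coassoc : forall x t, trilinear_form t ->
    \sum_(p <- hopf_comul x) \sum_(q <- hopf_comul p.1) t q.1 q.2 p.2 =
    \sum_(p <- hopf_comul x) \sum_(q <- hopf_comul p.2) t p.1 q.1 q.2;
  hopf_counit_linear : forall c x y,
    hopf_counit (c *: x + y) = c * hopf_counit x + hopf_counit y;
  hopf_counitM : forall x y, hopf_counit (x * y) = hopf_counit x * hopf_counit y;
  hopf_counit1 : hopf_counit 1 = 1;
  hopf_counitl : forall x, \sum_(p <- hopf_comul x) hopf_counit p.1 *: p.2 = x;
  hopf_counitr : forall x, \sum_(p <- hopf_comul x) hopf_counit p.2 *: p.1 = x;
  hopf_antipode_linear : forall c x y,
    hopf_antipode (c *: x + y) = c *: hopf_antipode x + hopf_antipode y;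
  hopf_antipodel : forall x,
    \sum_(p <- hopf_comul x) hopf_antipode p.1 * p.2 = (hopf_counit x)%:A;
  hopf_antipoder : forall x,
    \sum_(p <- hopf_comul x) p.1 * hopf_antipode p.2 = (hopf_counit x)%:A
}.

Definition star_mx (A : hopf_star_algebra) m n (u : 'M[A]_(m, n)) : 'M[A]_(n, m) :=
  map_mx (@hopf_star A) u^T.

Definition is_corep (A : hopf_star_algebra) n (u : 'M[A]_n) :=
  (forall i j, tensor_eq (hopf_comul (u i j))
     [seq (u i k, u k j) | k <- enum 'I_n]) /\
  (forall i j, hopf_counit (u i j) = (i == j)%:R).

Definition is_unitary_corep (A : hopf_star_algebra) n (u : 'M[A]_n) :=
  [/\ is_corep u, star_mx u *m u = 1%:M & u *m star_mx u = 1%:M].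

Definition is_matrix_coefficient (A : hopf_star_algebra) (x : A) :=
  exists n (u : 'M[A]_n) i j, is_unitary_corep u /\ x = u i j.

(* A compact quantum group G, given by its compact quantum group algebra A_G:
   a Hopf *-algebra spanned by the matrix coefficients of its finite-dimensional
   unitary corepresentations, which are the continuous finite-dimensional
   unitary representations of G. *)
Record compact_quantum_group := CompactQuantumGroup {
  cqg_alg :> hopf_star_algebra;
  cqg_spanned : forall x : cqg_alg, exists s : seq (C * cqg_alg),
    (forall p, p \in s -> is_matrix_coefficient p.2) /\
    x = \sum_(p <- s) p.1 *: p.2
}.

Section Representations.
Variable G : compact_quantum_group.

Record rep := Rep {
  rep_dim : nat;
  rep_mx : 'M[G]_rep_dim;
  rep_unitary : is_unitary_corep rep_mx
}.

Definition scalar_map m n (f : 'M[C]_(m, n)) : 'M[G]_(m, n) :=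
  map_mx (in_alg G) f.

Record rep_hom (X Y : rep) := RepHom {
  hom_mx :> 'M[C]_(rep_dim Y, rep_dim X);
  hom_intertwines : scalar_map hom_mx *m rep_mx X = rep_mx Y *m scalar_map hom_mx
}.


Lemma eq_mxtens_index m n (i k : 'I_m) (j l : 'I_n) :
  (mxtens_index (i, j) == mxtens_index (k, l)) = (i == k) && (j == l).
Proof. by rewrite (can_eq (@mxtens_indexK m n)) xpair_eqE. Qed.

Lemma tensor_corep m n (u : 'M[G]_m) (v : 'M[G]_n) :
  is_corep u -> is_corep v -> is_corep (u *t v).
Proof.
move=> [du eu] [dv ev]; split=> i j.
  case: (mxtens_indexP i) => i0 i1; case: (mxtens_indexP j) => j0 j1.
  rewrite tensmxE => b [bl br]; rewrite hopf_comulM //.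
  rewrite big_allpairs_dep /=.
  transitivity (\sum_(p <- hopf_comul (u i0 j0))
    \sum_(k < n) b (p.1 * v i1 k) (p.2 * v k j1)).
    apply: eq_bigr => p _; rewrite -big_enum -[RHS](big_map
      (fun k => (v i1 k, v k j1)) xpredT (fun q => b (p.1 * q.1) (p.2 * q.2))).
    apply: (dv i1 j1 (fun x y => b (p.1 * x) (p.2 * y))); split=> c x y z.
      by rewrite mulrDr -scalerAr bl.
    by rewrite mulrDr -scalerAr br.
  rewrite exchange_big /=.
  transitivity (\sum_(k < n) \sum_(l < m)
    b (u i0 l * v i1 k) (u l j0 * v k j1)).
    apply: eq_bigr => k _; rewrite -[RHS]big_enum -[RHS](big_map
      (fun l => (u i0 l, u l j0)) xpredT
      (fun q => b (q.1 * v i1 k) (q.2 * v k j1))).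
    apply: (du i0 j0 (fun x y => b (x * v i1 k) (y * v k j1))); split=> c x y z.
      by rewrite mulrDl -scalerAl bl.
    by rewrite mulrDl -scalerAl br.
  rewrite big_map big_enum /= exchange_big pair_big /=.
  rewrite (reindex (@mxtens_unindex m n)) /=; last first.
    by exists (@mxtens_index m n) => k _; rewrite (mxtens_indexK, mxtens_unindexK).
  by apply: eq_bigr => k _; rewrite !mxE !mxtens_indexK.
case: (mxtens_indexP i) => i0 i1; case: (mxtens_indexP j) => j0 j1.
by rewrite tensmxE hopf_counitM eu ev -natrM mulnb eq_mxtens_index.
Qed.

Lemma sum_mxtens_index (V : nmodType) m n (F : 'I_(m * n) -> V) :
  \sum_k F k = \sum_(i < m) \sum_(j < n) F (mxtens_index (i, j)).
Proof.
rewrite pair_big (reindex (@mxtens_index m n)) /=; last first.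
  by exists (@mxtens_unindex m n) => k _;
    rewrite (mxtens_indexK, mxtens_unindexK).
by apply: eq_bigr => -[].
Qed.

Lemma tensor_unitary_corep m n (u : 'M[G]_m) (v : 'M[G]_n) :
  is_unitary_corep u -> is_unitary_corep v -> is_unitary_corep (u *t v).
Proof.
have mulE p q r (a : 'M[G]_(p, q)) (b : 'M[G]_(q, r)) i j x y :
    \sum_k x * a i k * (b k j * y) = x * (a *m b) i j * y.
  rewrite mxE mulr_sumr mulr_suml.
  by apply: eq_bigr => k _; rewrite !mulrA.
have delta (i i' : 'I_m) (j j' : 'I_n) :
    (1%:M : 'M[G]_(m * n)) (mxtens_index (i, j)) (mxtens_index (i', j')) =
    (i == i')%:R * (j == j')%:R.
  by rewrite mxE -natrM mulnb eq_mxtens_index.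
move=> [cu u1 u2] [cv v1 v2]; split; first exact: tensor_corep.
  apply/matrixP => i j.
  case: (mxtens_indexP i) => i0 i1; case: (mxtens_indexP j) => j0 j1.
  rewrite delta mxE sum_mxtens_index exchange_big /=.
  transitivity (\sum_l star_mx v i1 l * (star_mx u *m u) i0 j0 * v l j1).
    apply: eq_bigr => l _; rewrite -mulE; apply: eq_bigr => k _.
    by rewrite !mxE !mxtens_indexK hopf_starM.
  rewrite u1 mxE.
  transitivity ((i0 == j0)%:R * (star_mx v *m v) i1 j1 : G); last first.
    by rewrite v1 mxE.
  rewrite [in RHS]mxE mulr_sumr; apply: eq_bigr => l _.
  by rewrite mulrA; congr (_ * _); apply: commr_nat.
apply/matrixP => i j.
case: (mxtens_indexP i) => i0 i1; case: (mxtens_indexP j) => j0 j1.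
rewrite delta mxE sum_mxtens_index.
transitivity (\sum_k u i0 k * (v *m star_mx v) i1 j1 * star_mx u k j0).
  apply: eq_bigr => k _; rewrite -mulE; apply: eq_bigr => l _.
  by rewrite !mxE !mxtens_indexK hopf_starM.
rewrite v2 mxE.
transitivity ((u *m star_mx u) i0 j0 * (i1 == j1)%:R : G); last first.
  by rewrite u2 mxE.
rewrite [in RHS]mxE mulr_suml; apply: eq_bigr => k _.
by rewrite -!mulrA; congr (_ * _); apply/esym/commr_nat.
Qed.

Lemma unit_unitary_corep : is_unitary_corep (1%:M : 'M[G]_1).
Proof.
have e1 : hopf_star (1 : G) = 1.
  by rewrite -[LHS]mulr1 -[X in _ * X]hopf_starK -hopf_starM mulr1 hopf_starK.
have e2 : star_mx (1%:M : 'M[G]_1) = 1%:M.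
  by apply/matrixP => i j; rewrite !mxE !ord1 eqxx.
split; last 2 first; rewrite ?e2 ?mulmx1 //.
split=> i j; rewrite !mxE !ord1 eqxx ?hopf_counit1 //.
move=> b bl; rewrite hopf_comul1 // big_map big_enum big_ord1 big_seq1 /=.
by rewrite !mxE.
Qed.

Definition unit_rep := Rep unit_unitary_corep.

Definition tensor_rep (X Y : rep) :=
  Rep (tensor_unitary_corep (rep_unitary X) (rep_unitary Y)).

Lemma id_intertwines (X : rep) :
  scalar_map 1%:M *m rep_mx X = rep_mx X *m scalar_map 1%:M.
Proof. by rewrite /scalar_map map_mx1 mul1mx mulmx1. Qed.

Definition id_hom (X : rep) : rep_hom X X := RepHom (id_intertwines X).

Lemma comp_intertwines X Y Z (g : rep_hom Y Z) (f : rep_hom X Y) :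
  scalar_map (g *m f) *m rep_mx X = rep_mx Z *m scalar_map (g *m f).
Proof.
rewrite /scalar_map map_mxM -mulmxA [map_mx _ f *m _]hom_intertwines mulmxA.
by rewrite [map_mx _ g *m _]hom_intertwines mulmxA.
Qed.

Definition comp_hom X Y Z (g : rep_hom Y Z) (f : rep_hom X Y) : rep_hom X Z :=
  RepHom (comp_intertwines g f).

Lemma linear_intertwines X Y (c : C) (f g : rep_hom X Y) :
  scalar_map (c *: (f : 'M_(_, _)) + g) *m rep_mx X =
  rep_mx Y *m scalar_map (c *: (f : 'M_(_, _)) + g).
Proof.
apply/matrixP => i j.
have /matrixP/(_ i j) := hom_intertwines f.
have /matrixP/(_ i j) := hom_intertwines g.
rewrite !mxE => eg ef.
transitivity (c *: (\sum_k (scalar_map f) i k * rep_mx X k j) +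
    \sum_k (scalar_map g) i k * rep_mx X k j).
  rewrite scaler_sumr -big_split; apply: eq_bigr => k _.
  by rewrite !mxE /= scalerDl mulrDl -scalerA scalerAl.
rewrite eg ef scaler_sumr -big_split; apply: eq_bigr => k _.
by rewrite !mxE /= scalerDl mulrDr -scalerA scalerAr.
Qed.

Definition linear_hom X Y (c : C) (f g : rep_hom X Y) : rep_hom X Y :=
  RepHom (linear_intertwines c f g).

Lemma star_scalar (c : C) : hopf_star (c%:A : G) = (c^*)%:A.
Proof.
have star0 : hopf_star (0 : G) = 0.
  have := hopf_star_antilinear (-1) (0 : G) 0.
  by rewrite scaler0 addr0 rmorphN1 scaleN1r addNr.
have star1 : hopf_star (1 : G) = 1.
  by rewrite -[LHS]mulr1 -[X in _ * X]hopf_starK -hopf_starM mulr1 hopf_starK.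
by rewrite -[c%:A]addr0 hopf_star_antilinear star1 star0 addr0.
Qed.

Lemma starD (x y : G) : hopf_star (x + y) = hopf_star x + hopf_star y.
Proof. by rewrite -[x]scale1r hopf_star_antilinear rmorph1 !scale1r. Qed.

Lemma star_mxM m n p (a : 'M[G]_(m, n)) (b : 'M[G]_(n, p)) :
  star_mx (a *m b) = star_mx b *m star_mx a.
Proof.
have star0 : hopf_star (0 : G) = 0 by have := star_scalar 0; rewrite rmorph0 !scale0r.
apply/matrixP => i j; rewrite !mxE (big_morph _ starD star0).
by apply: eq_bigr => k _; rewrite !mxE hopf_starM.
Qed.

Lemma dag_intertwines X Y (f : rep_hom X Y) :
  scalar_map (f^t*) *m rep_mx Y = rep_mx X *m scalar_map (f^t*).
Proof.
have [_ _ uX] := rep_unitary X; have [_ uY _] := rep_unitary Y.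
have e : star_mx (scalar_map f) = scalar_map (f^t*).
  by apply/matrixP => i j; rewrite !mxE /= star_scalar.
have := congr1 (fun M => rep_mx X *m star_mx M *m rep_mx Y) (hom_intertwines f).
by rewrite /= !star_mxM e !mulmxA uX mul1mx -!mulmxA uY mulmx1 => ->.
Qed.

Definition dag_hom X Y (f : rep_hom X Y) : rep_hom Y X := RepHom (dag_intertwines f).

Lemma tensor_intertwines X Y X' Y' (f : rep_hom X Y) (g : rep_hom X' Y') :
  scalar_map (f *t g) *m rep_mx (tensor_rep X X') =
  rep_mx (tensor_rep Y Y') *m scalar_map (f *t g).
Proof.
have /matrixP ef := hom_intertwines f; have /matrixP eg := hom_intertwines g.
apply/matrixP => i j.
case: (mxtens_indexP i) => i0 i1; case: (mxtens_indexP j) => j0 j1.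
transitivity ((scalar_map f *m rep_mx X) i0 j0 * (scalar_map g *m rep_mx X') i1 j1).
  rewrite !mxE sum_mxtens_index mulr_suml; apply: eq_bigr => k _.
  rewrite mulr_sumr; apply: eq_bigr => l _.
  by rewrite !mxE !mxtens_indexK /= -!scalerAl !mul1r -!scalerAr scalerA.
rewrite ef eg !mxE sum_mxtens_index mulr_suml; apply: eq_bigr => k _.
rewrite mulr_sumr; apply: eq_bigr => l _.
by rewrite !mxE !mxtens_indexK /= -!scalerAr !mulr1 -!scalerAl scalerA mulrC.
Qed.

Definition tensor_hom X Y X' Y' (f : rep_hom X Y) (g : rep_hom X' Y') :
    rep_hom (tensor_rep X X') (tensor_rep Y Y') :=
  @RepHom (tensor_rep X X') (tensor_rep Y Y') (f *t g) (tensor_intertwines f g).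

Lemma cast_intertwines (X Y : rep) (e : rep_dim X = rep_dim Y) :
  castmx (e, e) (rep_mx X) = rep_mx Y ->
  scalar_map (castmx (e, erefl) 1%:M) *m rep_mx X =
  rep_mx Y *m scalar_map (castmx (e, erefl) 1%:M).
Proof.
case: Y e => n u hu /= e <-; case: n / e u hu => u hu.
by rewrite /scalar_map !castmx_id map_mx1 mul1mx mulmx1.
Qed.

Definition cast_hom (X Y : rep) (e : rep_dim X = rep_dim Y)
    (h : castmx (e, e) (rep_mx X) = rep_mx Y) : rep_hom X Y :=
  RepHom (cast_intertwines h).

Lemma tensor_repA X Y Z (e := esym (mulnA (rep_dim X) (rep_dim Y) (rep_dim Z))) :
  castmx (e, e) (rep_mx (tensor_rep (tensor_rep X Y) Z)) =
  rep_mx (tensor_rep X (tensor_rep Y Z)).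
Proof.
have E (i : 'I_(rep_dim X)) (j : 'I_(rep_dim Y)) (k : 'I_(rep_dim Z)) :
    cast_ord (esym e) (mxtens_index (i, mxtens_index (j, k))) =
    mxtens_index (mxtens_index (i, j), k).
  by apply: val_inj; rewrite /= mulnDl addnA mulnA.
apply/matrixP => i j; rewrite castmxE.
case: (mxtens_indexP i) => i0 {}i; case: (mxtens_indexP i) => i1 i2.
case: (mxtens_indexP j) => j0 {}j; case: (mxtens_indexP j) => j1 j2.
by rewrite !E !mxE !mxtens_indexK /= mulrA.
Qed.

Lemma tensor_rep1l X (e := mul1n (rep_dim X)) :
  castmx (e, e) (rep_mx (tensor_rep unit_rep X)) = rep_mx X.
Proof. by rewrite /= tens_scalar_mx castmx_comp castmx_id scale1r. Qed.

Lemma tensor_rep1r X (e := muln1 (rep_dim X)) :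
  castmx (e, e) (rep_mx (tensor_rep X unit_rep)) = rep_mx X.
Proof.
have E (i : 'I_(rep_dim X)) : cast_ord (esym e) i = mxtens_index (i, ord0).
  by apply: val_inj; rewrite /= muln1 addn0.
by apply/matrixP => i j; rewrite castmxE !E !mxE !mxtens_indexK /= mulr1.
Qed.

Definition assoc_hom X Y Z :
    rep_hom (tensor_rep (tensor_rep X Y) Z) (tensor_rep X (tensor_rep Y Z)) :=
  @cast_hom (tensor_rep (tensor_rep X Y) Z) (tensor_rep X (tensor_rep Y Z)) _
    (tensor_repA X Y Z).
Definition unitl_hom X : rep_hom (tensor_rep unit_rep X) X :=
  @cast_hom (tensor_rep unit_rep X) X _ (tensor_rep1l X).
Definition unitr_hom X : rep_hom (tensor_rep X unit_rep) X :=
  @cast_hom (tensor_rep X unit_rep) X _ (tensor_rep1r X).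

(* The unitary multiplicators and the unitor are part of the structure. *)
Record fibre_functor := FibreFunctor {
  ff_obj :> rep -> nat;
  ff_hom : forall X Y, rep_hom X Y -> 'M[C]_(ff_obj Y, ff_obj X);
  ff_mult : forall X Y, 'M[C]_(ff_obj (tensor_rep X Y), ff_obj X * ff_obj Y);
  ff_unit : 'M[C]_(ff_obj unit_rep, 1);
  ff_id : forall X, ff_hom (id_hom X) = 1%:M;
  ff_comp : forall X Y Z (g : rep_hom Y Z) (f : rep_hom X Y),
    ff_hom (comp_hom g f) = ff_hom g *m ff_hom f;
  ff_linear : forall X Y c (f g : rep_hom X Y),
    ff_hom (linear_hom c f g) = c *: ff_hom f + ff_hom g;
  ff_dag : forall X Y (f : rep_hom X Y), ff_hom (dag_hom f) = (ff_hom f)^t*;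
  ff_mult_unitary : forall X Y, is_unitary (ff_mult X Y);
  ff_unit_unitary : is_unitary ff_unit;
  ff_mult_natural : forall X Y X' Y' (f : rep_hom X Y) (g : rep_hom X' Y'),
    ff_hom (tensor_hom f g) *m ff_mult X X' =
    ff_mult Y Y' *m (ff_hom f *t ff_hom g);
  ff_assoc : forall X Y Z,
    ff_hom (assoc_hom X Y Z) *m ff_mult (tensor_rep X Y) Z *m
      (ff_mult X Y *t 1%:M) =s
    ff_mult X (tensor_rep Y Z) *m (1%:M *t ff_mult Y Z);
  ff_unitl : forall X,
    ff_hom (unitl_hom X) *m ff_mult unit_rep X *m (ff_unit *t 1%:M) =s
    (1%:M : 'M[C]_(ff_obj X));
  ff_unitr : forall X,
    ff_hom (unitr_hom X) *m ff_mult X unit_rep *m (1%:M *t ff_unit) =s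
    (1%:M : 'M[C]_(ff_obj X))
}.

Lemma tens11 m n : (1%:M : 'M[C]_m) *t (1%:M : 'M_n) = 1%:M.
Proof.
apply/matrixP => i j.
case: (mxtens_indexP i) => i0 i1; case: (mxtens_indexP j) => j0 j1.
by rewrite !mxE !mxtens_indexK /= -natrM mulnb eq_mxtens_index.
Qed.

Lemma unitary1 n : is_unitary (1%:M : 'M[C]_n).
Proof. by rewrite /is_unitary trmx1 map_mx1 mulmx1. Qed.

Lemma castmx_undo m n (e : n = m) (e1 : m = m) (e2 : n = m) :
  castmx (e1, e2) (castmx (e, erefl) (1%:M : 'M[C]_n)) = 1%:M.
Proof. by case: m / e e1 e2 => e1 e2; rewrite !castmx_id. Qed.

Definition canonical_ff : fibre_functor.
Proof.
refine (@FibreFunctor (@rep_dim) (fun X Y f => f)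
  (fun X Y => 1%:M) 1%:M _ _ _ _ _ _ _ _ _ _) => //=.
- by move=> *; apply: unitary1.
- exact: unitary1.
- by move=> *; rewrite mulmx1 mul1mx.
- by move=> X Y Z; rewrite !tens11 !mulmx1 /strict_eq castmx_undo.
- by move=> X; rewrite !tens11 !mulmx1 /strict_eq castmx_undo.
- by move=> X; rewrite !tens11 !mulmx1 /strict_eq castmx_undo.
Defined.

Local Notation id_ n := (1%:M : 'M[C]_n) (only parsing).

Definition ff_iso (F1 F2 : fibre_functor) : Prop :=
  exists phi : forall X, 'M[C]_(F2 X, F1 X),
  [/\ forall X, is_unitary (phi X),
      forall X Y (f : rep_hom X Y), ff_hom F2 f *m phi X = phi Y *m ff_hom F1 f,
      forall X Y, phi (tensor_rep X Y) *m ff_mult F1 X Y =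
        ff_mult F2 X Y *m (phi X *t phi Y) &
      phi unit_rep *m ff_unit F1 = ff_unit F2].

Record upt_data (F1 F2 : fibre_functor) := UptData {
  upt_dim : nat;
  upt_mx :> forall X, 'M[C]_(upt_dim * F2 X, F1 X * upt_dim)
}.

Definition is_upt F1 F2 (al : upt_data F1 F2) : Prop :=
  let h := upt_dim al in
  [/\ forall X, is_unitary (al X),
      forall X Y (f : rep_hom X Y),
        (id_ h *t ff_hom F2 f) *m al X = al Y *m (ff_hom F1 f *t id_ h),
      forall X Y,
        al (tensor_rep X Y) *m (ff_mult F1 X Y *t id_ h) =s
        (id_ h *t ff_mult F2 X Y) *s (al X *t id_ (F2 Y)) *s (id_ (F1 X) *t al Y) &
      al unit_rep *m (ff_unit F1 *t id_ h) =s id_ h *t ff_unit F2].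

Definition comp_upt F1 F2 F3 (al : upt_data F1 F2) (be : upt_data F2 F3) :
    upt_data F1 F3 :=
  let h := upt_dim al in let k := upt_dim be in
  @UptData F1 F3 (h * k) (fun X =>
    scast ((id_ h *t be X) *s (al X *t id_ k))).

Definition id_upt F : upt_data F F := @UptData F F 1 (fun X => scast (id_ (F X))).

(* sum_i e_i^* (x) e_i and its transpose *)
Definition coev h : 'M[C]_(h * h, 1) :=
  \col_k ((mxtens_unindex k).1 == (mxtens_unindex k).2)%:R.
Definition ev h : 'M[C]_(1, h * h) := (coev h)^T.

Definition dual_upt F1 F2 (al : upt_data F1 F2) : upt_data F2 F1 :=
  let h := upt_dim al in
  @UptData F2 F1 h (fun X =>
    scast ((id_ h *t id_ (F1 X) *t ev h) *s
           (id_ h *t (al X)^t* *t id_ h) *s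
           (coev h *t id_ (F2 X) *t id_ h))).

Definition is_modification F1 F2 (al be : upt_data F1 F2)
    (f : 'M[C]_(upt_dim be, upt_dim al)) : Prop :=
  forall X, be X *m (id_ (F1 X) *t f) = (f *t id_ (F2 X)) *m al X.

(* The structure maps of a monoid in Hilb.  The composition, tensor product and
   dagger of modifications are those of the underlying linear maps, so the same
   equations define Frobenius monoids in Hilb and in End(F). *)
Record monoid_data := MonoidData {
  mon_dim : nat;
  mon_mul : 'M[C]_(mon_dim, mon_dim * mon_dim);
  mon_one : 'M[C]_(mon_dim, 1)
}.

Definition is_special_frobenius (A : monoid_data) : Prop :=
  let a := mon_dim A in let mu := mon_mul A in let u := mon_one A in
  [/\ mu *m (mu *t id_ a) =s mu *m (id_ a *t mu),
      mu *m (u *t id_ a) =s id_ a,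
      mu *m (id_ a *t u) =s id_ a,
      (mu *t id_ a) *s (id_ a *t mu^t*) = mu^t* *m mu /\
      (id_ a *t mu) *s (mu^t* *t id_ a) = mu^t* *m mu &
      mu *m mu^t* = id_ a].

Definition star_iso (A B : monoid_data) : Prop :=
  exists f : 'M[C]_(mon_dim B, mon_dim A),
  [/\ is_unitary f, f *m mon_mul A = mon_mul B *m (f *t f) &
      f *m mon_one A = mon_one B].

Definition pair_mul h : 'M[C]_(h * h, (h * h) * (h * h)) :=
  scast ((sqrtC h%:R)^-1 *: (id_ h *t (coev h)^t* *t id_ h)).
Definition pair_one h : 'M[C]_(h * h, 1) := sqrtC h%:R *: (ev h)^t*.

(* H (x) H^* for H = C^h *)
Definition pair_monoid h : monoid_data := MonoidData (pair_mul h) (pair_one h).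

Section EndF.
Variable F : fibre_functor.

Record end_monoid_data := EndMonoidData {
  em_upt :> upt_data F F;
  em_mul : 'M[C]_(upt_dim em_upt, upt_dim em_upt * upt_dim em_upt);
  em_one : 'M[C]_(upt_dim em_upt, 1)
}.

Definition em_monoid (A : end_monoid_data) : monoid_data :=
  MonoidData (em_mul A) (em_one A).

Definition is_simple_frobenius (A : end_monoid_data) : Prop :=
  [/\ is_upt A,
      @is_modification F F (comp_upt A A) A (em_mul A),
      @is_modification F F (id_upt F) A (em_one A),
      is_special_frobenius (em_monoid A) &
      exists2 h, (0 < h)%N & star_iso (em_monoid A) (pair_monoid h)].

Record simple_frobenius := SimpleFrobenius {
  sf_data :> end_monoid_data;
  sf_simple : is_simple_frobenius sf_data
}.

Definition em_cup (A : end_monoid_data) := (em_mul A)^t* *m em_one A.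
Definition em_cap (A : end_monoid_data) := (em_one A)^t* *m em_mul A.

Record bimod_data (A B : end_monoid_data) := BimodData {
  bm_upt :> upt_data F F;
  bm_act : 'M[C]_(upt_dim bm_upt, upt_dim A * upt_dim bm_upt * upt_dim B)
}.

Definition is_bimod A B (M : bimod_data A B) : Prop :=
  let a := upt_dim A in let m := upt_dim M in let b := upt_dim B in
  [/\ is_upt M,
      @is_modification F F (comp_upt (comp_upt A M) B) M (bm_act M),
      bm_act M *s (em_mul A *t id_ m *t em_mul B) =s
        bm_act M *s (id_ a *t bm_act M *t id_ b),
      bm_act M *m (em_one A *t id_ m *t em_one B) =s id_ m &
      (em_cap A *t id_ m *t em_cap B) *s (id_ a *t (bm_act M)^t* *t id_ b) =s
        bm_act M].

Definition bimod_iso A B (M N : bimod_data A B) : Prop :=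
  exists f : 'M[C]_(upt_dim N, upt_dim M),
  [/\ is_unitary f, is_modification f &
      f *m bm_act M = bm_act N *m (id_ (upt_dim A) *t f *t id_ (upt_dim B))].

Definition regular_bimod (A : end_monoid_data) : bimod_data A A :=
  @BimodData A A A (em_mul A *m (em_mul A *t id_ (upt_dim A))).

Definition left_act A B (M : bimod_data A B) :
    'M[C]_(upt_dim M, upt_dim A * upt_dim M) :=
  scast (bm_act M *m (id_ (upt_dim A) *t id_ (upt_dim M) *t em_one B)).
Definition right_act A B (M : bimod_data A B) :
    'M[C]_(upt_dim M, upt_dim M * upt_dim B) :=
  scast (bm_act M *m (em_one A *t id_ (upt_dim M) *t id_ (upt_dim B))).

Definition rel_tensor_idem A B D (M : bimod_data A B) (N : bimod_data B D) :
    'M[C]_(upt_dim M * upt_dim N) :=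
  let m := upt_dim M in let n := upt_dim N in
  scast ((bm_act M *t bm_act N) *s
         (em_one A *t id_ m *t em_cup B *t id_ n *t em_one D)).

(* P, with the isometry i, is a relative tensor product of M and N over B. *)
Definition is_rel_tensor A B D (M : bimod_data A B) (N : bimod_data B D)
    (P : bimod_data A D) (i : 'M[C]_(upt_dim M * upt_dim N, upt_dim P)) : Prop :=
  [/\ is_upt P,
      @is_modification F F P (comp_upt M N) i,
      i^t* *m i = 1%:M,
      i *m i^t* = rel_tensor_idem M N &
      bm_act P = i^t* *m (left_act M *t right_act N) *s
                 (id_ (upt_dim A) *t i *t id_ (upt_dim D))].

Definition morita_equiv (A B : end_monoid_data) : Prop :=
  exists (M : bimod_data A B) (N : bimod_data B A),
  [/\ is_bimod M, is_bimod N,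
      exists P i, @is_rel_tensor A B A M N P i /\ bimod_iso P (regular_bimod A) &
      exists Q j, @is_rel_tensor B A B N M Q j /\ bimod_iso Q (regular_bimod B)].

End EndF.

Definition upt_monoid F1 F2 (al : upt_data F1 F2) : end_monoid_data F1 :=
  @EndMonoidData F1 (comp_upt al (dual_upt al))
    (pair_mul (upt_dim al)) (pair_one (upt_dim al)).

Definition nonzero_upt F1 F2 (al : upt_data F1 F2) : Prop :=
  is_upt al /\ (0 < upt_dim al)%N.

Record accessible_ff (F : fibre_functor) := AccessibleFF {
  acc_ff :> fibre_functor;
  acc_upt : exists al : upt_data F acc_ff, nonzero_upt al
}.

End Representations.
End CompactQuantumGroups.

(* The set of classes [set y | E x y] of an equivalence relation E. *)
Definition quotient (T : Type) (E : T -> T -> Prop) : Type :=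
  {c : T -> Prop | exists x, c = E x}.

Definition class_of (T : Type) (E : T -> T -> Prop) (x : T) : quotient E :=
  exist _ (E x) (ex_intro (fun y => E x = E y) x erefl).

Section Classes.
Variables (R : realType) (G : compact_quantum_group R) (F : fibre_functor G).

Definition accessible_iso (F1 F2 : accessible_ff F) : Prop := ff_iso F1 F2.
Definition simple_morita (A B : simple_frobenius F) : Prop := morita_equiv A B.

End Classes.

(* Main.v *)
From mathcomp Require Import all_boot all_order all_algebra.
From mathcomp Require Import reals boolp classical_sets.
From mathcomp.real_closed Require Import complex mxtens.
From mathcomp Require Import ring.
Require Import Defs.

(** A transformation alpha : F -> F' on the space C^h is handled through its
    blocks: for every representation X an h x h family of maps
    alpha^ij : F(X) -> F'(X).  In this form composition multiplies blocks, the
    dual takes adjoints of blocks, and the axioms become identities between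
    sums of products of blocks ([is_uptP], [comp_upt_blk], [dual_upt_blk]).
    The correspondence then rests on five facts.

    The dual of a transformation out of the canonical functor is unitary
    ([upt_dual_unitary]).  Unitarity of alpha gives only two of the four
    orthogonality relations between blocks; the other two say that the
    componentwise transpose of alpha is unitary.  They hold because the complex
    conjugate of X embeds, up to multiplicity, into a representation Y of G, so
    that naturality of alpha against the invariant vectors of the tensor
    product of X and Y yields positive matrices Q and Q' that satisfy the missing
    relations up to a twist.  A trace computation shows that Q' alpha^ij =
    alpha^ij Q, which removes the twist.

    With the dual available, alpha (x) alpha^* is a special Frobenius monoid in
    End(F) whose underlying monoid is that of matrices, so it is simple
    ([upt_monoid_simple]).

    Every simple monoid arises in this way ([simple_frobenius_split]).  In a
    basis identifying it with the monoid of matrices, the blocks of the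
    underlying transformation are, for each X, a system of matrix units with
    coefficients in End(F(X)).  The range of a diagonal unit is the new space F'(X); it comes
    with a family alpha^ij : F(X) -> F'(X), and naturality, multiplicators and
    unitor of F' are forced because the ranges of the alpha^ij span F'(X).

    If alpha and beta have the same target, then alpha (x) beta^* and
    beta (x) alpha^* are mutually inverse bimodules ([morita_same_target]); an
    isomorphism of targets reduces to this case by composing alpha with it.

    Conversely, let M and N be mutually inverse bimodules between
    alpha (x) alpha^* and beta (x) beta^*, with alpha : F -> F1 and
    beta : F -> F2 ([morita_ff_iso]).  The two matrix monoids act on M by matrix
    units, hence M is a multiple of H_alpha (x) H_beta^*, and comparing traces in
    M (x) N shows that the multiplicities of M and N have product one.  So M is
    H_alpha (x) H_beta^* with its obvious action, and the blocks of the
    underlying transformation factor as (beta^lq)^* phi alpha^ip with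
    phi : F1(X) -> F2(X); this phi is the required unitary monoidal isomorphism.

    Morita equivalence therefore corresponds to isomorphism of the targets under
    the relation that A is isomorphic to alpha (x) alpha^*, which is total on
    both sides, and such a relation induces a bijection of the quotients
    ([quotient_bijection]). *)

Set Implicit Arguments.
Unset Strict Implicit.
Unset Printing Implicit Defensive.

Import Order.TTheory GRing.Theory Num.Theory.
Local Open Scope ring_scope.
Local Open Scope sesquilinear_scope.

(** * Matrices between tensor products *)

Notation idx := mxtens_index.

Section CastIndex.

Lemma cast_idxA a b c (e : (a * (b * c) = a * b * c)%N) i j k :
  cast_ord e (idx (i, idx (j, k))) = idx (idx (i, j), k).
Proof. by apply: val_inj; rewrite /= mulnDl addnA mulnA. Qed.

Lemma cast_idxAV a b c (e : (a * b * c = a * (b * c))%N) i j k :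
  cast_ord e (idx (idx (i, j), k)) = idx (i, idx (j, k)).
Proof. by apply: val_inj; rewrite /= mulnDl addnA mulnA. Qed.

Lemma cast_idx1l b (e : (1 * b = b)%N) i j : cast_ord e (idx (i, j)) = j.
Proof. by apply: val_inj; rewrite /= ord1. Qed.

Lemma cast_idx1r b (e : (b * 1 = b)%N) i j : cast_ord e (idx (i, j)) = i.
Proof. by apply: val_inj; rewrite /= ord1 muln1 addn0. Qed.

Lemma cast_1lidx b (e : (b = 1 * b)%N) j : cast_ord e j = idx (ord0, j).
Proof. by apply: val_inj. Qed.

Lemma cast_1ridx b (e : (b = b * 1)%N) j : cast_ord e j = idx (j, ord0).
Proof. by apply: val_inj; rewrite /= muln1 addn0. Qed.

Lemma cast_idx_swap1 b (e : (1 * b = b * 1)%N) i j :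
  cast_ord e (idx (i, j)) = idx (j, ord0).
Proof. by apply: val_inj; rewrite /= ord1 muln1 addn0. Qed.

Lemma cast_1lidx2 b c (e : (b * c = 1 * b * c)%N) i j :
  cast_ord e (idx (i, j)) = idx (idx (ord0, i), j).
Proof. by apply: val_inj; rewrite /= mul0n add0n. Qed.

Lemma cast_idxA2 a b c d (e : (a * b * c * d = a * (b * c) * d)%N) i j k l :
  cast_ord e (idx (idx (idx (i, j), k), l)) = idx (idx (i, idx (j, k)), l).
Proof. by apply: val_inj; rewrite /= !mulnDl -!mulnA !addnA. Qed.

Lemma cast_idxAAV a b c d (e : (a * (b * c) * d = a * b * (c * d))%N) i j k l :
  cast_ord e (idx (idx (i, idx (j, k)), l)) = idx (idx (i, j), idx (k, l)).
Proof. by apply: val_inj; rewrite /= !mulnDl -!mulnA !addnA. Qed.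

Lemma cast_idxAA a b c d (e : (a * b * (c * d) = a * (b * c) * d)%N) i j k l :
  cast_ord e (idx (idx (i, j), idx (k, l))) = idx (idx (i, idx (j, k)), l).
Proof. by apply: val_inj; rewrite /= !mulnDl -!mulnA !addnA. Qed.

End CastIndex.

Section StrictEntries.
Variable T : pzRingType.

Lemma one_mxE n (i j : 'I_n) : (1%:M : 'M[T]_n) i j = (i == j)%:R.
Proof. by rewrite mxE. Qed.

Lemma strict_compE p m n q (g : 'M[T]_(p, m)) (f : 'M[T]_(n, q)) e i j :
  strict_comp g f e i j = \sum_k g i (cast_ord e k) * f k j.
Proof.
case: m / e g => g; rewrite /strict_comp castmx_id mxE.
by apply: eq_bigr => k _; rewrite cast_ord_id.
Qed.

Lemma strict_castE m n m' n' (f : 'M[T]_(m, n)) em en (i : 'I_m') (j : 'I_n') :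
  strict_cast f em en i j = f (cast_ord (esym em) i) (cast_ord (esym en) j).
Proof. exact: castmxE. Qed.

Lemma strict_eqP m n m' n' (f : 'M[T]_(m, n)) (g : 'M[T]_(m', n')) em en :
  strict_eq f g em en <->
  forall i j, f i j = g (cast_ord em i) (cast_ord en j).
Proof.
case: m' / em g; case: n' / en => g; rewrite /strict_eq castmx_id.
split=> [-> i j|h]; first by rewrite !cast_ord_id.
by apply/matrixP => i j; rewrite h !cast_ord_id.
Qed.

Lemma sum_idx (V : nmodType) m n (F : 'I_(m * n) -> V) :
  \sum_k F k = \sum_i \sum_j F (idx (i, j)).
Proof. exact: sum_mxtens_index. Qed.

Lemma big_pick (V : nmodType) n (F : 'I_n -> V) i :
  (forall j, (j == i) = false -> F j = 0) -> \sum_j F j = F i.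
Proof. by move=> h; rewrite (bigD1 i) //= big1 ?addr0 // => j /negPf/h. Qed.

Lemma sum_deltal n (F : 'I_n -> T) i : \sum_j (i == j)%:R * F j = F i.
Proof.
rewrite (bigD1 i) //= eqxx mul1r big1 ?addr0 // => j /negPf.
by rewrite eq_sym => ->; rewrite mul0r.
Qed.

Lemma sum_deltar n (F : 'I_n -> T) i : \sum_j F j * (j == i)%:R = F i.
Proof.
rewrite (bigD1 i) //= eqxx mulr1 big1 ?addr0 // => j /negPf ->.
by rewrite mulr0.
Qed.

Lemma mul_tens1l h q p c (B : 'M[T]_(p, q)) (M : 'M[T]_(h * q, c)) i y x :
  ((1%:M *t B) *m M) (idx (i, y)) x = \sum_z B y z * M (idx (i, z)) x.
Proof.
rewrite mxE sum_idx exchange_big /=; apply: eq_bigr => z _.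
rewrite -[RHS](sum_deltal (fun j => B y z * M (idx (j, z)) x)).
by apply: eq_bigr => j _; rewrite tensmxE mxE mulrA.
Qed.

Lemma mul_tens1r h q p c (A : 'M[T]_(p, q)) (M : 'M[T]_(q * h, c)) y i x :
  ((A *t 1%:M) *m M) (idx (y, i)) x = \sum_z A y z * M (idx (z, i)) x.
Proof.
rewrite mxE sum_idx; apply: eq_bigr => z _.
rewrite -[RHS](sum_deltal (fun j => A y z * M (idx (z, j)) x)).
apply: eq_bigr => j _; rewrite tensmxE mxE -mulrA mulrA.
by case: (i == j); rewrite ?mulr1 ?mul1r // mulr0 !mul0r.
Qed.

Lemma mul1l_tens h q p c (B : 'M[T]_(q, p)) (M : 'M[T]_(c, h * q)) x i y :
  (M *m (1%:M *t B)) x (idx (i, y)) = \sum_z M x (idx (i, z)) * B z y.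
Proof.
rewrite mxE sum_idx exchange_big /=; apply: eq_bigr => z _.
rewrite -[RHS](sum_deltar (fun j => M x (idx (j, z)) * B z y)).
apply: eq_bigr => j _; rewrite tensmxE mxE.
by case: (j == i); rewrite ?mulr1 ?mul1r // !mulr0 mul0r mulr0.
Qed.

Lemma mul1r_tens h q p c (A : 'M[T]_(q, p)) (M : 'M[T]_(c, q * h)) x y i :
  (M *m (A *t 1%:M)) x (idx (y, i)) = \sum_z M x (idx (z, i)) * A z y.
Proof.
rewrite mxE sum_idx; apply: eq_bigr => z _.
rewrite -[RHS](sum_deltar (fun j => M x (idx (z, j)) * A z y)).
by apply: eq_bigr => j _; rewrite tensmxE mxE mulrA.
Qed.

End StrictEntries.

Section Blocks.
Variable C : numClosedFieldType.

(** In the rows the multiplicity space comes first and in the columns last, as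
    for a component F1(X) (x) H -> H (x) F2(X). *)
Definition blk h q p k (M : 'M[C]_(h * q, p * k)) (i : 'I_h) (j : 'I_k) :
    'M[C]_(q, p) :=
  \matrix_(y, x) M (idx (i, y)) (idx (x, j)).

Lemma blkE h q p k (M : 'M[C]_(h * q, p * k)) i j y x :
  M (idx (i, y)) (idx (x, j)) = blk M i j y x.
Proof. by rewrite mxE. Qed.

Lemma blkP h q p k (M N : 'M[C]_(h * q, p * k)) :
  (forall i j, blk M i j = blk N i j) <-> M = N.
Proof.
split=> [e|-> //]; apply/matrixP => i j.
case: (mxtens_indexP i) => {}i y; case: (mxtens_indexP j) => x {}j.
by rewrite !blkE e.
Qed.

Definition mx_of_blocks h q p k (a : 'I_h -> 'I_k -> 'M[C]_(q, p)) :
    'M[C]_(h * q, p * k) :=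
  \matrix_(r, c) a (mxtens_unindex r).1 (mxtens_unindex c).2
        (mxtens_unindex r).2 (mxtens_unindex c).1.

Lemma blk_mx_of_blocks h q p k (a : 'I_h -> 'I_k -> 'M[C]_(q, p)) i j :
  blk (mx_of_blocks a) i j = a i j.
Proof. by apply/matrixP => y x; rewrite !mxE !mxtens_indexK. Qed.

Lemma blk_mull h q q' p k (B : 'M[C]_(q', q)) (M : 'M[C]_(h * q, p * k)) i j :
  blk ((1%:M *t B) *m M) i j = B *m blk M i j.
Proof.
apply/matrixP => y x; rewrite mxE mul_tens1l mxE.
by apply: eq_bigr => z _; rewrite !mxE.
Qed.

Lemma blk_mulr h q p p' k (A : 'M[C]_(p, p')) (M : 'M[C]_(h * q, p * k)) i j :
  blk (M *m (A *t 1%:M)) i j = blk M i j *m A.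
Proof.
apply/matrixP => y x; rewrite mxE mul1r_tens mxE.
by apply: eq_bigr => z _; rewrite !mxE.
Qed.

Lemma blk_scalel h h' q p k (f : 'M[C]_(h', h)) (M : 'M[C]_(h * q, p * k)) i j :
  blk ((f *t 1%:M) *m M) i j = \sum_l f i l *: blk M l j.
Proof.
apply/matrixP => y x; rewrite mxE mul_tens1r summxE.
by apply: eq_bigr => z _; rewrite !mxE.
Qed.

Lemma blk_scaler h q p k k' (f : 'M[C]_(k, k')) (M : 'M[C]_(h * q, p * k)) i j :
  blk (M *m (1%:M *t f)) i j = \sum_l f l j *: blk M i l.
Proof.
apply/matrixP => y x; rewrite mxE mul1l_tens summxE.
by apply: eq_bigr => z _; rewrite !mxE mulrC.
Qed.

Lemma mx_delta n m (i j : 'I_n) (k l : 'I_m) :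
  (1%:M : 'M[C]_(n * m)) (idx (i, k)) (idx (j, l)) = (i == j)%:R * (k == l)%:R.
Proof. by rewrite mxE eq_mxtens_index -natrM mulnb. Qed.

Lemma mx_deltaM n (b : bool) (i j : 'I_n) :
  (b%:R%:M : 'M[C]_n) i j = b%:R * (i == j)%:R.
Proof. by rewrite mxE mulr_natr. Qed.

Lemma blk_isometryP h q p k (M : 'M[C]_(h * q, p * k)) :
  M^t* *m M = 1%:M <->
  forall j j', \sum_i (blk M i j)^t* *m blk M i j' = (j == j')%:R%:M.
Proof.
have E j j' x x' : (M^t* *m M) (idx (x, j)) (idx (x', j')) =
    (\sum_i (blk M i j)^t* *m blk M i j') x x'.
  rewrite mxE sum_idx summxE; apply: eq_bigr => i _.
  by rewrite mxE; apply: eq_bigr => y _; rewrite !mxE.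
split=> [e j j'|e].
  by apply/matrixP => x x'; rewrite -E e mx_delta mx_deltaM mulrC.
apply/matrixP => a b.
case: (mxtens_indexP a) => x j; case: (mxtens_indexP b) => x' j'.
by rewrite E e mx_delta mx_deltaM mulrC.
Qed.

Lemma blk_coisometryP h q p k (M : 'M[C]_(h * q, p * k)) :
  M *m M^t* = 1%:M <->
  forall i i', \sum_j blk M i j *m (blk M i' j)^t* = (i == i')%:R%:M.
Proof.
have E i i' y y' : (M *m M^t*) (idx (i, y)) (idx (i', y')) =
    (\sum_j blk M i j *m (blk M i' j)^t*) y y'.
  rewrite mxE sum_idx exchange_big summxE; apply: eq_bigr => j _.
  by rewrite mxE; apply: eq_bigr => x _; rewrite !mxE.
split=> [e i i'|e].
  by apply/matrixP => y y'; rewrite -E e mx_delta mx_deltaM.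
apply/matrixP => a b.
case: (mxtens_indexP a) => i y; case: (mxtens_indexP b) => i' y'.
by rewrite E e mx_delta mx_deltaM.
Qed.

Lemma dagM m n p (A : 'M[C]_(m, n)) (B : 'M[C]_(n, p)) :
  (A *m B)^t* = B^t* *m A^t*.
Proof. by rewrite trmx_mul map_mxM. Qed.

Lemma dag_tens m n p q (A : 'M[C]_(m, n)) (B : 'M[C]_(p, q)) :
  (A *t B)^t* = A^t* *t B^t*.
Proof. by rewrite trmx_tens map_mxT. Qed.

Lemma dag1 n : (1%:M : 'M[C]_n)^t* = 1%:M.
Proof. by rewrite trmx1 map_mx1. Qed.

Lemma dagZ m n a (A : 'M[C]_(m, n)) : (a *: A)^t* = a^* *: A^t*.
Proof. by rewrite linearZ map_mxZ. Qed.

Lemma dag_sum m n (I : Type) (r : seq I) (P : pred I) (F : I -> 'M[C]_(m, n)) :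
  (\sum_(i <- r | P i) F i)^t* = \sum_(i <- r | P i) (F i)^t*.
Proof. by rewrite !raddf_sum. Qed.

Lemma dagB m n (A B : 'M[C]_(m, n)) : (A - B)^t* = A^t* - B^t*.
Proof. by rewrite raddfB map_mxB. Qed.

Lemma dag_scalar n (c : C) : (c%:M : 'M[C]_n)^t* = (c^*)%:M.
Proof. by rewrite tr_scalar_mx map_scalar_mx. Qed.

Lemma tensmx11 m n : (1%:M : 'M[C]_m) *t (1%:M : 'M_n) = 1%:M.
Proof.
apply/matrixP => i j.
case: (mxtens_indexP i) => i0 i1; case: (mxtens_indexP j) => j0 j1.
by rewrite mx_delta tensmxE !mxE.
Qed.

Lemma tens_suml m n p q (I : Type) (r : seq I) (P : pred I)
    (F : I -> 'M[C]_(m, n)) (B : 'M[C]_(p, q)) :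
  (\sum_(i <- r | P i) F i) *t B = \sum_(i <- r | P i) F i *t B.
Proof.
apply/matrixP => i j; rewrite summxE mxE summxE mulr_suml.
by apply: eq_bigr => k _; rewrite mxE.
Qed.

Lemma tens_sumr m n p q (I : Type) (r : seq I) (P : pred I)
    (F : I -> 'M[C]_(m, n)) (B : 'M[C]_(p, q)) :
  B *t (\sum_(i <- r | P i) F i) = \sum_(i <- r | P i) B *t F i.
Proof.
apply/matrixP => i j; rewrite summxE mxE summxE mulr_sumr.
by apply: eq_bigr => k _; rewrite mxE.
Qed.

Lemma tensZl m n p q a (A : 'M[C]_(m, n)) (B : 'M[C]_(p, q)) :
  (a *: A) *t B = a *: (A *t B).
Proof. by apply/matrixP => i j; rewrite !mxE mulrA. Qed.

Lemma tensZr m n p q a (A : 'M[C]_(m, n)) (B : 'M[C]_(p, q)) :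
  A *t (a *: B) = a *: (A *t B).
Proof. by apply/matrixP => i j; rewrite !mxE mulrCA. Qed.

Lemma sum_delta_scale m n k (F : 'I_k -> 'M[C]_(m, n)) i :
  \sum_j (i == j)%:R *: F j = F i.
Proof.
rewrite (bigD1 i) //= eqxx scale1r big1 ?addr0 // => j /negPf.
by rewrite eq_sym => ->; rewrite scale0r.
Qed.

Lemma sum_delta_mulr m n k (F : 'I_k -> 'M[C]_(m, n)) i :
  \sum_j F j *m (j == i)%:R%:M = F i.
Proof.
rewrite -[RHS]sum_delta_scale; apply: eq_bigr => j _.
by rewrite mul_mx_scalar eq_sym.
Qed.

End Blocks.

(** * Transformations in block form *)

Section UptBlocks.
Variables (R : realType) (G : compact_quantum_group R).
Local Notation C := R[i].
Local Notation id_ n := (1%:M : 'M[C]_n) (only parsing).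
Implicit Types (F : fibre_functor G) (X Y : rep G).

Definition block_family F1 F2 h := forall X, 'I_h -> 'I_h -> 'M[C]_(F2 X, F1 X).

(** The first two fields are the two halves of the unitarity of a component. *)
Record is_block_upt F1 F2 h (a : block_family F1 F2 h) : Prop := IsBlockUpt {
  blocks_iso : forall X j k, \sum_i (a X i j)^t* *m a X i k = (j == k)%:R%:M;
  blocks_coiso : forall X i j, \sum_k a X i k *m (a X j k)^t* = (i == j)%:R%:M;
  blocks_nat : forall X Y (f : rep_hom X Y) i j,
    ff_hom F2 f *m a X i j = a Y i j *m ff_hom F1 f;
  blocks_mult : forall X Y i j,
    a (tensor_rep X Y) i j *m ff_mult F1 X Y =
    ff_mult F2 X Y *m \sum_k a X i k *t a Y k j;
  blocks_unit : forall i j,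
    a (unit_rep G) i j *m ff_unit F1 = (i == j)%:R *: ff_unit F2
}.

Definition upt_blk F1 F2 (al : upt_data F1 F2) :
    block_family F1 F2 (upt_dim al) := fun X => blk (al X).

Arguments upt_blk {F1 F2} al X i j.

Lemma is_uptP F1 F2 (al : upt_data F1 F2) :
  is_upt al <-> is_block_upt (upt_blk al).
Proof.
have E3 X Y :
    (al (tensor_rep X Y) *m (ff_mult F1 X Y *t id_ (upt_dim al)) =s
     (id_ (upt_dim al) *t ff_mult F2 X Y) *s (al X *t id_ (F2 Y)) *s
     (id_ (F1 X) *t al Y)) <->
    (forall i j, upt_blk al (tensor_rep X Y) i j *m ff_mult F1 X Y =
      ff_mult F2 X Y *m \sum_k upt_blk al X i k *t upt_blk al Y k j).
  have E i j x y z :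
    ((id_ (upt_dim al) *t ff_mult F2 X Y) *s (al X *t id_ (F2 Y)) *s
     (id_ (F1 X) *t al Y)) (idx (i, z)) (idx (x, idx (y, j))) =
    (ff_mult F2 X Y *m \sum_k upt_blk al X i k *t upt_blk al Y k j)
      z (idx (x, y)).
    rewrite strict_compE sum_idx.
    under eq_bigr => x' _ do rewrite sum_idx.
    rewrite mxE sum_idx (bigD1 x) //= [X in _ + X]big1 ?addr0; last first.
      move=> x' /negPf xx'; rewrite big1 // => l _; rewrite big1 // => y' _.
      by rewrite tensmxE one_mxE xx' mul0r mulr0.
    rewrite [RHS]exchange_big /= exchange_big /=; apply: eq_bigr => y' _.
    under [RHS]eq_bigr => x' _ do rewrite summxE mulr_sumr.
    rewrite exchange_big; apply: eq_bigr => l _ /=.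
    rewrite cast_idxA tensmxE one_mxE eqxx mul1r strict_compE sum_idx.
    rewrite sum_idx (bigD1 i) //= [X in _ + X]big1 ?addr0; last first.
      move=> i' /negPf ii'; rewrite big1 // => x' _; rewrite big1 // => y'' _.
      by rewrite cast_idxAV tensmxE one_mxE eq_sym ii' !mul0r.
    rewrite mulr_suml; apply: eq_bigr => x' _.
    rewrite (bigD1 y') //= [X in _ + X]big1 ?addr0; last first.
      by move=> y'' /negPf yy'; rewrite tensmxE one_mxE yy' !mulr0.
    rewrite cast_idxAV !tensmxE !one_mxE !eqxx mulr1 mul1r.
    by rewrite /upt_blk -!blkE mulrA.
  rewrite strict_eqP; split=> [e i j|e a b].
    apply/matrixP => z c; case: (mxtens_indexP c) => x y; rewrite -E.
    have := e (idx (i, z)) (idx (idx (x, y), j)).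
    by rewrite cast_ord_id cast_idxAV blkE blk_mulr.
  case: (mxtens_indexP a) => i z; case: (mxtens_indexP b) => c j.
  case: (mxtens_indexP c) => x y.
  by rewrite cast_ord_id cast_idxAV E blkE blk_mulr e.
have E4 : (al (unit_rep G) *m (ff_unit F1 *t id_ (upt_dim al)) =s id_ (upt_dim al) *t ff_unit F2) <->
    (forall i j, upt_blk al (unit_rep G) i j *m ff_unit F1 =
       (i == j)%:R *: ff_unit F2).
  rewrite strict_eqP; split=> [e i j|e a b].
    apply/matrixP => z x; rewrite -blk_mulr -blkE e ord1.
    rewrite cast_ord_id cast_idx_swap1.
    by rewrite tensmxE !mxE.
  case: (mxtens_indexP a) => i z; case: (mxtens_indexP b) => x j.
  rewrite cast_ord_id cast_idx_swap1 blkE blk_mulr e.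
  by rewrite tensmxE !mxE ord1.
split=> [[uni nat mul un]|[iso coiso nat mul un]].
  split.
  - by move=> X; apply/blk_isometryP; case: (uni X).
  - by move=> X; apply/blk_coisometryP; case: (uni X).
  - by move=> X Y f i j; rewrite /upt_blk -blk_mull nat blk_mulr.
  - by move=> X Y; apply/E3.
  - exact/E4.
split.
- move=> X; split; first by apply/blk_isometryP/iso.
  by apply/blk_coisometryP/coiso.
- by move=> X Y f; apply/blkP => i j; rewrite blk_mull blk_mulr; apply: nat.
- by move=> X Y; apply/E3.
- exact/E4.
Qed.

Definition upt_of F1 F2 h (a : block_family F1 F2 h) : upt_data F1 F2 :=
  @UptData _ _ F1 F2 h (fun X => mx_of_blocks (a X)).

Arguments upt_of {F1 F2 h} a.

Lemma upt_of_blk F1 F2 h (a : block_family F1 F2 h) X i j :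
  upt_blk (upt_of a) X i j = a X i j.
Proof. exact: blk_mx_of_blocks. Qed.

Lemma is_block_upt_ext F1 F2 h (a b : block_family F1 F2 h) :
  (forall X i j, a X i j = b X i j) -> is_block_upt a -> is_block_upt b.
Proof.
move=> e [iso coiso nat mul un]; split.
- by move=> X j k; rewrite -iso; apply: eq_bigr => i _; rewrite -!e.
- by move=> X i j; rewrite -coiso; apply: eq_bigr => k _; rewrite -!e.
- by move=> X Y f i j; rewrite -!e.
- move=> X Y i j; rewrite -e mul; congr (_ *m _).
  by apply: eq_bigr => k _; rewrite !e.
- by move=> i j; rewrite -e.
Qed.

Lemma comp_upt_blk F1 F2 F3 (al : upt_data F1 F2) (be : upt_data F2 F3) X i j k l :
  upt_blk (comp_upt al be) X (idx (i, k)) (idx (j, l)) =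
  upt_blk be X k l *m upt_blk al X i j.
Proof.
apply/matrixP => z x; rewrite mxE strict_castE.
rewrite cast_idxAV cast_idxA strict_compE sum_idx mxE sum_idx.
rewrite (bigD1 i) //= [X in _ + X]big1 ?addr0; last first.
  move=> i' /negPf ii'; rewrite big1 // => y _; rewrite big1 // => l' _.
  by rewrite cast_idxAV tensmxE one_mxE eq_sym ii' !mul0r.
apply: eq_bigr => y _.
rewrite (bigD1 l) //= [X in _ + X]big1 ?addr0; last first.
  by move=> l' /negPf ll'; rewrite !tensmxE [X in _ * X]mulrC one_mxE ll' mul0r mulr0.
by rewrite cast_idxAV !tensmxE !one_mxE !eqxx mul1r mulr1 /upt_blk !blkE.
Qed.

Lemma id_upt_blk F X i j : upt_blk (id_upt F) X i j = 1%:M.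
Proof.
apply/matrixP => y x; rewrite mxE strict_castE.
by rewrite cast_idx1r cast_idx1l.
Qed.

Lemma coevE h (i j : 'I_h) k : coev R h (idx (i, j)) k = (i == j)%:R.
Proof. by rewrite mxE mxtens_indexK. Qed.

Lemma evE h (i j : 'I_h) k : ev R h k (idx (i, j)) = (i == j)%:R.
Proof. by rewrite mxE coevE. Qed.

Lemma dual_upt_blk F1 F2 (al : upt_data F1 F2) X i j :
  upt_blk (dual_upt al) X i j = (upt_blk al X i j)^t*.
Proof.
apply/matrixP => x z; rewrite mxE strict_castE cast_1ridx cast_1lidx2.
rewrite strict_compE sum_idx exchange_big /=.
rewrite (big_pick (i := j)); last first.
  move=> j' jj; rewrite big1 // => k _.
  case: (mxtens_indexP k) => b z'; rewrite !tensmxE !one_mxE jj.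
  by rewrite !mulr0.
rewrite sum_idx exchange_big /=.
rewrite (big_pick (i := z)); last first.
  move=> z' jj; rewrite big1 // => k _.
  by rewrite !tensmxE !one_mxE jj mulr0 mul0r mulr0.
rewrite sum_idx (big_pick (i := i)); last first.
  move=> b bi; rewrite big1 // => c _.
  rewrite cast_idxA2 strict_compE sum_idx big1 ?mul0r // => k _.
  rewrite big1 // => d _; case: (mxtens_indexP k) => b' k'.
  case: (mxtens_indexP k') => x' c'.
  rewrite cast_idxAAV !tensmxE !one_mxE.
  by case: eqVneq => [<-|]; rewrite ?mul0r ?mulr0 // [i == b]eq_sym bi !(mulr0, mul0r).
rewrite (big_pick (i := i)); last first.
  by move=> c ci; rewrite !tensmxE coevE eq_sym ci !mul0r mulr0.
rewrite !tensmxE coevE !one_mxE !eqxx !mulr1 cast_idxA2.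
rewrite strict_compE sum_idx exchange_big /= (big_pick (i := j)); last first.
  move=> d dj; rewrite big1 // => k _.
  by case: (mxtens_indexP k) => b k'; rewrite !tensmxE !one_mxE dj !mulr0.
rewrite sum_idx (big_pick (i := i)); last first.
  move=> d dj; rewrite big1 // => k _.
  by rewrite !tensmxE !one_mxE dj mul0r mul0r mulr0.
rewrite sum_idx (big_pick (i := x)); last first.
  move=> d dj; rewrite big1 // => k _.
  by rewrite cast_idxAAV !tensmxE !one_mxE [x == d]eq_sym dj mulr0 !mul0r.
rewrite (big_pick (i := j)); last first.
  by move=> d dj; rewrite cast_idxAAV !tensmxE evE dj mulr0 mul0r.
by rewrite cast_idxAAV !tensmxE evE !one_mxE !eqxx !mulr1 !mul1r !mxE.
Qed.

Lemma is_modificationP F1 F2 (al be : upt_data F1 F2)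
    (f : 'M[C]_(upt_dim be, upt_dim al)) :
  is_modification f <->
  forall X i j, \sum_k f k j *: upt_blk be X i k =
                \sum_k f i k *: upt_blk al X k j.
Proof.
split=> h X; first by move=> i j; rewrite -blk_scaler -blk_scalel h.
by apply/blkP => i j; rewrite blk_scaler blk_scalel h.
Qed.

(** A product of dimensions hidden in [upt_dim] is not recognised by
    [mxtens_indexP]; this is the version for composites. *)
Lemma comp_idxP F1 F2 F3 (al : upt_data F1 F2) (be : upt_data F2 F3)
  (a : 'I_(upt_dim (comp_upt al be))) :
  @is_mxtens_index (upt_dim al) (upt_dim be) a.
Proof. exact: mxtens_indexP. Qed.

Lemma comp_upt_is_upt F1 F2 F3 (al : upt_data F1 F2) (be : upt_data F2 F3) :
  is_upt al -> is_upt be -> is_upt (comp_upt al be).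
Proof.
move=> /is_uptP[iso coiso nat mul un] /is_uptP[iso' coiso' nat' mul' un'].
apply/is_uptP; split.
- move=> X; move=> a b.
  case: (comp_idxP a) => j l; case: (comp_idxP b) => j' l'.
  rewrite sum_idx.
  transitivity (\sum_i (upt_blk al X i j)^t* *m
      (\sum_k (upt_blk be X k l)^t* *m upt_blk be X k l') *m upt_blk al X i j').
    apply: eq_bigr => i _; rewrite mulmx_sumr mulmx_suml.
    by apply: eq_bigr => k _; rewrite !comp_upt_blk dagM !mulmxA.
  rewrite eq_mxtens_index iso' -mulnb natrM scalar_mxM -iso mulmx_suml.
  apply: eq_bigr => i _.
  by rewrite -!mulmxA scalar_mxC.
- move=> X; move=> a b.
  case: (comp_idxP a) => j l; case: (comp_idxP b) => j' l'.
  rewrite sum_idx exchange_big.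
  transitivity (\sum_k upt_blk be X l k *m
      (\sum_i upt_blk al X j i *m (upt_blk al X j' i)^t*) *m
      (upt_blk be X l' k)^t*).
    apply: eq_bigr => k _; rewrite mulmx_sumr mulmx_suml.
    by apply: eq_bigr => i _; rewrite !comp_upt_blk dagM !mulmxA.
  rewrite eq_mxtens_index coiso -mulnb mulnC natrM scalar_mxM -coiso' mulmx_suml.
  apply: eq_bigr => i _.
  by rewrite -!mulmxA scalar_mxC.
- move=> X Y f; move=> a b.
  case: (comp_idxP a) => j l; case: (comp_idxP b) => j' l'.
  by rewrite !comp_upt_blk mulmxA nat' -mulmxA nat mulmxA.
- move=> X Y; move=> a b.
  case: (comp_idxP a) => j l; case: (comp_idxP b) => j' l'.
  rewrite !comp_upt_blk -mulmxA mul mulmxA mul' -mulmxA; congr (_ *m _).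
  rewrite mulmx_suml sum_idx exchange_big; apply: eq_bigr => k _.
  rewrite mulmx_sumr; apply: eq_bigr => i _.
  by rewrite !comp_upt_blk tensmx_mul.
- move=> a b.
  case: (comp_idxP a) => j l; case: (comp_idxP b) => j' l'.
  rewrite comp_upt_blk -mulmxA un -scalemxAr un' scalerA -natrM mulnb.
  by rewrite eq_mxtens_index.
Qed.

End UptBlocks.

Arguments upt_blk {R G F1 F2} al X i j.
Arguments upt_of {R G F1 F2 h} a.

(** * Linear forms separate points *)

Section Functionals.
Local Open Scope classical_set_scope.
Variables (K : fieldType) (V : lmodType K).

Definition linear_form (phi : V -> K) :=
  forall c x y, phi (c *: x + y) = c * phi x + phi y.

Lemma linear_form0 phi : linear_form phi -> phi 0 = 0.
Proof.
by move=> h; have := h (-1) 0 0; rewrite scaler0 addr0 mulN1r addNr.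
Qed.

Lemma linear_formD phi x y : linear_form phi -> phi (x + y) = phi x + phi y.
Proof. by move=> h; have := h 1 x y; rewrite scale1r mul1r. Qed.

Lemma linear_formZ phi c x : linear_form phi -> phi (c *: x) = c * phi x.
Proof. by move=> h; have := h c x 0; rewrite !addr0 (linear_form0 h) addr0. Qed.

Lemma linear_form_sum phi (I : Type) (r : seq I) (F : I -> V) :
  linear_form phi -> phi (\sum_(i <- r) F i) = \sum_(i <- r) phi (F i).
Proof.
move=> h; apply: (big_morph phi (fun x y => linear_formD x y h)).
exact: linear_form0.
Qed.

(** A maximal subspace A that avoids x is a complement of the line through x:
    were y outside of A + Kx, then Ky + A would be larger and still avoid x.  The
    coordinate along x is the required form.  This is what turns equalities of
    tensors, defined by testing on scalar bilinear forms, into equalities of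
    vector-valued bilinear maps. *)
Lemma separating_form (x : V) : x != 0 ->
  exists2 phi, linear_form phi & phi x = 1.
Proof.
move=> x0.
(* The union of the empty chain is empty, so 0 is added by hand. *)
pose A0 (A : set V) z := A z \/ z = 0.
pose P (A : set V) :=
  (forall c a b, A0 A a -> A0 A b -> A0 A (c *: a + b)) /\ ~ A0 A x.
have [|A [[Alin Ax] Amax]] := @Zorn_bigcup V P.
  move=> F FP Ftot; split; last first.
    move=> [[B FB Bx]|x0']; last by rewrite x0' eqxx in x0.
    by have [_ []] := FP _ FB; left.
  have key B a : F B -> A0 B a -> A0 (\bigcup_(X in F) X) a.
    by move=> FB [Ba|->]; [left; exists B|right].
  move=> c a b [[B1 F1 B1a]|->] [[B2 F2 B2b]|->].
  - have [B [FB Ba Bb]] : exists B, [/\ F B, B a & B b].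
      have [B12|B21] := Ftot _ _ F1 F2.
        by exists B2; split=> //; apply: B12.
      by exists B1; split=> //; apply: B21.
    by apply: (key B) => //; apply: (FP _ FB).1; left.
  - by apply: (key B1) => //; apply: (FP _ F1).1; [left|right].
  - by apply: (key B2) => //; apply: (FP _ F2).1; [right|left].
  - by right; rewrite scaler0 addr0.
have A00 : A0 A 0 by right.
have AZ c a : A0 A a -> A0 A (c *: a).
  by move=> h; rewrite -[_ *: _]addr0; apply: Alin.
have AD a b : A0 A a -> A0 A b -> A0 A (a + b).
  by move=> ha hb; rewrite -[a]scale1r; apply: Alin.
have split y : exists c, A0 A (y - c *: x).
  have [Ay|nAy] := pselect (A0 A y); first by exists 0; rewrite scale0r subr0.
  (* The span of y and A. *)
  pose B z := exists c a, A0 A a /\ z = c *: y + a.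
  have B0 z : A0 B z -> B z.
    by move=> [//|->]; exists 0, 0; rewrite scale0r addr0.
  have AB : A `<` B.
    rewrite properEneq; split; last first.
      by move=> a Aa; exists 0, a; split; [left|rewrite scale0r add0r].
    apply/eqP => eAB; apply: nAy; left; rewrite eAB; exists 1, 0.
    by rewrite scale1r addr0.
  have nPB := Amax _ AB.
  have [Bx|nBx] := pselect (A0 B x); last first.
    case: nPB; split=> // c a b /B0[d [a' [Aa' ->]]] /B0[e [b' [Ab' ->]]].
    left; exists (c * d + e), (c *: a' + b'); split; first exact: Alin.
    by rewrite scalerDr scalerA scalerDl addrACA.
  have [c [a [Aa xE]]] := B0 _ Bx.
  have c0 : c != 0.
    by apply/eqP => c0; apply: Ax; rewrite xE c0 scale0r add0r.
  exists c^-1; have -> : y - c^-1 *: x = - c^-1 *: a.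
    by rewrite xE scalerDr scalerA mulVf // scale1r opprD addNKr scaleNr.
  exact: AZ.
have uniq c d y : A0 A (y - c *: x) -> A0 A (y - d *: x) -> c = d.
  move=> hc hd; apply/eqP; rewrite -subr_eq0; apply/negPn/negP => cd.
  apply: Ax; have -> : x = (c - d)^-1 *: ((y - d *: x) + (-1) *: (y - c *: x)).
    rewrite scaleN1r opprB [X in _ *: X]addrC addrA subrK.
    by rewrite -scalerBl scalerA mulVf ?scale1r // subr_eq0.
  by apply/AZ/AD => //; apply: AZ.
have [phi phiP] := choice split.
exists phi.
  move=> c a b; apply: (uniq _ _ (c *: a + b)) => //.
  rewrite scalerDl -scalerA opprD addrACA -scalerBr.
  exact: Alin.
by apply: (uniq _ _ x) => //; rewrite scale1r subrr.
Qed.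

Lemma form_eq (x y : V) :
  (forall phi, linear_form phi -> phi x = phi y) -> x = y.
Proof.
move=> h; apply/eqP; rewrite -subr_eq0; apply/negPn/negP => /separating_form.
case=> phi lin; rewrite linear_formD // -scaleN1r linear_formZ // h // mulN1r.
by rewrite subrr => /eqP; rewrite eq_sym oner_eq0.
Qed.

End Functionals.

(** * Adjoints, traces and orthogonal coefficients *)

Section LinearAlgebra.
Variable C : numClosedFieldType.

(** W^* is an orthonormal basis of the row space of P. *)
Lemma dagger_split n (P : 'M[C]_n) : P *m P = P -> P^t* = P ->
  exists r (W : 'M[C]_(n, r)), W^t* *m W = 1%:M /\ W *m W^t* = P.
Proof.
move=> PP Pa; pose Q := schmidt (row_base P).
have rn : (\rank P <= n)%N := rank_leq_col P.
have /unitarymxP QQ : Q \is unitarymx by apply: schmidt_unitarymx.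
have QP : (Q :=: P)%MS.
  apply: eqmx_trans (eq_row_base P).
  by apply: eqmx_schmidt_free => //; apply: row_base_free.
exists (\rank P), (Q^t*); rewrite trmxCK; split=> //.
have /submxP[D PD] : (P <= Q)%MS by rewrite QP.
have /submxP[E QE] : (Q <= P)%MS by rewrite QP.
have e1 : P *m (Q^t* *m Q) = P.
  by rewrite {1}PD -mulmxA (mulmxA Q) QQ mul1mx -PD.
have e2 : Q^t* *m Q *m P = Q^t* *m Q.
  by rewrite -mulmxA {2}QE -mulmxA PP -QE.
transitivity ((P *m (Q^t* *m Q))^t*); last by rewrite e1.
by rewrite dagM Pa dagM trmxCK e2.
Qed.

Lemma trace_mul_dag m n (A : 'M[C]_(m, n)) :
  \tr (A *m A^t*) = \sum_i \sum_j `|A i j| ^+ 2.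
Proof.
apply: eq_bigr => i _; rewrite mxE; apply: eq_bigr => j _.
by rewrite !mxE normCK.
Qed.

Lemma trace_mul_dag_ge0 m n (A : 'M[C]_(m, n)) : 0 <= \tr (A *m A^t*).
Proof. by rewrite trace_mul_dag !sumr_ge0 // => i _; rewrite sumr_ge0 // => j _; rewrite exprn_ge0. Qed.

Lemma trace_mul_dag_eq0 m n (A : 'M[C]_(m, n)) : \tr (A *m A^t*) = 0 -> A = 0.
Proof.
rewrite trace_mul_dag => /eqP; rewrite psumr_eq0 => [/allP h|i _]; last first.
  by rewrite sumr_ge0 // => j _; rewrite exprn_ge0.
apply/matrixP => i j; have := h i (mem_index_enum i).
rewrite psumr_eq0 => [/allP h'|k _]; last by rewrite exprn_ge0.
have := h' j (mem_index_enum j).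
by rewrite mxE sqrf_eq0 normr_eq0 => /eqP.
Qed.

(** V may have infinite dimension and comes without bases, so the linear
    relations between the e_i are obtained as a matrix of relations of maximal
    rank. *)
Lemma kernel_matrix (V : lmodType C) n (e : 'I_n -> V)
    (null := fun k : 'rV[C]_n => \sum_i k 0 i *: e i = 0) :
  exists K : 'M[C]_n, (forall i, null (row i K)) /\
    forall k, null k -> (k <= K)%MS.
Proof.
have nullD c x y : null x -> null y -> null (c *: x + y).
  rewrite /null => hx hy; transitivity (c *: (\sum_i x 0 i *: e i) +
      \sum_i y 0 i *: e i); last by rewrite hx hy scaler0 addr0.
  rewrite scaler_sumr -big_split; apply: eq_bigr => i _.
  by rewrite !mxE scalerDl scalerA.
have null0 : null 0 by rewrite /null big1 // => i _; rewrite mxE scale0r.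
have null_span m (K : 'M_(m, n)) v :
    (forall i, null (row i K)) -> null (v *m K).
  move=> hK; rewrite mulmx_sum_row.
  elim/big_rec: _ => // i x _ hx; exact: nullD.
pose R r := `[< exists K : 'M[C]_n,
  (forall i, null (row i K)) /\ \rank K = r >].
have Rex : exists r, R r.
  exists 0%N; apply/asboolP; exists 0; split; last by rewrite mxrank0.
  by move=> i; rewrite row0.
have Rle r : R r -> (r <= n)%N by move=> /asboolP[K [_ <-]]; apply: rank_leq_row.
case: (ex_maxnP Rex Rle) => r /asboolP[K [nK rK]] rmax.
exists K; split=> // k nk.
have nKk i : null (row i (K + k)%MS).
  have /submxP[D ->] : (row i (K + k)%MS <= col_mx K k)%MS.
    by rewrite -addsmxE row_sub.
  apply: null_span => j; rewrite -[j]splitK; case: (split j) => j' /=.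
    by rewrite rowKu.
  by rewrite rowKd; have -> : row j' k = k by apply/rowP => ?; rewrite mxE ord1.
have le : (\rank (K + k)%MS <= \rank K)%N.
  by rewrite rK; apply: rmax; apply/asboolP; exists (K + k)%MS.
have : (K <= K + k)%MS := addsmxSl K k.
move/mxrank_leqif_sup/geq_leqif; rewrite le => /esym h.
exact: submx_trans (addsmxSr K k) h.
Qed.

(** Coefficients of a vector in the possibly dependent family e become unique
    when they are required to be orthogonal to all relations; subtracting the
    projection onto the space of relations achieves this. *)
Lemma orthogonal_coefficients (V : lmodType C) n (e : 'I_n -> V)
    (c : 'rV[C]_n) : exists c' : 'rV[C]_n,
  \sum_i c' 0 i *: e i = \sum_i c 0 i *: e i /\
  forall k : 'rV[C]_n, \sum_i k 0 i *: e i = 0 -> c' *m k^t* = 0.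
Proof.
have [K [nK maxK]] := kernel_matrix e.
exists (c - c *m proj_ortho K); split.
  have /submxP[D cE] := proj_ortho_sub K c.
  have -> : \sum_i (c - c *m proj_ortho K) 0 i *: e i =
      \sum_i c 0 i *: e i - \sum_i (D *m K) 0 i *: e i.
    rewrite cE -sumrB; apply: eq_bigr => i _.
    by rewrite !mxE scalerBl.
  have -> : \sum_i (D *m K) 0 i *: e i =
      \sum_j D 0 j *: \sum_i row j K 0 i *: e i.
    under [RHS]eq_bigr => j _ do rewrite scaler_sumr.
    rewrite exchange_big; apply: eq_bigr => i _ /=.
    rewrite mxE scaler_suml; apply: eq_bigr => j _.
    by rewrite scalerA mxE.
  by rewrite [X in _ - X]big1 ?subr0 // => j _; rewrite nK scaler0.
move=> k /maxK/submxP[D ->].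
rewrite dagM mulmxA; have /orthomx1P -> := proj_ortho_compl_sub K c.
by rewrite mul0mx.
Qed.

End LinearAlgebra.

(** * Matrix coefficients of a compact quantum group *)

Section HopfAlgebra.
Variables (R : realType) (G : compact_quantum_group R).
Local Notation C := R[i].

Definition bilinear_map (V : lmodType C) (B : G -> G -> V) :=
  (forall c x y z, B (c *: x + y) z = c *: B x z + B y z) /\
  (forall c x y z, B z (c *: x + y) = c *: B z x + B z y).

Lemma tensor_eq_map (V : lmodType C) (B : G -> G -> V) s s' :
  bilinear_map B -> tensor_eq s s' ->
  \sum_(p <- s) B p.1 p.2 = \sum_(p <- s') B p.1 p.2.
Proof.
move=> [Bl Br] e; apply: form_eq => phi lin; rewrite !linear_form_sum //.
apply: (e (fun x y => phi (B x y))); split=> c x y z.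
  by rewrite Bl lin.
by rewrite Br lin.
Qed.

(** The sum of B x_(1) x_(2), in Sweedler notation. *)
Definition comul_sum (V : lmodType C) (B : G -> G -> V) (x : G) : V :=
  \sum_(p <- hopf_comul x) B p.1 p.2.

Lemma comul_sum_linear (V : lmodType C) (B : G -> G -> V) c x y :
  bilinear_map B ->
  comul_sum B (c *: x + y) = c *: comul_sum B x + comul_sum B y.
Proof.
move=> hB; rewrite /comul_sum (tensor_eq_map hB (hopf_comul_linear c x y)).
rewrite big_cat big_map /= scaler_sumr; congr (_ + _).
apply: eq_bigr => p _ /=; have := hB.1 c p.1 0 p.2.
have := hB.1 (-1) 0 0 p.2.
by rewrite scaler0 addr0 scaleN1r addNr => ->; rewrite !addr0.
Qed.

Lemma comul_sum0 (V : lmodType C) (B : G -> G -> V) :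
  bilinear_map B -> comul_sum B 0 = 0.
Proof.
move=> hB; have := comul_sum_linear (-1) 0 0 hB.
by rewrite scaler0 addr0 scaleN1r addNr.
Qed.

Lemma comul_sum_sum (V : lmodType C) (B : G -> G -> V) (I : Type) (r : seq I)
    (x : I -> G) : bilinear_map B ->
  comul_sum B (\sum_(i <- r) x i) = \sum_(i <- r) comul_sum B (x i).
Proof.
move=> hB; elim: r => [|i r IH]; first by rewrite !big_nil comul_sum0.
rewrite !big_cons -IH -[x i]scale1r comul_sum_linear //.
by rewrite !scale1r.
Qed.

Lemma comul_sumZ (V : lmodType C) (B : G -> G -> V) c x : bilinear_map B ->
  comul_sum B (c *: x) = c *: comul_sum B x.
Proof.
by move=> hB; rewrite -[c *: x]addr0 comul_sum_linear // comul_sum0 // addr0.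
Qed.

Lemma comul_sum_corep (V : lmodType C) (B : G -> G -> V) n (u : 'M[G]_n) i j :
  tensor_eq (hopf_comul (u i j)) [seq (u i k, u k j) | k <- enum 'I_n] ->
  bilinear_map B -> comul_sum B (u i j) = \sum_k B (u i k) (u k j).
Proof.
by move=> du hB; rewrite /comul_sum (tensor_eq_map hB du) big_map big_enum.
Qed.

Lemma tensor_eq_star s s' : tensor_eq s s' ->
  tensor_eq [seq (hopf_star p.1, hopf_star p.2) | p <- s]
            [seq (hopf_star p.1, hopf_star p.2) | p <- s' : seq (G * G)].
Proof.
move=> e b [bl br]; rewrite !big_map; apply: (can_inj conjCK).
rewrite !rmorph_sum; apply: (e (fun x y => (b (hopf_star x) (hopf_star y))^*)).
by split=> c x y z; rewrite hopf_star_antilinear ?bl ?br rmorphD rmorphM /= conjCK.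
Qed.

Lemma star0 : hopf_star (0 : G) = 0.
Proof. by have := star_scalar G 0; rewrite rmorph0 !scale0r. Qed.

(** Both matrices S(u) and u^* are inverse to u. *)
Lemma antipode_corep n (u : 'M[G]_n) i j : is_unitary_corep u ->
  hopf_antipode (u i j) = hopf_star (u j i).
Proof.
move=> [[du eu] _ uu].
have hB : bilinear_map (fun x y : G => hopf_antipode x * y).
  split=> c x y z; first by rewrite hopf_antipode_linear mulrDl -scalerAl.
  by rewrite mulrDr -scalerAr.
have su : map_mx (@hopf_antipode _ G) u *m u = 1%:M.
  apply/matrixP => a b; have := hopf_antipodel (u a b).
  rewrite -[LHS]/(comul_sum (fun x y : G => hopf_antipode x * y) (u a b)).
  rewrite (comul_sum_corep (du a b) hB) eu !mxE scaler_nat => <-.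
  by apply: eq_bigr => k _; rewrite mxE.
have <- : star_mx u i j = hopf_star (u j i) by rewrite !mxE.
have : map_mx (@hopf_antipode _ G) u *m (u *m star_mx u) = star_mx u.
  by rewrite mulmxA su mul1mx.
by rewrite uu mulmx1 => <-; rewrite mxE.
Qed.

Lemma block_corep m n (u : 'M[G]_m) (v : 'M[G]_n) :
  is_unitary_corep u -> is_unitary_corep v ->
  is_unitary_corep (block_mx u 0 0 v).
Proof.
move=> [[du eu] u1 u2] [[dv ev] v1 v2].
have e0 : hopf_counit (0 : G) = 0.
  have := hopf_counit_linear (-1) (0 : G) 0.
  by rewrite scaler0 addr0 mulN1r addNr.
have starE : star_mx (block_mx u 0 0 v) = block_mx (star_mx u) 0 0 (star_mx v).
  rewrite /star_mx tr_block_mx map_block_mx !trmx0; congr block_mx;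
    by apply/matrixP => i j; rewrite !mxE star0.
have mx0E p q (x : 'I_p) (y : 'I_q) : (0 : 'M[G]_(p, q)) x y = 0.
  by rewrite mxE.
split; last 2 first.
- by rewrite starE mulmx_block !mulmx0 !mul0mx !addr0 !add0r u1 v1 -scalar_mx_block.
- by rewrite starE mulmx_block !mulmx0 !mul0mx !addr0 !add0r u2 v2 -scalar_mx_block.
split=> i j; last first.
  rewrite -(splitK i) -(splitK j); case: (split i) => i'; case: (split j) => j' /=.
  - by rewrite block_mxEul eu (inj_eq (@lshift_inj _ _)).
  - by rewrite block_mxEur mx0E e0 eq_lrshift.
  - by rewrite block_mxEdl mx0E e0 eq_rlshift.
  - by rewrite block_mxEdr ev (inj_eq (@rshift_inj _ _)).
move=> b hb; rewrite big_map big_enum big_split_ord /=.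
have b0l x : b 0 x = 0.
  by have := hb.1 (-1) 0 0 x; rewrite scaler0 addr0 mulN1r addNr.
have b0r x : b x 0 = 0.
  by have := hb.2 (-1) 0 0 x; rewrite scaler0 addr0 mulN1r addNr.
have hb' : bilinear_map (V := C) b by case: hb.
have c0 : \sum_(p <- hopf_comul (0 : G)) b p.1 p.2 = 0.
  exact: comul_sum0 hb'.
rewrite -(splitK i) -(splitK j); case: (split i) => i'; case: (split j) => j' /=.
- rewrite block_mxEul (du i' j' b hb) big_map big_enum /=.
  rewrite [X in _ = _ + X]big1 ?addr0; last first.
    by move=> k _; rewrite block_mxEur mx0E b0l.
  by apply: eq_bigr => k _; rewrite !block_mxEul.
- rewrite block_mxEur mx0E c0 !big1 ?addr0 // => k _.
    by rewrite [X in b X]block_mxEur mx0E b0l.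
  by rewrite [X in b _ X]block_mxEur mx0E b0r.
- rewrite block_mxEdl mx0E c0 !big1 ?addr0 // => k _.
    by rewrite [X in b _ X]block_mxEdl mx0E b0r.
  by rewrite [X in b X]block_mxEdl mx0E b0l.
- rewrite block_mxEdr (dv i' j' b hb) big_map big_enum /=.
  rewrite [X in _ = X + _]big1 ?add0r; last first.
    by move=> k _; rewrite block_mxEdl mx0E b0l.
  by apply: eq_bigr => k _; rewrite !block_mxEdr.
Qed.

Definition rep_sum (X Y : rep G) : rep G :=
  Rep (block_corep (rep_unitary X) (rep_unitary Y)).

Definition coef_span (Y : rep G) (x : G) :=
  exists c : 'M[C]_(rep_dim Y), x = \sum_k \sum_l c k l *: rep_mx Y k l.

Lemma coef_span_sum X Y x :
  coef_span X x \/ coef_span Y x -> coef_span (rep_sum X Y) x.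
Proof.
case=> -[c ->].
  exists (block_mx c 0 0 0); rewrite big_split_ord /= [X in _ = _ + X]big1.
    rewrite addr0; apply: eq_bigr => k _; rewrite big_split_ord /=.
    rewrite [X in _ = _ + X]big1 ?addr0 => [|l _].
      by apply: eq_bigr => l _; rewrite !block_mxEul.
    by rewrite !block_mxEur !mxE scaler0.
  move=> k _; rewrite big_split_ord /= !big1 ?addr0 // => l _.
    by rewrite !block_mxEdr !mxE scale0r.
  by rewrite !block_mxEdl !mxE scaler0.
exists (block_mx 0 0 0 c); rewrite big_split_ord /= [X in _ = X + _]big1.
  rewrite add0r; apply: eq_bigr => k _; rewrite big_split_ord /=.
  rewrite [X in _ = X + _]big1 ?add0r => [|l _].
    by apply: eq_bigr => l _; rewrite !block_mxEdr.
  by rewrite !block_mxEdl !mxE scaler0.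
move=> k _; rewrite big_split_ord /= !big1 ?addr0 // => l _.
  by rewrite !block_mxEur !mxE scaler0.
by rewrite !block_mxEul !mxE scale0r.
Qed.

Lemma coef_spanD Y a x y :
  coef_span Y x -> coef_span Y y -> coef_span Y (a *: x + y).
Proof.
move=> [c ->] [d ->]; exists (a *: c + d).
rewrite scaler_sumr -big_split; apply: eq_bigr => k _ /=.
rewrite scaler_sumr -big_split; apply: eq_bigr => l _ /=.
by rewrite !mxE scalerDl scalerA.
Qed.

Lemma coef_span_ex x : exists Y, coef_span Y x.
Proof.
have [s [hs ->]] := cqg_spanned x.
elim: s hs => [_|[a y] s IH hs].
  exists (unit_rep G), 0; rewrite big_nil big1 // => k _.
  by rewrite big1 // => l _; rewrite mxE scale0r.
have [|Y hY] := IH; first by move=> p ps; apply: hs; rewrite inE ps orbT.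
have [n [u [i [j [uu /= yE]]]]] := hs (a, y) (mem_head _ _).
exists (rep_sum (Rep uu) Y); rewrite big_cons /=.
apply: coef_spanD; apply: coef_span_sum; [left|by right].
exists (delta_mx i j); rewrite (big_pick (i := i)) => [|k ki]; last first.
  by rewrite big1 // => l _; rewrite mxE ki scale0r.
rewrite (big_pick (i := j)) => [|l lj]; last by rewrite mxE lj andbF scale0r.
by rewrite mxE !eqxx scale1r yE.
Qed.

(** Direct sums collect the coefficients of finitely many representations in
    one. *)
Lemma coef_span_seq (s : seq G) :
  exists Y, forall x, x \in s -> coef_span Y x.
Proof.
elim: s => [|x s [Y hY]]; first by exists (unit_rep G).
have [X hX] := coef_span_ex x; exists (rep_sum X Y) => y.
rewrite inE => /predU1P[->|/hY]; by move=> *; apply: coef_span_sum; auto.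
Qed.

End HopfAlgebra.

(** * The conjugate of a representation *)

Section ConjugateIntertwiners.
Variables (R : realType) (G : compact_quantum_group R).
Local Notation C := R[i].

Section Relations.
Variable Y : rep G.
Local Notation N := (rep_dim Y).
Local Notation w := (rep_mx Y).

Definition eval_coef (c : 'M[C]_N) : G := \sum_k \sum_l c k l *: w k l.

Definition coef_dot (c d : 'M[C]_N) : C := \sum_k \sum_l c k l * (d k l)^*.

(** The coefficients c are orthogonal to all linear relations between the matrix
    coefficients of Y.  These representatives are unique, and unlike arbitrary
    ones they are respected by the comodule structure. *)
Definition minimal_coef (c : 'M[C]_N) :=
  forall d, eval_coef d = 0 -> coef_dot c d = 0.

Lemma eval_coef_linear a c d :
  eval_coef (a *: c + d) = a *: eval_coef c + eval_coef d.
Proof.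
rewrite scaler_sumr -big_split; apply: eq_bigr => k _ /=.
rewrite scaler_sumr -big_split; apply: eq_bigr => l _ /=.
by rewrite !mxE scalerDl scalerA.
Qed.

Lemma eval_coef0 : eval_coef 0 = 0.
Proof.
by rewrite /eval_coef big1 // => k _; rewrite big1 // => l _; rewrite mxE scale0r.
Qed.

Lemma eval_coef_sum (I : Type) (r : seq I) (a : I -> C) (c : I -> 'M[C]_N) :
  eval_coef (\sum_(i <- r) a i *: c i) = \sum_(i <- r) a i *: eval_coef (c i).
Proof.
elim: r => [|i r IH]; first by rewrite !big_nil eval_coef0.
by rewrite !big_cons eval_coef_linear IH.
Qed.

Lemma minimal_coef_linear a c d :
  minimal_coef c -> minimal_coef d -> minimal_coef (a *: c + d).
Proof.
move=> hc hd e he; transitivity (a * coef_dot c e + coef_dot d e).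
  rewrite mulr_sumr -big_split; apply: eq_bigr => k _ /=.
  rewrite mulr_sumr -big_split; apply: eq_bigr => l _ /=.
  by rewrite !mxE mulrDl mulrA.
by rewrite hc // hd // mulr0 addr0.
Qed.

Lemma minimal_coef0 : minimal_coef 0.
Proof. by move=> e _; rewrite /coef_dot big1 // => k _; rewrite big1 // => l _; rewrite mxE mul0r. Qed.

Lemma minimal_coef_sum (I : Type) (r : seq I) (a : I -> C) (c : I -> 'M[C]_N) :
  (forall i, minimal_coef (c i)) -> minimal_coef (\sum_(i <- r) a i *: c i).
Proof.
move=> h; elim: r => [|i r IH]; first by rewrite big_nil; apply: minimal_coef0.
by rewrite big_cons; apply: minimal_coef_linear.
Qed.

Lemma minimal_coef_unique c : minimal_coef c -> eval_coef c = 0 -> c = 0.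
Proof.
move=> h /h e; apply: trace_mul_dag_eq0; rewrite -[RHS]e trace_mul_dag.
by apply: eq_bigr => i _; apply: eq_bigr => j _; rewrite normCK.
Qed.

Lemma minimal_coef_ex x : coef_span Y x ->
  exists c, minimal_coef c /\ eval_coef c = x.
Proof.
move=> [c0 ->].
have [c [ec pc]] := orthogonal_coefficients
  (fun k => w (mxtens_unindex k).1 (mxtens_unindex k).2)
  (\row_k c0 (mxtens_unindex k).1 (mxtens_unindex k).2).
have ev (d : 'rV[C]_(N * N)) :
    \sum_k d 0 k *: w (mxtens_unindex k).1 (mxtens_unindex k).2 =
    \sum_i \sum_j d 0 (idx (i, j)) *: w i j.
  rewrite sum_idx; apply: eq_bigr => i _; apply: eq_bigr => j _.
  by rewrite mxtens_indexK.
exists (\matrix_(i, j) c 0 (idx (i, j))); split.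
  move=> d hd; pose v := \row_k d (mxtens_unindex k).1 (mxtens_unindex k).2.
  have /matrixP/(_ 0 0) : c *m v^t* = 0.
    apply: pc; rewrite ev -[RHS]hd; apply: eq_bigr => i _; apply: eq_bigr => j _.
    by rewrite mxE mxtens_indexK.
  rewrite !mxE sum_idx => <-; apply: eq_bigr => i _; apply: eq_bigr => j _.
  by rewrite !mxE mxtens_indexK.
rewrite /eval_coef.
under eq_bigr => i _ do under eq_bigr => j _ do rewrite mxE.
rewrite -ev ec ev; apply: eq_bigr => i _; apply: eq_bigr => j _.
by rewrite mxE mxtens_indexK.
Qed.

(** Action of a linear form phi by convolution, written on coefficients. *)
Definition coef_act (phi : G -> C) (c : 'M[C]_N) : 'M[C]_N :=
  \matrix_(k, p) \sum_l c k l * phi (w p l).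

Lemma eval_coef_act phi c : linear_form phi ->
  eval_coef (coef_act phi c) = comul_sum (fun x y => phi y *: x) (eval_coef c).
Proof.
move=> lin; have [[dw _] _ _] := rep_unitary Y.
have hB : bilinear_map (fun x y : G => phi y *: x).
  split=> a x y z; first by rewrite scalerDr !scalerA mulrC.
  by rewrite lin scalerDl scalerA.
rewrite /eval_coef comul_sum_sum //; apply: eq_bigr => k _.
rewrite comul_sum_sum //.
under eq_bigr => p _ do rewrite mxE scaler_suml.
rewrite exchange_big; apply: eq_bigr => l _ /=.
rewrite comul_sumZ // (comul_sum_corep (dw k l) hB) scaler_sumr.
by apply: eq_bigr => p _; rewrite scalerA.
Qed.

(** The adjoint of the action of phi is the action of the form psi below, since
    the antipode of w_lk is the star of w_kl.  Any convolution maps relations to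
    relations, so its adjoint preserves their orthogonal complement. *)
Lemma minimal_coef_act phi c : linear_form phi ->
  minimal_coef c -> minimal_coef (coef_act phi c).
Proof.
move=> lin mc d hd.
pose psi (x : G) := (phi (hopf_star (hopf_antipode x)))^*.
have psilin : linear_form psi.
  move=> a x y; rewrite /psi hopf_antipode_linear hopf_star_antilinear lin.
  by rewrite rmorphD rmorphM /= conjCK.
have psiE k l : psi (w l k) = (phi (w k l))^*.
  by rewrite /psi (antipode_corep _ _ (rep_unitary Y)) hopf_starK.
have := mc (coef_act psi d).
rewrite eval_coef_act // hd comul_sum0; last first.
  split=> a x y z; first by rewrite scalerDr !scalerA mulrC.
  by rewrite psilin scalerDl scalerA.
move=> /(_ erefl) <-; apply: eq_bigr => k _.
under eq_bigr => p _ do rewrite mxE mulr_suml.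
rewrite exchange_big; apply: eq_bigr => l _ /=.
rewrite mxE rmorph_sum mulr_sumr; apply: eq_bigr => p _ /=.
by rewrite psiE rmorphM /= conjCK mulrA mulrAC.
Qed.

End Relations.

(** Only the intertwining matrices are produced, not the conjugate as a unitary
    representation: the entries of the conjugate matrix ubar of X are matrix
    coefficients of some Y, and D i k collects the coefficients of the i-th row.
    Choosing orthogonal coefficients makes D i k an intertwiner from ubar to the
    matrix of Y.  A vector v killed by all D i k satisfies ubar v = 0, and
    then v = 0 by u^* u = 1. *)
Lemma conjugate_intertwiners (X : rep G) :
  exists (Y : rep G) (D : 'I_(rep_dim X) -> 'I_(rep_dim Y) ->
    'M[C]_(rep_dim Y, rep_dim X)),
  (forall i k z s, \sum_y D i k y s *: rep_mx Y z y =
     \sum_t D i k z t *: hopf_star (rep_mx X t s)) /\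
  (forall v : 'cV[C]_(rep_dim X), (forall i k, D i k *m v = 0) -> v = 0).
Proof.
set n := rep_dim X; set u := rep_mx X.
have [[du _] u1 _] := rep_unitary X.
have [Y hY] := coef_span_seq [seq hopf_star (u p.1 p.2) | p : 'I_n * 'I_n].
have /choice[c0 c0P] (p : 'I_n * 'I_n) :
    exists c : 'M[C]_(rep_dim Y), minimal_coef c /\
      eval_coef c = hopf_star (u p.1 p.2).
  by apply/minimal_coef_ex/hY/mapP; exists p; rewrite ?mem_enum.
pose c i j := c0 (i, j).
have cmin i j : minimal_coef (c i j) by case: (c0P (i, j)).
have cE i j : eval_coef (c i j) = hopf_star (u i j) by case: (c0P (i, j)).
have starcorep i j : tensor_eq (hopf_comul (hopf_star (u i j)))
    [seq (hopf_star (u i k), hopf_star (u k j)) | k <- enum 'I_n].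
  move=> b hb; rewrite hopf_comul_star //.
  by rewrite (tensor_eq_star (du i j)) // -map_comp.
have key i j phi : linear_form phi ->
    coef_act phi (c i j) = \sum_m phi (hopf_star (u m j)) *: c i m.
  move=> lin; pose d := coef_act phi (c i j).
  suff : (-1) *: d + \sum_m phi (hopf_star (u m j)) *: c i m = 0.
    by move/eqP; rewrite scaleN1r addrC subr_eq0 => /eqP.
  have hB : bilinear_map (fun x y : G => phi y *: x).
    split=> a x y z; first by rewrite scalerDr !scalerA mulrC.
    by rewrite lin scalerDl scalerA.
  apply: minimal_coef_unique.
    apply: minimal_coef_linear; first exact: minimal_coef_act.
    exact: minimal_coef_sum.
  rewrite eval_coef_linear eval_coef_act // cE eval_coef_sum scaleN1r addrC.
  have := @comul_sum_corep _ _ _ _ _ (\matrix_(i, j) hopf_star (u i j)) i j _ hB.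
  rewrite mxE => -> => [|b hb]; last first.
    by rewrite starcorep // !big_map; apply: eq_bigr => k _; rewrite !mxE.
  by apply/eqP; rewrite subr_eq0; apply/eqP/eq_bigr => m _; rewrite cE !mxE.
exists Y, (fun i k => \matrix_(p, m) c i m k p); split=> [i k z s|v hv].
  apply: form_eq => phi lin; rewrite !linear_form_sum //.
  transitivity (coef_act phi (c i s) k z).
    rewrite mxE; apply: eq_bigr => y _.
    by rewrite linear_formZ // mxE.
  rewrite key // summxE; apply: eq_bigr => m _.
  by rewrite linear_formZ // !mxE mulrC.
have ubar_v i : \sum_m v m 0 *: hopf_star (u i m) = 0.
  transitivity (eval_coef (\sum_m v m 0 *: c i m)).
    by rewrite eval_coef_sum; apply: eq_bigr => m _; rewrite cE.
  have -> : \sum_m v m 0 *: c i m = 0; last exact: eval_coef0.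
  apply/matrixP => k p; have /matrixP/(_ p 0) := hv i k.
  rewrite summxE mxE => h; rewrite [RHS]mxE; rewrite [RHS]mxE in h.
  rewrite -[RHS]h; apply: eq_bigr => m _.
  by rewrite !mxE mulrC.
apply/matrixP => j o; rewrite ord1 mxE.
have : \sum_i (\sum_m v m 0 *: hopf_star (u i m)) * u i j = 0.
  by rewrite big1 // => i _; rewrite ubar_v mul0r.
under eq_bigr => i _ do rewrite mulr_suml.
rewrite exchange_big /=.
have -> : \sum_m \sum_i v m 0 *: hopf_star (u i m) * u i j = v j 0 *: 1.
  rewrite (big_pick (i := j)) => [|m mj].
    transitivity (v j 0 *: (star_mx u *m u) j j); last by rewrite u1 mxE eqxx.
    rewrite mxE scaler_sumr; apply: eq_bigr => i _.
    by rewrite !mxE scalerAl.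
  transitivity (v m 0 *: (star_mx u *m u) m j); last by rewrite u1 mxE mj scaler0.
  rewrite mxE scaler_sumr; apply: eq_bigr => i _.
  by rewrite !mxE scalerAl.
by move/eqP; rewrite scaler_eq0 oner_eq0 orbF => /eqP.
Qed.

End ConjugateIntertwiners.

(** * Unitarity of the dual *)

Section DualUnitarity.
Variable C : numClosedFieldType.

Lemma mulmx1C_rect m n (A : 'M[C]_(m, n)) (B : 'M[C]_(n, m)) :
  m = n -> A *m B = 1%:M -> B *m A = 1%:M.
Proof. by move=> e; case: n / e in A B *; apply: mulmx1C. Qed.

(** The second and third hypotheses make a unitary, and the fourth, e1 in the
    proof, says that its transpose is unitary up to the twists Q and Q'.  Put Z_ij = Q' a_ij - a_ij Q.  The sum of
    tr (Z_ij Q^-1 Z_ij^* ) expands, by unitarity and by both one-sided forms of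
    e1, into four terms equal to h tr Q' or h tr Q, and e1 also makes these two
    equal.  So the sum vanishes; since Q is a sum of squares, so does every Z_ij,
    and then the twists cancel in e1. *)
Lemma transpose_unitary n n' h (a : 'I_h -> 'I_h -> 'M[C]_(n', n))
    (I : finType) p p' (E : I -> 'M[C]_(p, n)) (E' : I -> 'M[C]_(p', n'))
    (Q := \sum_q (E q)^t* *m E q) (Q' := \sum_q (E' q)^t* *m E' q) :
  n = n' ->
  (forall j k, \sum_i (a i j)^t* *m a i k = (j == k)%:R%:M) ->
  (forall i j, \sum_k a i k *m (a j k)^t* = (i == j)%:R%:M) ->
  (forall j k, \sum_l (a j l)^t* *m Q' *m a k l = (j == k)%:R *: Q) ->
  Q \in unitmx ->
  (forall i j, \sum_k (a i k)^t* *m a j k = (i == j)%:R%:M) /\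
  (forall i j, \sum_k a k i *m (a k j)^t* = (i == j)%:R%:M).
Proof.
move=> en iso coiso e1 uQ.
have eD : (h * n' = n * h)%N by rewrite mulnC en.
have Qa : Q^t* = Q.
  by rewrite dag_sum; apply: eq_bigr => q _; rewrite dagM trmxCK.
have Q'a : Q'^t* = Q'.
  by rewrite dag_sum; apply: eq_bigr => q _; rewrite dagM trmxCK.
pose A : 'M[C]_(h * n', n * h) := mx_of_blocks (fun l k => a k l).
have bA l k : blk A l k = a k l by apply: blk_mx_of_blocks.
have adjE m (M : 'M[C]_(h * m, n * h)) (x : 'I_n) j c :
    (M^t*) (idx (x, j)) c = (M c (idx (x, j)))^* by rewrite !mxE.
(* The other one-sided form of e1: a one-sided inverse between spaces of equal
   dimension is two-sided. *)
have e2 l l' : \sum_k a k l *m invmx Q *m (a k l')^t* *m Q' = (l == l')%:R%:M.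
  have f1 : (A^t* *m ((1%:M *t Q') *m A)) *m (invmx Q *t 1%:M) = 1%:M.
    have -> : A^t* *m ((1%:M *t Q') *m A) = Q *t 1%:M.
      apply/matrixP => r c.
      case: (mxtens_indexP r) => x j; case: (mxtens_indexP c) => x' j'.
      rewrite tensmxE one_mxE mxE sum_idx mulrC.
      have /matrixP/(_ x x') := e1 j j'; rewrite [RHS]mxE => <-.
      rewrite summxE; apply: eq_bigr => m _; rewrite -mulmxA mxE.
      apply: eq_bigr => y _; rewrite mul_tens1l adjE blkE bA !mxE.
      congr (_ * _); apply: eq_bigr => z _.
      by rewrite blkE bA.
    by rewrite tensmx_mul mulmxV // mul1mx tensmx11.
  have {f1} : ((1%:M *t Q') *m A *m (invmx Q *t 1%:M)) *m A^t* = 1%:M.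
    by apply: mulmx1C_rect; rewrite -?f1 ?mulmxA.
  move=> f1; have {f1} : A *m (invmx Q *t 1%:M) *m A^t* *m (1%:M *t Q') = 1%:M.
    by apply: mulmx1C; rewrite !mulmxA.
  move=> /matrixP f1; apply/matrixP => y y'.
  have := f1 (idx (l, y)) (idx (l', y')).
  rewrite mx_delta mx_deltaM => <-.
  rewrite -mulmxA mxE sum_idx exchange_big summxE /=; apply: eq_bigr => k _.
  rewrite -!mulmxA !mulmxA -mulmxA mxE; apply: eq_bigr => x _.
  rewrite blkE blk_mulr bA; congr (_ * _).
  rewrite mul1l_tens mxE; apply: eq_bigr => z _.
  by rewrite adjE blkE bA !mxE.
have hQ : h%:R * \tr Q = h%:R * \tr Q'.
  transitivity (\sum_(j < h) \sum_l \tr ((a j l)^t* *m Q' *m a j l)).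
    rewrite mulr_natl -[X in _ *+ X]card_ord -sumr_const; apply: eq_bigr => j _.
    by rewrite -raddf_sum e1 eqxx scale1r.
  rewrite mulr_natl -[X in _ *+ X]card_ord -sumr_const; apply: eq_bigr => j _.
  transitivity (\tr (Q' *m \sum_l (a j l *m (a j l)^t*))); last first.
    by rewrite coiso eqxx mulmx1.
  rewrite mulmx_sumr raddf_sum; apply: eq_bigr => l _ /=.
  by rewrite -mulmxA mxtrace_mulC mulmxA.
pose Z i j := Q' *m a i j - a i j *m Q.
pose Y i j := Z i j *m invmx Q.
have YQ i j : Y i j *m Q = Z i j by rewrite mulmxKV.
have ZZ i j : Y i j *m (Z i j)^t* =
    Q' *m a i j *m invmx Q *m (a i j)^t* *m Q' - Q' *m (a i j *m (a i j)^t*) -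
    (a i j *m (a i j)^t*) *m Q' + a i j *m Q *m (a i j)^t*.
  rewrite /Y /Z mulmxBl mulmxK // dagB !dagM Qa Q'a.
  by rewrite mulmxBl !mulmxBr !mulmxA mulmxKV // opprB addrA addrAC.
have sumZ : \sum_i \sum_j \tr (Y i j *m (Z i j)^t*) = 0.
  transitivity (h%:R * \tr Q' - h%:R * \tr Q' - h%:R * \tr Q' + h%:R * \tr Q);
    last by rewrite hQ subrr sub0r addNr.
  under eq_bigr => i _ do under eq_bigr => j _ do rewrite ZZ !raddfD !raddfN /=.
  under eq_bigr => i _ do rewrite !big_split !sumrN /=.
  rewrite !big_split !sumrN /=; congr (_ - _ - _ + _).
  - rewrite exchange_big mulr_natl -[X in _ *+ X]card_ord -sumr_const /=.
    apply: eq_bigr => j _.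
    transitivity (\tr (Q' *m \sum_k a k j *m invmx Q *m (a k j)^t* *m Q')).
      by rewrite mulmx_sumr raddf_sum; apply: eq_bigr => k _ /=; rewrite !mulmxA.
    by rewrite e2 eqxx mulmx1.
  - rewrite mulr_natl -[X in _ *+ X]card_ord -sumr_const /=.
    apply: eq_bigr => i _; rewrite -[in RHS](mulmx1 Q').
    have := coiso i i; rewrite eqxx => <-.
    by rewrite mulmx_sumr raddf_sum.
  - rewrite mulr_natl -[X in _ *+ X]card_ord -sumr_const /=.
    apply: eq_bigr => i _; rewrite -[in RHS](mul1mx Q').
    have := coiso i i; rewrite eqxx => <-.
    by rewrite mulmx_suml raddf_sum.
  - rewrite exchange_big mulr_natl -[X in _ *+ X]card_ord -sumr_const /=.
    apply: eq_bigr => j _; rewrite -[in RHS](mulmx1 Q).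
    have := iso j j; rewrite eqxx => <-.
    rewrite mulmx_sumr raddf_sum; apply: eq_bigr => i _ /=.
    by rewrite -mulmxA mxtrace_mulC mulmxA.
have trY i j : \tr (Y i j *m (Z i j)^t*) =
    \sum_q \tr ((Y i j *m (E q)^t*) *m (Y i j *m (E q)^t*)^t*).
  rewrite -YQ dagM Qa mulmx_suml mulmx_sumr raddf_sum.
  by apply: eq_bigr => q _ /=; rewrite [in RHS]dagM trmxCK !mulmxA.
have trY_ge0 i j : 0 <= \tr (Y i j *m (Z i j)^t*).
  by rewrite trY sumr_ge0 // => q _; apply: trace_mul_dag_ge0.
have Z0 i j : Z i j = 0.
  have /eqP := sumZ; rewrite psumr_eq0 => [/allP/(_ i (mem_index_enum i))|k _];
    last by rewrite sumr_ge0.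
  rewrite psumr_eq0 => [/allP/(_ j (mem_index_enum j))|//].
  rewrite trY psumr_eq0 => [/allP YE|q _]; last exact: trace_mul_dag_ge0.
  rewrite -YQ mulmx_sumr big1 // => q _; rewrite mulmxA.
  by have /eqP/trace_mul_dag_eq0 -> := YE q (mem_index_enum q); rewrite mul0mx.
have comm i j : Q' *m a i j = a i j *m Q by apply/eqP; rewrite -subr_eq0 -/(Z i j) Z0.
have co i j : \sum_k (a i k)^t* *m a j k = (i == j)%:R%:M.
  transitivity ((\sum_k (a i k)^t* *m Q' *m a j k) *m invmx Q).
    rewrite mulmx_suml; apply: eq_bigr => k _.
    by rewrite -!mulmxA (mulmxA Q') comm mulmxK.
  by rewrite e1 -scalemxAl mulmxV // scalemx1.
split=> //.
have A1 : A^t* *m A = 1%:M.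
  by apply/blk_isometryP => j j'; rewrite -co; apply: eq_bigr => l _; rewrite !bA.
have /blk_coisometryP A2 : A *m A^t* = 1%:M by apply: mulmx1C_rect A1; rewrite eD.
by move=> i j; rewrite -A2; apply: eq_bigr => k _; rewrite !bA.
Qed.

End DualUnitarity.

Section DualUpt.
Variables (R : realType) (G : compact_quantum_group R).
Local Notation C := R[i].

(** The two halves of the unitarity of the components of the dual. *)
Record is_dual_unitary (F1 F2 : fibre_functor G) h (a : block_family F1 F2 h) :
    Prop := IsDualUnitary {
  dual_iso : forall X i j, \sum_k (a X i k)^t* *m a X j k = (i == j)%:R%:M;
  dual_coiso : forall X i j, \sum_k a X k i *m (a X k j)^t* = (i == j)%:R%:M
}.

Lemma dual_upt_is_upt F1 F2 (al : upt_data F1 F2) :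
  is_upt al -> is_dual_unitary (upt_blk al) -> is_upt (dual_upt al).
Proof.
move=> /is_uptP[iso coiso nat mul un] [iso' coiso'].
apply/is_uptP; split.
- move=> X i j; rewrite -coiso'; apply: eq_bigr => k _.
  by rewrite !dual_upt_blk trmxCK.
- move=> X i j; rewrite -iso'; apply: eq_bigr => k _.
  by rewrite !dual_upt_blk trmxCK.
- move=> X Y f i j; rewrite !dual_upt_blk.
  have := nat Y X (dag_hom f) i j; rewrite !ff_dag => /(congr1 (fun M => M^t*)).
  by rewrite !dagM !trmxCK.
- move=> X Y i j; rewrite dual_upt_blk.
  have [m1 m1'] := ff_mult_unitary F1 X Y.
  have [m2 m2'] := ff_mult_unitary F2 X Y.
  have := congr1 (fun M => ff_mult F1 X Y *m M^t* *m ff_mult F2 X Y) (mul X Y i j).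
  rewrite /= !dagM !mulmxA m1' mul1mx => ->.
  rewrite -!mulmxA m2 mulmx1 dag_sum; congr (_ *m _); apply: eq_bigr => k _.
  by rewrite dag_tens !dual_upt_blk.
move=> i j; rewrite dual_upt_blk.
have [u1 u1'] := ff_unit_unitary F1; have [u2 u2'] := ff_unit_unitary F2.
have := congr1 (fun M => ff_unit F1 *m M^t* *m ff_unit F2) (un i j).
rewrite /= !dagM !mulmxA u1' mul1mx => ->.
by rewrite dagZ -scalemxAr -scalemxAl -mulmxA u2 mulmx1 conjC_nat.
Qed.

(** Each D q is the same thing as an invariant vector r q in the tensor product
    of X and Y.  Naturality and monoidality of a at r q relate a at Y with a at X
    through E q and E' q, conjugates of D q and of its counterpart D' q for the
    target (the equation star below).  Summing the squares of these relations yields the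
    twisted relations of [transpose_unitary]; Q is invertible because the D q
    have no common kernel. *)
Lemma upt_dual_unitary (F : fibre_functor G) h
    (a : block_family (canonical_ff G) F h) :
  (0 < h)%N -> is_block_upt a -> is_dual_unitary a.
Proof.
move=> h0 [iso coiso nat mul un].
have dimE X : rep_dim X = F X.
  apply/eqP; rewrite -(eqn_pmul2l h0); apply/eqP.
  pose A := mx_of_blocks (a X).
  have A1 : A^t* *m A = 1%:M.
    apply/blk_isometryP => j k; rewrite -iso; apply: eq_bigr => i _.
    by rewrite !blk_mx_of_blocks.
  have A2 : A *m A^t* = 1%:M.
    apply/blk_coisometryP => j k; rewrite -coiso; apply: eq_bigr => i _.
    by rewrite !blk_mx_of_blocks.
  apply/eqP; rewrite eqn_leq [(h * rep_dim X)%N]mulnC.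
  by rewrite (mulmx1_min A1) (mulmx1_min A2).
suff du X : (forall i j, \sum_k (a X i k)^t* *m a X j k = (i == j)%:R%:M) /\
    (forall i j, \sum_k a X k i *m (a X k j)^t* = (i == j)%:R%:M).
  by split=> X; case: (du X).
have [Y [D [Dint Dinj]]] := conjugate_intertwiners X.
pose n := rep_dim X; pose N := rep_dim Y.
pose u := rep_mx X; pose w := rep_mx Y.
have [_ _ uu] := rep_unitary X.
pose r q : 'M[C]_(n * N, 1) :=
  \col_k D q.1 q.2 (mxtens_unindex k).2 (mxtens_unindex k).1.
have rint q : scalar_map G (r q) *m rep_mx (unit_rep G) =
    rep_mx (tensor_rep X Y) *m scalar_map G (r q).
  rewrite mulmx1; apply/matrixP => k o; rewrite {o}ord1.
  case: (mxtens_indexP k) => t z; rewrite [RHS]mxE sum_idx.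
  transitivity (\sum_x u t x * \sum_y D q.1 q.2 y x *: w z y); last first.
    apply: eq_bigr => x _; rewrite mulr_sumr; apply: eq_bigr => y _.
    by rewrite tensmxE !mxE mxtens_indexK /= -[LHS]scalerAr -[RHS]scalerAr mulr1.
  under eq_bigr => x _ do rewrite Dint mulr_sumr.
  rewrite exchange_big /= (big_pick (i := t)) => [|s st].
    transitivity (D q.1 q.2 z t *: (u *m star_mx u) t t).
      by rewrite uu !mxE mxtens_indexK eqxx.
    rewrite mxE scaler_sumr; apply: eq_bigr => x _.
    by rewrite !mxE scalerAr.
  transitivity (D q.1 q.2 z s *: (u *m star_mx u) t s).
    rewrite mxE scaler_sumr; apply: eq_bigr => x _.
    by rewrite !mxE scalerAr.
  by rewrite uu mxE eq_sym st scaler0.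
pose rh q : rep_hom (unit_rep G) (tensor_rep X Y) :=
  @RepHom _ _ (unit_rep G) (tensor_rep X Y) (r q) (rint q).
pose r' q := (ff_mult F X Y)^t* *m (ff_hom F (rh q) *m ff_unit F).
pose D' q : 'M[C]_(F Y, F X) := \matrix_(y, x) r' q (idx (x, y)) 0.
(* Monoidality of a at r q, with the tensor unfolded into a matrix. *)
have inter q i j : \sum_k a Y k j *m D q.1 q.2 *m (a X i k)^T = (i == j)%:R *: D' q.
  have [m1 _] := ff_mult_unitary F X Y.
  have e : (\sum_k a X i k *t a Y k j) *m r q = (i == j)%:R *: r' q.
    have eR : ff_hom (canonical_ff G) (rh q) *m ff_unit (canonical_ff G) = r q.
      by rewrite mulmx1.
    have eM : ff_mult (canonical_ff G) X Y = 1%:M :> 'M_(rep_dim X * rep_dim Y) by [].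
    have := mul X Y i j; rewrite eM mulmx1.
    move/(congr1 (mulmx ((ff_mult F X Y)^t*))); rewrite mulmxA m1 mul1mx => <-.
    rewrite -eR -mulmxA (mulmxA (a _ _ _)) -nat -mulmxA un.
    by rewrite -!scalemxAr.
  apply/matrixP => y' x'; rewrite mxE [D' q _ _]mxE.
  have /matrixP/(_ (idx (x', y')) 0) := e; rewrite [RHS]mxE => <-.
  rewrite mulmx_suml !summxE; apply: eq_bigr => k _.
  rewrite mxE [RHS]mxE sum_idx; apply: eq_bigr => x _.
  rewrite mxE mulr_suml; apply: eq_bigr => y _.
  by rewrite tensmxE !mxE mxtens_indexK /= mulrC mulrA.
pose E q : 'M[C]_(N, n) := map_mx Num.conj (D q.1 q.2).
pose E' q : 'M[C]_(F Y, F X) := map_mx Num.conj (D' q).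
(* One copy of a moved to the other side by unitarity, then conjugated. *)
have star q l j : map_mx Num.conj (a Y l j) *m E q = E' q *m a X j l.
  have e : a Y l j *m D q.1 q.2 = D' q *m map_mx Num.conj (a X j l).
    transitivity (\sum_i (\sum_k a Y k j *m D q.1 q.2 *m (a X i k)^T) *m
        map_mx Num.conj (a X i l)).
      under eq_bigr => i _ do rewrite mulmx_suml.
      rewrite exchange_big /= (big_pick (i := l)) => [|k kl].
        under eq_bigr => i _ do rewrite -mulmxA.
        rewrite -mulmx_sumr -[LHS]mulmx1; congr (_ *m _); apply: (can_inj trmxK).
        rewrite raddf_sum /= trmx1; have := iso X l l; rewrite eqxx => <-.
        by apply: eq_bigr => i _; rewrite trmx_mul trmxK map_trmx.
      have e : \sum_i (a X i k)^T *m map_mx Num.conj (a X i l) = 0.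
        apply: (can_inj trmxK); rewrite raddf_sum /= trmx0.
        transitivity (\sum_i (a X i l)^t* *m a X i k).
          by apply: eq_bigr => i _; rewrite trmx_mul trmxK map_trmx.
        by rewrite iso eq_sym kl -scalemx1 scale0r.
      under eq_bigr => i _ do rewrite -mulmxA.
      by rewrite -mulmx_sumr e mulmx0.
    rewrite (big_pick (i := j)) => [|i ij]; last by rewrite inter ij scale0r mul0mx.
    by rewrite inter eqxx scale1r.
  have := congr1 (map_mx Num.conj) e; rewrite !map_mxM => ->; congr (_ *m _).
  by apply/matrixP => x y; rewrite !mxE /= conjCK.
apply: (transpose_unitary (E := E) (E' := E') (dimE X) (iso X) (coiso X)).
  move=> j k; under eq_bigr => l _ do rewrite mulmx_sumr mulmx_suml.
  rewrite exchange_big scaler_sumr; apply: eq_bigr => q _ /=.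
  transitivity (\sum_l (map_mx Num.conj (a Y l j) *m E q)^t* *m
      (map_mx Num.conj (a Y l k) *m E q)).
    by apply: eq_bigr => l _; rewrite !star dagM !mulmxA.
  transitivity ((E q)^t* *m (\sum_l map_mx Num.conj ((a Y l j)^t* *m a Y l k)) *m E q).
    rewrite mulmx_sumr mulmx_suml; apply: eq_bigr => l _.
    rewrite [(_ *m _)^t*]dagM.
    have -> : (map_mx Num.conj (a Y l j))^t* = map_mx Num.conj ((a Y l j)^t*).
      by rewrite map_trmx.
    by rewrite [X in _ = _ *m X *m _]map_mxM !mulmxA.
  have -> : \sum_l map_mx Num.conj ((a Y l j)^t* *m a Y l k) = (j == k)%:R%:M.
    transitivity (map_mx Num.conj (\sum_l (a Y l j)^t* *m a Y l k)).
      by rewrite raddf_sum.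
    rewrite iso; apply/matrixP => x y.
    by rewrite mxE mx_deltaM -natrM; apply: conjC_nat.
  by rewrite mul_mx_scalar -scalemxAl.
rewrite -row_free_unit -kermx_eq0; apply/eqP/row_matrixP => i0.
rewrite row0; set v := row i0 _.
have vQ : v *m \sum_q (E q)^t* *m E q = 0.
  by apply/sub_kermxP; apply: row_sub.
have Ev q : E q *m v^t* = 0.
  have := congr1 (fun M => \tr (M *m v^t*)) vQ.
  rewrite mul0mx mxtrace0 mulmx_sumr mulmx_suml raddf_sum /=.
  have -> : \sum_q \tr (v *m ((E q)^t* *m E q) *m v^t*) =
      \sum_q \tr ((v *m (E q)^t*) *m (v *m (E q)^t*)^t*).
    by apply: eq_bigr => p _; rewrite [in RHS]dagM trmxCK !mulmxA.
  move/eqP; rewrite psumr_eq0 => [/allP h1|p _]; last exact: trace_mul_dag_ge0.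
  have /eqP/trace_mul_dag_eq0 := h1 q (mem_index_enum q).
  move/(congr1 (fun M => M^t*)); rewrite dagM trmxCK => ->.
  by rewrite trmx0 map_mx0.
have : v^T = 0.
  apply: Dinj => i k; have := congr1 (map_mx Num.conj) (Ev (i, k)).
  rewrite map_mxM map_mx0 => <-; congr (_ *m _);
    by apply/matrixP => x y; rewrite !mxE /= conjCK.
by move/(congr1 trmx); rewrite trmxK trmx0.
Qed.

End DualUpt.

(** * The Frobenius monoid of a transformation *)

Section PairMonoid.
Variables (R : realType).
Local Notation C := R[i].
Local Notation id_ n := (1%:M : 'M[C]_n) (only parsing).

Definition sqd h : C := sqrtC h%:R.

Lemma sqd_conj h : (sqd h)^* = sqd h.
Proof. by apply: conj_Creal; rewrite ger0_real // sqrtC_ge0 ler0n. Qed.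

Lemma sqdK h : sqd h * sqd h = h%:R.
Proof. by rewrite -expr2 sqrtCK. Qed.

Lemma sqd_neq0 h : (0 < h)%N -> sqd h != 0.
Proof. by move=> h0; rewrite sqrtC_eq0 pnatr_eq0 -lt0n. Qed.

Lemma cast_1mid a b (e : (a * b = a * 1 * b)%N) i j :
  cast_ord e (idx (i, j)) = idx (idx (i, ord0), j).
Proof. by apply: val_inj; rewrite /= muln1 addn0. Qed.

Lemma pair_mulE h (i j k l m n : 'I_h) :
  pair_mul R h (idx (i, j)) (idx (idx (k, l), idx (m, n))) =
  (sqd h)^-1 * ((i == k)%:R * (l == m)%:R * (j == n)%:R).
Proof.
rewrite strict_castE cast_1mid cast_idxAA mxE; congr (_ * _).
by rewrite !tensmxE !one_mxE mxE mxE coevE conjC_nat.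
Qed.

Lemma pair_oneE h (i j : 'I_h) k : pair_one R h (idx (i, j)) k = sqd h * (i == j)%:R.
Proof. by rewrite mxE mxE mxE evE conjC_nat. Qed.

(** The Frobenius axioms read entry by entry, free of the associativity casts. *)
Lemma special_frobenius_entries (A : monoid_data R)
    (a := mon_dim A) (mu := fun x y z => mon_mul A x (idx (y, z)))
    (u := fun x => mon_one A x 0) :
  (forall x i j k, \sum_z mu x z k * mu z i j = \sum_z mu x i z * mu z j k) ->
  (forall x i, \sum_z mu x z i * u z = (x == i)%:R) ->
  (forall x i, \sum_z mu x i z * u z = (x == i)%:R) ->
  (forall y1 y2 x1 x2, \sum_q mu y1 x1 q * (mu x2 q y2)^* =
    \sum_z (mu z y1 y2)^* * mu z x1 x2) ->
  (forall y1 y2 x1 x2, \sum_q mu y2 q x2 * (mu x1 y1 q)^* =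
    \sum_z (mu z y1 y2)^* * mu z x1 x2) ->
  (forall x y, \sum_i \sum_j mu x i j * (mu y i j)^* = (x == y)%:R) ->
  is_special_frobenius A.
Proof.
move=> hA hl hr h1 h2 hs; split.
- apply/strict_eqP => x c; case: (mxtens_indexP c) => b k.
  case: (mxtens_indexP b) => i j.
  by rewrite cast_ord_id cast_idxAV mul1r_tens mul1l_tens hA.
- apply/strict_eqP => x c; case: (mxtens_indexP c) => o i.
  by rewrite cast_ord_id cast_idx1l mul1r_tens ord1 hl mxE.
- apply/strict_eqP => x c; case: (mxtens_indexP c) => i o.
  by rewrite cast_ord_id cast_idx1r mul1l_tens ord1 hr mxE.
- split; apply/matrixP => b c; case: (mxtens_indexP b) => y1 y2;
    case: (mxtens_indexP c) => x1 x2.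
    rewrite [RHS]mxE strict_compE sum_idx (big_pick (i := x1)) => [|p px].
      rewrite sum_idx.
      under eq_bigr => q _.
        rewrite (big_pick (i := y2)) => [|r ry]; last first.
          by rewrite cast_idxA !tensmxE !one_mxE [y2 == r]eq_sym ry mulr0 mul0r.
        rewrite cast_idxA !tensmxE !one_mxE !eqxx mulr1 mul1r mxE mxE.
        over.
      by rewrite h1; apply: eq_bigr => z _; rewrite !mxE.
    by rewrite big1 // => k _; case: (mxtens_indexP k) => q r;
      rewrite !tensmxE one_mxE px mul0r mulr0.
  rewrite [RHS]mxE strict_compE sum_idx.
  rewrite exchange_big (big_pick (i := x2)) => [|p px]; last first.
    by rewrite big1 // => k _; rewrite !tensmxE one_mxE px !mulr0.
  rewrite sum_idx (big_pick (i := y1)) => [|p py]; last first.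
    by rewrite big1 // => k _; rewrite cast_idxAV !tensmxE one_mxE eq_sym py !mul0r.
  transitivity (\sum_q mu y2 q x2 * (mu x1 y1 q)^*); last first.
    by rewrite h2; apply: eq_bigr => z _; rewrite !mxE.
  apply: eq_bigr => q _.
  by rewrite cast_idxAV !tensmxE !one_mxE !eqxx mulr1 mul1r !mxE.
- apply/matrixP => x y; rewrite mxE sum_idx one_mxE -hs.
  by apply: eq_bigr => i _; apply: eq_bigr => j _; rewrite !mxE.
Qed.

(* Evaluates the outermost sum at the one index where its terms do not vanish. *)
Ltac pick k := rewrite (big_pick (i := k)); last by
  (let z := fresh "z" in let zk := fresh "zk" in move=> z zk;
   try (rewrite big1 //; move=> ? _);
   rewrite ?zk ?(eq_sym _ z) ?zk !(mulr0, mul0r, conjC0)).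

Lemma trueR : true%:R = 1 :> C. Proof. by []. Qed.

Lemma pair_mul_conj h x y : (pair_mul R h x y)^* = pair_mul R h x y.
Proof.
case: (mxtens_indexP x) => i j; case: (mxtens_indexP y) => a b.
case: (mxtens_indexP a) => k l; case: (mxtens_indexP b) => m n.
by rewrite pair_mulE -!natrM rmorphM /= conjC_nat fmorphV /= sqd_conj.
Qed.

Lemma pair_special_frobenius h : (0 < h)%N -> is_special_frobenius (pair_monoid R h).
Proof.
move=> h0; have s0 := sqd_neq0 h0.
apply: special_frobenius_entries.
- move=> x i j k; case: (mxtens_indexP x) => x1 x2; case: (mxtens_indexP i) => i1 i2.
  case: (mxtens_indexP j) => j1 j2; case: (mxtens_indexP k) => k1 k2.
  rewrite !sum_idx.
  under eq_bigr => z1 _ do under eq_bigr => z2 _ do rewrite !pair_mulE.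
  under [RHS]eq_bigr => z1 _ do under eq_bigr => z2 _ do rewrite !pair_mulE.
  pick i1; pick j2; pick j1; pick k2; rewrite !eqxx; ring.
- move=> x i; case: (mxtens_indexP x) => x1 x2; case: (mxtens_indexP i) => i1 i2.
  rewrite !sum_idx.
  under eq_bigr => z1 _ do under eq_bigr => z2 _ do rewrite pair_mulE pair_oneE.
  pick x1; pick x1; rewrite !eqxx eq_mxtens_index -mulnb natrM trueR.
  by field; rewrite s0.
- move=> x i; case: (mxtens_indexP x) => x1 x2; case: (mxtens_indexP i) => i1 i2.
  rewrite !sum_idx.
  under eq_bigr => z1 _ do under eq_bigr => z2 _ do rewrite pair_mulE pair_oneE.
  pick i2; pick i2; rewrite !eqxx eq_mxtens_index -mulnb natrM trueR.
  by field; rewrite s0.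
- move=> y z x i; case: (mxtens_indexP x) => x1 x2; case: (mxtens_indexP i) => i1 i2.
  case: (mxtens_indexP y) => y1 y2; case: (mxtens_indexP z) => z1 z2.
  rewrite !sum_idx.
  under eq_bigr => j1 _ do under eq_bigr => j2 _ do rewrite pair_mul_conj !pair_mulE.
  under [RHS]eq_bigr => j1 _ do under eq_bigr => j2 _ do rewrite pair_mul_conj !pair_mulE.
  pick x2; pick y2; pick y1; pick z2; rewrite !eqxx [i1 == x2]eq_sym [i2 == z2]eq_sym.
  rewrite [y1 == x1]eq_sym; ring.
- move=> y z x i; case: (mxtens_indexP x) => x1 x2; case: (mxtens_indexP i) => i1 i2.
  case: (mxtens_indexP y) => y1 y2; case: (mxtens_indexP z) => z1 z2.
  rewrite !sum_idx.
  under eq_bigr => j1 _ do under eq_bigr => j2 _ do rewrite pair_mul_conj !pair_mulE.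
  under [RHS]eq_bigr => j1 _ do under eq_bigr => j2 _ do rewrite pair_mul_conj !pair_mulE.
  pick z1; pick i1; pick y1; pick z2; rewrite !eqxx [x1 == y1]eq_sym; ring.
- move=> y z; case: (mxtens_indexP y) => y1 y2; case: (mxtens_indexP z) => z1 z2.
  rewrite !sum_idx.
  transitivity (\sum_(i2 < h) (sqd h)^-1 * (sqd h)^-1 * ((y1 == z1)%:R * (y2 == z2)%:R)).
    rewrite (big_pick (i := y1)) => [|k ky]; last first.
      rewrite big1 // => i2 _; rewrite sum_idx big1 // => i _; rewrite big1 // => j _.
      by rewrite pair_mulE eq_sym ky !(mul0r, mulr0).
    apply: eq_bigr => i2 _; rewrite sum_idx.
    under eq_bigr => j1 _ do under eq_bigr => j2 _ do rewrite pair_mul_conj !pair_mulE.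
    pick i2; pick y2; rewrite !eqxx trueR [z1 == y1]eq_sym [z2 == y2]eq_sym; ring.
  rewrite sumr_const card_ord eq_mxtens_index -mulnb natrM -[LHS]mulr_natl -(sqdK h).
  by field; rewrite s0.
Qed.

(** This lemma and the next two evaluate both sides of [is_modificationP] for the
    unit and the multiplication. *)
Lemma coev_sum (V : lmodType C) h (F : 'I_(h * h) -> V) :
  \sum_k pair_one R h k 0 *: F k = sqd h *: \sum_i F (idx (i, i)).
Proof.
rewrite sum_idx scaler_sumr; apply: eq_bigr => i _.
rewrite (big_pick (i := i)) => [|j ji]; rewrite pair_oneE ?eqxx ?mulr1 //.
by rewrite eq_sym ji mulr0 scale0r.
Qed.

Lemma pair_mul_sum_in (V : lmodType C) h (F : 'I_(h * h) -> V) k l m n :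
  \sum_x pair_mul R h x (idx (idx (k, l), idx (m, n))) *: F x =
  (sqd h)^-1 *: ((l == m)%:R *: F (idx (k, n))).
Proof.
rewrite sum_idx (big_pick (i := k)) => [|i ik]; last first.
  by rewrite big1 // => j _; rewrite pair_mulE ik !mul0r mulr0 scale0r.
rewrite (big_pick (i := n)) => [|j jn]; last first.
  by rewrite pair_mulE jn !mulr0 scale0r.
by rewrite pair_mulE !eqxx mul1r mulr1 scalerA.
Qed.

Lemma pair_mul_sum_out (V : lmodType C) h (F : 'I_(h * h * (h * h)) -> V) i j :
  \sum_x pair_mul R h (idx (i, j)) x *: F x =
  (sqd h)^-1 *: \sum_l F (idx (idx (i, l), idx (l, j))).
Proof.
rewrite sum_idx sum_idx (big_pick (i := i)) => [|k ki]; last first.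
  rewrite big1 // => l _; rewrite sum_idx big1 // => m _; rewrite big1 // => n _.
  by rewrite pair_mulE eq_sym ki !mul0r mulr0 scale0r.
rewrite scaler_sumr; apply: eq_bigr => l _.
rewrite sum_idx (big_pick (i := l)) => [|m ml]; last first.
  by rewrite big1 // => n _; rewrite pair_mulE [l == m]eq_sym ml mulr0 mul0r mulr0 scale0r.
rewrite (big_pick (i := j)) => [|n nj]; last first.
  by rewrite pair_mulE [j == n]eq_sym nj !mulr0 scale0r.
by rewrite pair_mulE !eqxx !mulr1.
Qed.

End PairMonoid.

Section UptMonoid.
Variables (R : realType) (G : compact_quantum_group R).
Local Notation C := R[i].

(** Multiplication and unit are modifications exactly by the two relations of
    [is_dual_unitary]. *)
Lemma upt_monoid_simple (F1 F2 : fibre_functor G) (al : upt_data F1 F2) :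
  nonzero_upt al -> is_dual_unitary (upt_blk al) ->
  is_simple_frobenius (upt_monoid al).
Proof.
move=> [ual h0] du; have udual := dual_upt_is_upt ual du.
have blkE X i j k l : upt_blk (upt_monoid al) X (idx (i, k)) (idx (j, l)) =
    (upt_blk al X k l)^t* *m upt_blk al X i j.
  by rewrite comp_upt_blk dual_upt_blk.
split.
- exact: comp_upt_is_upt.
- apply/is_modificationP => X i j; case: (comp_idxP i) => i1 i2.
  case: (comp_idxP j) => a b; case: (comp_idxP a) => j1 j2.
  case: (comp_idxP b) => j3 j4.
  rewrite pair_mul_sum_in pair_mul_sum_out; congr (_ *: _).
  rewrite blkE.
  transitivity ((upt_blk al X i2 j4)^t* *m (\sum_k upt_blk al X k j3 *m
     (upt_blk al X k j2)^t*) *m upt_blk al X i1 j1).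
    rewrite (dual_coiso du) mul_mx_scalar -scalemxAl.
    by rewrite [j3 == _]eq_sym.
  rewrite mulmx_sumr mulmx_suml; apply: eq_bigr => k _.
  by rewrite comp_upt_blk !blkE !mulmxA.
- apply/is_modificationP => X i j; case: (comp_idxP i) => i1 i2.
  rewrite ord1 coev_sum big_ord1 pair_oneE id_upt_blk -scalerA; congr (_ *: _).
  under eq_bigr => k _ do rewrite blkE.
  by rewrite (dual_iso du) eq_sym scalemx1.
- exact: pair_special_frobenius.
exists (upt_dim al) => //; exists 1%:M; split.
- exact: unitary1.
- by rewrite tensmx11 mulmx1 mul1mx.
- by rewrite mul1mx.
Qed.

End UptMonoid.

(** * Modifications *)

Section Modifications.
Variables (R : realType) (G : compact_quantum_group R).
Local Notation C := R[i].
Implicit Types (F : fibre_functor G).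

Lemma mod_id F1 F2 (al : upt_data F1 F2) : @is_modification _ _ F1 F2 al al 1%:M.
Proof. by move=> X; rewrite !tensmx11 mulmx1 mul1mx. Qed.

Lemma mod_comp F1 F2 (al be ga : upt_data F1 F2)
    (f : 'M[C]_(upt_dim be, upt_dim al)) (g : 'M[C]_(upt_dim ga, upt_dim be)) :
  is_modification f -> is_modification g ->
  @is_modification _ _ F1 F2 al ga (g *m f).
Proof.
move=> hf hg X.
have -> : 1%:M *t (g *m f) = (1%:M *t g) *m (1%:M *t f) :> 'M_(F1 X * _, _).
  by rewrite tensmx_mul mulmx1.
have -> : (g *m f) *t 1%:M = (g *t 1%:M) *m (f *t 1%:M) :> 'M_(_, _ * F2 X).
  by rewrite tensmx_mul mulmx1.
by rewrite mulmxA hg -!mulmxA hf.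
Qed.

Lemma mod_dag F1 F2 (al be : upt_data F1 F2)
    (f : 'M[C]_(upt_dim be, upt_dim al)) :
  is_upt al -> is_upt be -> is_modification f ->
  @is_modification _ _ F1 F2 be al (f^t*).
Proof.
move=> [ual _ _ _] [ube _ _ _] hf X.
have [a1 a2] := ual X; have [b1 b2] := ube X.
have := congr1 (fun M => al X *m M^t* *m be X) (hf X).
rewrite /= !dagM !dag_tens !dag1 !mulmxA a2 mul1mx => <-.
by rewrite -!mulmxA b1 mulmx1.
Qed.

Lemma sum_scale_mul (m n p : nat) (I J : finType) (a : I -> C) (b : J -> C)
    (A : J -> 'M[C]_(m, n)) (B : I -> 'M[C]_(n, p)) :
  (\sum_j b j *: A j) *m (\sum_i a i *: B i) =
  \sum_i \sum_j (a i * b j) *: (A j *m B i).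
Proof.
rewrite mulmx_sumr; apply: eq_bigr => i _.
rewrite mulmx_suml; apply: eq_bigr => j _.
by rewrite -scalemxAl -scalemxAr scalerA mulrC.
Qed.

Lemma mod_tens F1 F2 F3 (al al' : upt_data F1 F2) (be be' : upt_data F2 F3)
    (f : 'M[C]_(upt_dim al', upt_dim al)) (g : 'M[C]_(upt_dim be', upt_dim be)) :
  is_modification f -> is_modification g ->
  @is_modification _ _ F1 F3 (comp_upt al be) (comp_upt al' be') (f *t g).
Proof.
move=> /is_modificationP hf /is_modificationP hg.
apply/is_modificationP => X a b; case: (comp_idxP a) => i k.
case: (comp_idxP b) => j l.
rewrite !sum_idx.
transitivity ((\sum_k' g k' l *: upt_blk be' X k k') *m
    (\sum_i' f i' j *: upt_blk al' X i i')).
  rewrite sum_scale_mul; apply: eq_bigr => i' _; apply: eq_bigr => k' _.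
  by rewrite comp_upt_blk tensmxE.
rewrite hf hg sum_scale_mul; apply: eq_bigr => i' _; apply: eq_bigr => k' _.
by rewrite comp_upt_blk tensmxE.
Qed.

(** Transport of a transformation along f, chosen so that a unitary f becomes a
    modification. *)
Definition conj_upt F1 F2 (al : upt_data F1 F2) m (f : 'M[C]_(m, upt_dim al)) :
    upt_data F1 F2 :=
  @UptData _ _ F1 F2 m (fun X => (f *t 1%:M) *m al X *m (1%:M *t f^t*)).

Lemma conj_upt_mod F1 F2 (al : upt_data F1 F2) m (f : 'M[C]_(m, upt_dim al)) :
  is_unitary f -> @is_modification _ _ F1 F2 al (conj_upt f) f.
Proof.
by move=> [f1 f2] X; rewrite /conj_upt /= -!mulmxA tensmx_mul f1 mulmx1 tensmx11 mulmx1.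
Qed.

Lemma conj_upt_blk F1 F2 (al : upt_data F1 F2) m (f : 'M[C]_(m, upt_dim al)) X i j :
  upt_blk (conj_upt f) X i j =
  \sum_l (f j l)^* *: \sum_k f i k *: upt_blk al X k l.
Proof.
rewrite /upt_blk /= blk_scaler; apply: eq_bigr => l _.
by rewrite blk_scalel !mxE.
Qed.

Lemma conj_upt_is_upt F1 F2 (al : upt_data F1 F2) m (f : 'M[C]_(m, upt_dim al)) :
  is_upt al -> is_unitary f -> is_upt (conj_upt f).
Proof.
move=> ual [f1 f2]; have [iso coiso nt mul un] := iffLR (is_uptP al) ual.
have [uni _ _ _] := ual.
apply/is_uptP; split.
- move=> X; apply/blk_isometryP; rewrite /= !dagM !dag_tens !dag1 trmxCK.
  have [a1 a2] := uni X.
  rewrite !mulmxA -(mulmxA _ (f^t* *t 1%:M)) tensmx_mul f1 mulmx1 tensmx11 mulmx1.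
  rewrite -(mulmxA _ ((al X)^t*)) a1 mulmx1 tensmx_mul f2 mulmx1.
  exact: tensmx11.
- move=> X; apply/blk_coisometryP; rewrite /= !dagM !dag_tens !dag1 trmxCK.
  have [a1 a2] := uni X.
  rewrite !mulmxA -(mulmxA _ (1%:M *t f^t*)) tensmx_mul f1 mulmx1 tensmx11 mulmx1.
  rewrite -(mulmxA _ (al X)) a2 mulmx1 tensmx_mul f2 mulmx1.
  exact: tensmx11.
- move=> X Y g i j; rewrite !conj_upt_blk mulmx_sumr mulmx_suml.
  apply: eq_bigr => l _; rewrite -scalemxAr -scalemxAl; congr (_ *: _).
  rewrite mulmx_sumr mulmx_suml; apply: eq_bigr => k _.
  by rewrite -scalemxAr -scalemxAl nt.
- move=> X Y i j; rewrite conj_upt_blk.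
  transitivity (\sum_l (f j l)^* *: \sum_k f i k *:
      (ff_mult F2 X Y *m \sum_p upt_blk al X k p *t upt_blk al Y p l)).
    rewrite mulmx_suml; apply: eq_bigr => l _; rewrite -scalemxAl; congr (_ *: _).
    rewrite mulmx_suml; apply: eq_bigr => k _.
    by rewrite -scalemxAl mul.
  have E : \sum_k upt_blk (conj_upt f) X i k *t upt_blk (conj_upt f) Y k j =
      \sum_l (f j l)^* *: \sum_k f i k *:
        (\sum_p upt_blk al X k p *t upt_blk al Y p l).
    have inY p : \sum_k (f k p)^* *: upt_blk (conj_upt f) Y k j =
        \sum_l (f j l)^* *: upt_blk al Y p l.
      under eq_bigr => k _ do rewrite conj_upt_blk scaler_sumr.
      rewrite exchange_big; apply: eq_bigr => l _ /=.
      under eq_bigr => k _ do rewrite scalerA mulrC -scalerA.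
      rewrite -scaler_sumr; congr (_ *: _).
      under eq_bigr => k _ do rewrite scaler_sumr.
      rewrite exchange_big /= (big_pick (i := p)) => [|q qp].
        under eq_bigr => k _ do rewrite scalerA.
        rewrite -scaler_suml.
        have /matrixP/(_ p p) := f1; rewrite one_mxE eqxx mxE.
        under eq_bigr => k _ do rewrite !mxE.
        by move=> ->; rewrite scale1r.
      under eq_bigr => k _ do rewrite scalerA.
      rewrite -scaler_suml.
      have /matrixP/(_ p q) := f1; rewrite one_mxE eq_sym qp mxE.
      under eq_bigr => k _ do rewrite !mxE.
      by move=> ->; rewrite scale0r.
    transitivity (\sum_p (\sum_q f i q *: upt_blk al X q p) *t
        (\sum_l (f j l)^* *: upt_blk al Y p l)).
      under eq_bigr => k _ do rewrite conj_upt_blk tens_suml.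
      rewrite exchange_big; apply: eq_bigr => p _ /=.
      rewrite -inY tens_sumr; apply: eq_bigr => k _.
      by rewrite tensZl tensZr.
    under eq_bigr => p _ do rewrite tens_sumr.
    rewrite exchange_big; apply: eq_bigr => l _ /=.
    under eq_bigr => p _ do rewrite tensZr tens_suml.
    rewrite -scaler_sumr; congr (_ *: _).
    rewrite exchange_big; apply: eq_bigr => k _ /=.
    rewrite scaler_sumr; apply: eq_bigr => p _.
    by rewrite tensZl.
  rewrite E mulmx_sumr; apply: eq_bigr => l _.
  rewrite -scalemxAr; congr (_ *: _); rewrite mulmx_sumr; apply: eq_bigr => k _.
  by rewrite -scalemxAr.
- move=> i j; rewrite conj_upt_blk mulmx_suml.
  transitivity (\sum_l (f i l * (f j l)^*) *: ff_unit F2).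
    apply: eq_bigr => l _; rewrite -scalemxAl mulmx_suml.
    rewrite (big_pick (i := l)) => [|k kl].
      by rewrite -scalemxAl un eqxx scale1r scalerA mulrC.
    by rewrite -scalemxAl un kl scale0r scaler0.
  rewrite -scaler_suml; congr (_ *: _).
  have /matrixP/(_ i j) := f2; rewrite one_mxE => <-; rewrite mxE.
  by apply: eq_bigr => l _; rewrite !mxE.
Qed.

(** Unitary isomorphism of monoids in End(F). *)
Definition iso_end F (A B : end_monoid_data F) :=
  exists f : 'M[C]_(upt_dim B, upt_dim A),
  [/\ is_unitary f, is_modification f,
      f *m em_mul A = em_mul B *m (f *t f) & f *m em_one A = em_one B].

Lemma iso_end_sym F (A B : end_monoid_data F) :
  is_upt A -> is_upt B -> iso_end A B -> iso_end B A.
Proof.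
move=> uA uB [f [[f1 f2] fm fmul fone]]; exists (f^t*); split.
- by split; rewrite trmxCK.
- exact: mod_dag.
- have := congr1 (fun M => f^t* *m M *m (f^t* *t f^t*)) fmul.
  rewrite /= !mulmxA f1 mul1mx => ->.
  by rewrite -!mulmxA tensmx_mul f2 tensmx11 mulmx1.
- by rewrite -fone mulmxA f1 mul1mx.
Qed.

End Modifications.

(** * Splitting a system of matrix units *)

Section Families.
Variables (C : numClosedFieldType) (h : nat) (o : 'I_h).
Local Notation family q p := ('I_h -> 'I_h -> 'M[C]_(q, p)).

Definition coisometric q p (a : family q p) :=
  forall i j, \sum_k a i k *m (a j k)^t* = (i == j)%:R%:M.

(** Coisometric families with the same products a_il^* a_jk differ by a unitary
    between their targets. *)
Definition gram q p (a : family q p) i l j k := (a i l)^t* *m a j k.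

Definition intertwines q p q' p' (a : family q p) (c : family q' p') (f : 'M[C]_(p', p)) :=
  forall i l j k, f *m gram a i l j k = gram c i l j k *m f.

(** For f that intertwines a and c this is the only map t with t a_ij = c_ij f;
    the formula computes it from the row o. *)
Definition transfer q p q' p' (a : family q p) (c : family q' p') (f : 'M[C]_(p', p)) :
    'M[C]_(q', q) := \sum_k c o k *m f *m (a o k)^t*.

Lemma transferE q p q' p' (a : family q p) (c : family q' p') f i j :
  coisometric c -> intertwines a c f -> transfer a c f *m a i j = c i j *m f.
Proof.
move=> cc acf; rewrite mulmx_suml.
transitivity (\sum_k c o k *m (c o k)^t* *m c i j *m f).
  apply: eq_bigr => k _; rewrite -!mulmxA.
  by have := acf o k i j; rewrite /gram -!mulmxA => ->.
by rewrite -!mulmx_suml cc eqxx mul1mx.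
Qed.

(** The ranges of the a_ij span the target. *)
Lemma coisometric_cancel q p m (a : family q p) (g g' : 'M[C]_(m, q)) :
  coisometric a -> (forall i j, g *m a i j = g' *m a i j) -> g = g'.
Proof.
move=> ca e; rewrite -[g]mulmx1 -[g']mulmx1.
have := ca o o; rewrite eqxx => <-; rewrite !mulmx_sumr.
by apply: eq_bigr => k _; rewrite !mulmxA e.
Qed.

Lemma transfer_dag q p q' p' (a : family q p) (c : family q' p') f :
  (transfer a c f)^t* = transfer c a (f^t*).
Proof.
by rewrite dag_sum; apply: eq_bigr => k _; rewrite !dagM trmxCK mulmxA.
Qed.

Lemma intertwines_dag q p q' p' (a : family q p) (c : family q' p') f :
  intertwines a c f -> intertwines c a (f^t*).
Proof.
move=> h1 i l j k; have := congr1 (fun M => M^t*) (h1 j k i l).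
by rewrite /gram !dagM !trmxCK.
Qed.

Lemma transfer_unitary q p q' p' (a : family q p) (c : family q' p') f :
  coisometric a -> coisometric c -> intertwines a c f -> is_unitary f ->
  is_unitary (transfer a c f).
Proof.
move=> ca cc acf [f1 f2]; have caf := intertwines_dag acf.
split; rewrite transfer_dag.
  apply: (coisometric_cancel ca) => i j.
  by rewrite -mulmxA transferE // mulmxA transferE // -mulmxA f1 mulmx1 mul1mx.
apply: (coisometric_cancel cc) => i j.
by rewrite -mulmxA transferE // mulmxA transferE // -mulmxA f2 mulmx1 mul1mx.
Qed.

(** The family that monoidality of a transformation attaches to a tensor
    product. *)
Definition family_tens q p q' p' (a : family q p) (b : family q' p') :
    family (q * q') (p * p') := fun i j => \sum_k a i k *t b k j.

Lemma coisometric_tens q p q' p' (a : family q p) (b : family q' p') :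
  coisometric a -> coisometric b -> coisometric (family_tens a b).
Proof.
move=> ca cb i j.
transitivity (\sum_l \sum_m (a i l *m (a j m)^t*) *t
    \sum_k (b l k *m (b m k)^t*)).
  under eq_bigr => k _ do rewrite dag_sum mulmx_suml.
  rewrite exchange_big; apply: eq_bigr => l _ /=.
  under eq_bigr => k _ do rewrite mulmx_sumr.
  rewrite exchange_big; apply: eq_bigr => m _ /=.
  rewrite tens_sumr; apply: eq_bigr => k _.
  by rewrite dag_tens tensmx_mul.
transitivity (\sum_l (a i l *m (a j l)^t*) *t (1%:M : 'M[C]_q')).
  apply: eq_bigr => l _; rewrite (big_pick (i := l)) => [|m ml].
    by rewrite cb eqxx.
  by rewrite cb eq_sym ml -scalemx1 scale0r tensmx0.
rewrite -tens_suml ca -[X in _ = X]scalemx1 -[X in X *t _]scalemx1.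
by rewrite tensZl tensmx11.
Qed.

Lemma gram_tens q p q' p' (a : family q p) (b : family q' p') i l j k :
  gram (family_tens a b) i l j k =
  \sum_m' \sum_m gram a i m j m' *t gram b m l m' k.
Proof.
rewrite /gram dag_sum mulmx_suml exchange_big; apply: eq_bigr => m _.
rewrite mulmx_sumr; apply: eq_bigr => m' _.
by rewrite dag_tens tensmx_mul.
Qed.

Definition family1 : family 1 1 := fun i j => (i == j)%:R%:M.

Lemma coisometric1 : coisometric family1.
Proof.
move=> i j; rewrite (big_pick (i := i)) => [|k ki].
  by rewrite /family1 eqxx mul1mx dag_scalar conjC_nat eq_sym.
by rewrite /family1 eq_sym ki -scalemx1 scale0r mul0mx.
Qed.

Lemma gram1 i l j k : gram family1 i l j k = ((j == k) && (i == l))%:R%:M.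
Proof.
rewrite /gram /family1 dag_scalar conjC_nat -scalar_mxM -natrM mulnb andbC.
by [].
Qed.

(** For fixed i and j let E_ij be the matrix with blocks g i l j k in row l and
    column k.  The hypotheses say that the E_ij are matrix units.  With W an
    isometry onto the range of E_oo and w_l its blocks, a_jk is the k-th block
    of W^* E_oj. *)
Lemma matrix_units_split p (g : 'I_h -> 'I_h -> 'I_h -> 'I_h -> 'M[C]_p) :
  (forall i l j k, (g i l j k)^t* = g j k i l) ->
  (forall i l j i' q k, \sum_m g i l j m *m g i' m q k = (i' == j)%:R *: g i l q k) ->
  exists r (a : family r p), coisometric a /\ forall i l j k, gram a i l j k = g i l j k.
Proof.
move=> gdag gmul.
pose P : 'M[C]_(h * p) := \matrix_(r, c)
  g o (mxtens_unindex r).1 o (mxtens_unindex c).1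
    (mxtens_unindex r).2 (mxtens_unindex c).2.
have PE l x k y : P (idx (l, x)) (idx (k, y)) = g o l o k x y.
  by rewrite mxE !mxtens_indexK.
have PP : P *m P = P.
  apply/matrixP => r c; case: (mxtens_indexP r) => l x; case: (mxtens_indexP c) => k y.
  rewrite mxE sum_idx PE.
  have := gmul o l o o o k; rewrite eqxx scale1r => <-.
  rewrite summxE; apply: eq_bigr => m _; rewrite mxE.
  by apply: eq_bigr => z _; rewrite !PE.
have Pdag : P^t* = P.
  apply/matrixP => r c; case: (mxtens_indexP r) => l x; case: (mxtens_indexP c) => k y.
  rewrite PE -gdag !mxE; congr (_^*).
  by rewrite !mxtens_indexK.
have [r [W [W1 W2]]] := dagger_split PP Pdag.
pose w l : 'M[C]_(p, r) := \matrix_(x, s) W (idx (l, x)) s.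
have ww l k : w l *m (w k)^t* = g o l o k.
  apply/matrixP => x y; rewrite -PE -W2 !mxE.
  by apply: eq_bigr => s _; rewrite !mxE.
have w1 : \sum_l (w l)^t* *m w l = 1%:M.
  rewrite -W1; apply/matrixP => x y; rewrite summxE mxE sum_idx.
  by apply: eq_bigr => l _; rewrite mxE; apply: eq_bigr => s _; rewrite !mxE.
exists r, (fun j k => \sum_l (w l)^t* *m g o l j k); split.
  move=> i j.
  transitivity (\sum_l \sum_m (w l)^t* *m (\sum_k g o l i k *m g j k o m) *m w m).
    under eq_bigr => k _ do rewrite dag_sum mulmx_suml.
    rewrite exchange_big; apply: eq_bigr => l _ /=.
    under eq_bigr => k _ do rewrite mulmx_sumr.
    rewrite exchange_big; apply: eq_bigr => m _ /=.
    rewrite mulmx_sumr mulmx_suml; apply: eq_bigr => k _.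
    by rewrite dagM trmxCK gdag !mulmxA.
  under eq_bigr => l _ do under eq_bigr => m _ do
    rewrite gmul -ww -scalemxAr -scalemxAl !mulmxA.
  under eq_bigr => l _ do under eq_bigr => m _ do
    rewrite -(mulmxA _ ((w m)^t*)).
  under eq_bigr => l _ do rewrite -scaler_sumr -mulmx_sumr w1 mulmx1.
  by rewrite -scaler_sumr w1 scalemx1 eq_sym.
move=> i l j k; rewrite /gram dag_sum mulmx_suml.
transitivity (\sum_m g i l o m *m (\sum_m' g o m o m' *m g o m' j k)).
  apply: eq_bigr => m _; rewrite !mulmx_sumr; apply: eq_bigr => m' _.
  by rewrite dagM trmxCK gdag -ww !mulmxA.
under eq_bigr => m _ do rewrite gmul eqxx scale1r.
by rewrite gmul eqxx scale1r.
Qed.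

End Families.

(** * Simple monoids come from fibre functors *)

Section CastTensor.
Variable C : numClosedFieldType.

Lemma castmx_mulmx m n p m' n' p' (em : m = m') (en : n = n') (ep : p = p')
    (A : 'M[C]_(m, n)) (B : 'M[C]_(n, p)) :
  castmx (em, en) A *m castmx (en, ep) B = castmx (em, ep) (A *m B).
Proof. by case: m' / em; case: n' / en; case: p' / ep; rewrite !castmx_id. Qed.

Lemma castmx_tensA m n p q r s (A : 'M[C]_(m, n)) (B : 'M[C]_(p, q))
    (D : 'M[C]_(r, s)) e1 e2 :
  castmx (e1, e2) ((A *t B) *t D) = A *t (B *t D).
Proof.
apply/matrixP => a b; case: (mxtens_indexP a) => i {}a; case: (mxtens_indexP a) => j k.
case: (mxtens_indexP b) => x {}b; case: (mxtens_indexP b) => y z.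
by rewrite castmxE !cast_idxA !tensmxE mulrA.
Qed.

Lemma castmx_tens1l m n (A : 'M[C]_(m, n)) e1 e2 :
  castmx (e1, e2) ((1%:M : 'M_1) *t A) = A.
Proof.
apply/matrixP => a b; rewrite castmxE !cast_1lidx tensmxE one_mxE eqxx.
by rewrite mul1r.
Qed.

Lemma castmx_tens1r m n (A : 'M[C]_(m, n)) e1 e2 :
  castmx (e1, e2) (A *t (1%:M : 'M_1)) = A.
Proof.
apply/matrixP => a b; rewrite castmxE !cast_1ridx tensmxE one_mxE eqxx.
by rewrite mulr1.
Qed.

Lemma castmx_sum m n m' n' (e : (m = m') * (n = n')) (I : Type) (r : seq I)
    (P : pred I) (F : I -> 'M[C]_(m, n)) :
  castmx e (\sum_(i <- r | P i) F i) = \sum_(i <- r | P i) castmx e (F i).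
Proof.
case: e => em en; case: m' / em; case: n' / en; rewrite castmx_id.
by apply: eq_bigr => i _; rewrite castmx_id.
Qed.

End CastTensor.

Section Reconstruction.
Variables (R : realType) (G : compact_quantum_group R).
Local Notation C := R[i].
Variables (F : fibre_functor G) (h : nat) (o : 'I_h).

Section FromFamilies.
Variables (d : rep G -> nat) (a : forall X, 'I_h -> 'I_h -> 'M[C]_(d X, F X)).
Variable (gam : upt_data F F) (gdim : upt_dim gam = (h * h)%N).
Hypothesis (gup : is_upt gam).
Let gblk X (I J : 'I_(h * h)) : 'M[C]_(F X, F X) :=
  upt_blk gam X (cast_ord (esym gdim) I) (cast_ord (esym gdim) J).
Hypothesis (co : forall X, coisometric (a X)).
Hypothesis (gr : forall X i l j k, gram (a X) i l j k = gblk X (idx (j, i)) (idx (k, l))).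
Hypothesis (one_out : forall X k l, \sum_i gblk X (idx (i, i)) (idx (k, l)) = (k == l)%:R%:M).

Let gram_nat X Y (f : rep_hom X Y) : intertwines (a X) (a Y) (ff_hom F f).
Proof.
move=> i l j k; rewrite !gr /gblk.
by have [_ _ nt _ _] := iffLR (is_uptP gam) gup; rewrite nt.
Qed.

Let gram_mult X Y :
  intertwines (family_tens (a X) (a Y)) (a (tensor_rep X Y)) (ff_mult F X Y).
Proof.
move=> i l j k; rewrite gr gram_tens.
have [_ _ _ mul _] := iffLR (is_uptP gam) gup; rewrite /gblk mul; congr (_ *m _).
rewrite (reindex (cast_ord (esym gdim))) /=; last first.
  by exists (cast_ord gdim) => x _; rewrite ?cast_ordK ?cast_ordKV.
rewrite sum_idx; apply: eq_bigr => m' _; apply: eq_bigr => m _.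
by rewrite !gr.
Qed.

Let gram_unit : intertwines (@family1 C h) (a (unit_rep G)) (ff_unit F).
Proof.
move=> i l j k; rewrite gr gram1.
have [_ _ _ _ un] := iffLR (is_uptP gam) gup; rewrite /gblk un.
by rewrite (inj_eq (@cast_ord_inj _ _ _)) eq_mxtens_index mul_mx_scalar.
Qed.

Let hom X Y (f : rep_hom X Y) := transfer o (a X) (a Y) (ff_hom F f).
Let mult X Y :=
  transfer o (family_tens (a X) (a Y)) (a (tensor_rep X Y)) (ff_mult F X Y).
Let unit := transfer o (@family1 C h) (a (unit_rep G)) (ff_unit F).

Let homE X Y (f : rep_hom X Y) i j : hom f *m a X i j = a Y i j *m ff_hom F f.
Proof. by apply: transferE => //; apply: gram_nat. Qed.

Let multE X Y i j : mult X Y *m family_tens (a X) (a Y) i j =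
  a (tensor_rep X Y) i j *m ff_mult F X Y.
Proof. by apply: transferE => //; apply: gram_mult. Qed.

Let unitE i j : unit *m family1 C i j = a (unit_rep G) i j *m ff_unit F.
Proof. by apply: transferE => //; apply: gram_unit. Qed.

Let co_tens X Y : coisometric (family_tens (a X) (a Y)).
Proof. exact: coisometric_tens. Qed.

(** The coefficients of F' are transferred from those of F along the families a.
    Every axiom holds after composition with the maps a_ij, where it reduces to
    the axiom for F, and the ranges of these maps span F'(X). *)
Lemma reconstructed_functor :
  exists (F' : fibre_functor G) (b : block_family F F' h),
  is_block_upt b /\ forall X i j k l,
    (b X k l)^t* *m b X i j = gblk X (idx (i, k)) (idx (j, l)).
Proof.
have hid X : hom (id_hom X) = 1%:M.
  by apply: (coisometric_cancel o (co X)) => i j; rewrite homE ff_id mulmx1 mul1mx.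
have hcomp X Y Z (g : rep_hom Y Z) (f : rep_hom X Y) :
    hom (comp_hom g f) = hom g *m hom f.
  apply: (coisometric_cancel o (co X)) => i j.
  by rewrite -mulmxA !homE mulmxA homE ff_comp mulmxA.
have hlin X Y c (f g : rep_hom X Y) :
    hom (linear_hom c f g) = c *: hom f + hom g.
  apply: (coisometric_cancel o (co X)) => i j.
  by rewrite mulmxDl -scalemxAl !homE ff_linear mulmxDr -scalemxAr.
have hdag X Y (f : rep_hom X Y) : hom (dag_hom f) = (hom f)^t*.
  by rewrite /hom transfer_dag ff_dag.
have umult X Y : is_unitary (mult X Y).
  apply: transfer_unitary.
  - exact: co_tens.
  - exact: co.
  - exact: gram_mult.
  - exact: ff_mult_unitary.
have uunit : is_unitary unit.
  apply: transfer_unitary.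
  - exact: coisometric1.
  - exact: co.
  - exact: gram_unit.
  - exact: ff_unit_unitary.
have nmult X Y X' Y' (f : rep_hom X Y) (g : rep_hom X' Y') :
    hom (tensor_hom f g) *m mult X X' = mult Y Y' *m (hom f *t hom g).
  apply: (coisometric_cancel o (@co_tens X X')) => i j.
  transitivity (a (tensor_rep Y Y') i j *m
      (ff_hom F (tensor_hom f g) *m ff_mult F X X')).
    by rewrite -(mulmxA (hom _)) multE (mulmxA (hom _)) homE -mulmxA.
  rewrite ff_mult_natural mulmxA -multE -!mulmxA; congr (_ *m _).
  rewrite mulmx_suml mulmx_sumr.
  by apply: eq_bigr => k _; rewrite !tensmx_mul !homE.
have hassoc X Y Z : hom (assoc_hom X Y Z) *m mult (tensor_rep X Y) Z *m
      (mult X Y *t (1%:M : 'M_(d Z))) =s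
    mult X (tensor_rep Y Z) *m ((1%:M : 'M_(d X)) *t mult Y Z).
  rewrite /strict_eq; set em := erefl; set en := eq_ind_r _ _ _.
  have en2 : (F X * F Y * F Z = F X * (F Y * F Z))%N by rewrite mulnA.
  have cF : coisometric (family_tens (a X) (family_tens (a Y) (a Z))).
    by apply: coisometric_tens.
  apply: (coisometric_cancel o cF) => i j.
  have famE : family_tens (a X) (family_tens (a Y) (a Z)) i j =
      castmx (en, en2) (family_tens (family_tens (a X) (a Y)) (a Z) i j).
    rewrite castmx_sum /family_tens.
    under eq_bigr => k _ do rewrite tens_sumr.
    rewrite exchange_big; apply: eq_bigr => k _ /=.
    rewrite tens_suml castmx_sum; apply: eq_bigr => l _.
    by rewrite castmx_tensA.
  transitivity (a (tensor_rep X (tensor_rep Y Z)) i j *m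
      (ff_mult F X (tensor_rep Y Z) *m (1%:M *t ff_mult F Y Z))); last first.
    rewrite mulmxA -multE -!mulmxA; congr (_ *m _).
    rewrite mulmx_suml mulmx_sumr; apply: eq_bigr => k _.
    by rewrite !tensmx_mul multE mulmx1 mul1mx.
  rewrite {1}famE castmx_mulmx.
  have <- := ff_assoc F X Y Z; rewrite /strict_eq.
  rewrite -(castmx_id (erefl, erefl) (a _ i j)) castmx_mulmx.
  rewrite (eq_irrelevance em erefl); congr (castmx (_, _) _);
    first exact: eq_irrelevance.
  transitivity (hom (assoc_hom X Y Z) *m (a (tensor_rep (tensor_rep X Y) Z) i j *m
      (ff_mult F (tensor_rep X Y) Z *m (ff_mult F X Y *t 1%:M)))).
    rewrite -!mulmxA; congr (_ *m _); rewrite [RHS]mulmxA -multE -[RHS]mulmxA.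
    congr (_ *m _); rewrite mulmx_suml mulmx_sumr; apply: eq_bigr => k _.
    by rewrite !tensmx_mul multE mulmx1 mul1mx.
  by rewrite !mulmxA homE.
have hunitl X : hom (unitl_hom X) *m mult (unit_rep G) X *m
    (unit *t (1%:M : 'M_(d X))) =s (1%:M : 'M[C]_(d X)).
  rewrite /strict_eq; set em := erefl; set en := eq_ind_r _ _ _.
  have en2 : (1 * F X = F X)%N by rewrite mul1n.
  apply: (coisometric_cancel o (co X)) => i j.
  have famE : a X i j = castmx (en, en2) (family_tens (@family1 C h) (a X) i j).
    rewrite /family_tens (big_pick (i := i)) => [|k ki].
      by rewrite /family1 eqxx castmx_tens1l.
    by rewrite /family1 eq_sym ki -scalemx1 scale0r tens0mx.
  rewrite mul1mx [in LHS]famE castmx_mulmx.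
  rewrite -[RHS]mulmx1 -(ff_unitl F X) /strict_eq.
  rewrite -(castmx_id (erefl, erefl) (a _ i j)) castmx_mulmx.
  rewrite (eq_irrelevance em erefl); congr (castmx (_, _) _);
    first exact: eq_irrelevance.
  transitivity (hom (unitl_hom X) *m (a (tensor_rep (unit_rep G) X) i j *m
      (ff_mult F (unit_rep G) X *m (ff_unit F *t 1%:M)))).
    rewrite -!mulmxA; congr (_ *m _); rewrite [RHS]mulmxA -multE -[RHS]mulmxA.
    congr (_ *m _); rewrite mulmx_suml mulmx_sumr; apply: eq_bigr => k _.
    by rewrite !tensmx_mul unitE mulmx1 mul1mx.
  by rewrite !mulmxA homE.
have hunitr X : hom (unitr_hom X) *m mult X (unit_rep G) *m
    ((1%:M : 'M_(d X)) *t unit) =s (1%:M : 'M[C]_(d X)).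
  rewrite /strict_eq; set em := erefl; set en := eq_ind_r _ _ _.
  have en2 : (F X * 1 = F X)%N by rewrite muln1.
  apply: (coisometric_cancel o (co X)) => i j.
  have famE : a X i j = castmx (en, en2) (family_tens (a X) (@family1 C h) i j).
    rewrite /family_tens (big_pick (i := j)) => [|k ki].
      by rewrite /family1 eqxx castmx_tens1r.
    by rewrite /family1 ki -scalemx1 scale0r tensmx0.
  rewrite mul1mx [in LHS]famE castmx_mulmx.
  rewrite -[RHS]mulmx1 -(ff_unitr F X) /strict_eq.
  rewrite -(castmx_id (erefl, erefl) (a _ i j)) castmx_mulmx.
  rewrite (eq_irrelevance em erefl); congr (castmx (_, _) _);
    first exact: eq_irrelevance.
  transitivity (hom (unitr_hom X) *m (a (tensor_rep X (unit_rep G)) i j *m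
      (ff_mult F X (unit_rep G) *m (1%:M *t ff_unit F)))).
    rewrite -!mulmxA; congr (_ *m _); rewrite [RHS]mulmxA -multE -[RHS]mulmxA.
    congr (_ *m _); rewrite mulmx_suml mulmx_sumr; apply: eq_bigr => k _.
    by rewrite !tensmx_mul unitE mulmx1 mul1mx.
  by rewrite !mulmxA homE.
pose F' := FibreFunctor hid hcomp hlin hdag umult uunit nmult hassoc hunitl hunitr.
exists F', a; split; last by move=> X i j k l; rewrite -gr.
split.
- move=> X j k; rewrite eq_sym -one_out; apply: eq_bigr => i _.
  by rewrite -gr.
- by move=> X i j; apply: co.
- by move=> X Y f i j; apply: homE.
- by move=> X Y i j; rewrite -multE.
- move=> i j; rewrite -unitE /family1 mul_mx_scalar.
  by [].
Qed.

End FromFamilies.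

(** Let g be the blocks of A in coordinates where A is the monoid of matrices.
    That multiplication and unit are modifications gives M and U.  With
    unitarity U yields counit, its version for the adjoint of the unit, and then
    the symmetry S follows because both of its sides are left inverses of the
    same family.  M' is M multiplied by the inverse of g.  Together S and M' are
    the hypotheses of [matrix_units_split]. *)
Lemma simple_reconstruction (A : end_monoid_data F) (f : 'M[C]_(h * h, upt_dim A)) :
  is_simple_frobenius A -> is_unitary f ->
  f *m em_mul A = pair_mul R h *m (f *t f) -> f *m em_one A = pair_one R h ->
  exists (F' : fibre_functor G) (al : upt_data F F'),
    nonzero_upt al /\ iso_end A (upt_monoid al).
Proof.
move=> [uA mulA oneA _ _] uf fmul fone; have [f1 f2] := uf.
have s0 : sqd R h != 0 by apply: sqd_neq0; apply: leq_ltn_trans (ltn_ord o).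
pose gam := conj_upt f.
have gup : is_upt gam by apply: conj_upt_is_upt.
have fm : is_modification (be := gam) f by apply: conj_upt_mod.
have fm' := mod_dag uA gup fm.
have gmul : @is_modification _ _ F F (comp_upt gam gam) gam (pair_mul R h).
  have -> : pair_mul R h = f *m (em_mul A *m (f^t* *t f^t*)).
    by rewrite mulmxA fmul -mulmxA tensmx_mul f2 tensmx11 mulmx1.
  apply: (mod_comp _ fm); apply: (mod_comp _ mulA).
  exact: mod_tens.
have gone : @is_modification _ _ F F (id_upt F) gam (pair_one R h).
  by rewrite -fone; apply: (mod_comp _ fm).
pose g X (i j k l : 'I_h) : 'M[C]_(F X) := upt_blk gam X (idx (i, j)) (idx (k, l)).
have [giso gcoiso _ _ _] := iffLR (is_uptP gam) gup.
have M X i j k l m n : \sum_p g X p j m n *m g X i p k l = (l == m)%:R *: g X i j k n.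
  have := iffLR (is_modificationP _) gmul X (idx (i, j)) (idx (idx (k, l), idx (m, n))).
  rewrite pair_mul_sum_in pair_mul_sum_out => /scalerI -> //.
    by apply: eq_bigr => p _; rewrite comp_upt_blk.
  by rewrite invr_eq0.
have U X i j : \sum_k g X i j k k = (i == j)%:R%:M.
  have := iffLR (is_modificationP _) gone X (idx (i, j)) 0.
  rewrite coev_sum big_ord1 pair_oneE id_upt_blk -scalerA => /scalerI -> //.
  by rewrite scalemx1.
have iso X k l k' l' : \sum_i \sum_j (g X i j k l)^t* *m g X i j k' l' =
    ((k == k') && (l == l'))%:R%:M.
  by have := giso X (idx (k, l)) (idx (k', l')); rewrite sum_idx eq_mxtens_index.
have coiso X i j i' j' : \sum_k \sum_l g X i j k l *m (g X i' j' k l)^t* =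
    ((i == i') && (j == j'))%:R%:M.
  by have := gcoiso X (idx (i, j)) (idx (i', j')); rewrite sum_idx eq_mxtens_index.
(* U multiplied by the adjoint of g. *)
have counit X k l : \sum_i g X i i k l = (k == l)%:R%:M.
  suff e : \sum_i (g X i i k l)^t* = (k == l)%:R%:M.
    by rewrite -[LHS]trmxCK dag_sum e dag_scalar conjC_nat.
  transitivity (\sum_i \sum_j (g X i j k l)^t* *m \sum_m g X i j m m).
    apply: eq_bigr => i _; rewrite (big_pick (i := i)) => [|j ji].
      by rewrite U eqxx mulmx1.
    by rewrite U eq_sym ji -scalemx1 scale0r mulmx0.
  transitivity (\sum_m ((k == m) && (l == m))%:R%:M : 'M[C]_(F X)).
    under [RHS]eq_bigr => m _ do rewrite -iso.
    rewrite [RHS]exchange_big; apply: eq_bigr => i _ /=.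
    rewrite [RHS]exchange_big; apply: eq_bigr => j _ /=.
    by rewrite mulmx_sumr.
  rewrite (big_pick (i := k)) => [|m mk]; first by rewrite eqxx eq_sym.
  by rewrite eq_sym mk -scalemx1 scale0r.
have S X i j k l : (g X i j k l)^t* = g X j i l k.
  (* D is orthogonal to the columns of a unitary, hence zero. *)
  pose D i j := g X j i l k - (g X i j k l)^t*.
  have D0 k' l' : \sum_i \sum_j D i j *m g X i j k' l' = 0.
    transitivity (\sum_i \sum_j g X j i l k *m g X i j k' l' -
        \sum_i \sum_j (g X i j k l)^t* *m g X i j k' l').
      rewrite -sumrB; apply: eq_bigr => i0 _; rewrite -sumrB.
      by apply: eq_bigr => j0 _; rewrite mulmxBl.
    rewrite iso; apply/eqP; rewrite subr_eq0; apply/eqP.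
    under eq_bigr => i0 _ do rewrite M.
    rewrite -scaler_sumr counit scale_scalar_mx -natrM mulnb andbC.
    by rewrite [k == _]eq_sym [l == _]eq_sym.
  have : D i j = 0.
    transitivity (\sum_i' \sum_j' D i' j' *m
        \sum_k' \sum_l' g X i' j' k' l' *m (g X i j k' l')^t*).
      rewrite (big_pick (i := i)) => [|i' ii]; last first.
        rewrite big1 // => j' _; rewrite coiso ii.
        by rewrite -scalemx1 scale0r mulmx0.
      rewrite (big_pick (i := j)) => [|j' jj]; last first.
        by rewrite coiso jj andbF -scalemx1 scale0r mulmx0.
      by rewrite coiso !eqxx mulmx1.
    under eq_bigr => i' _ do under eq_bigr => j' _ do rewrite mulmx_sumr.
    under eq_bigr => i' _ do rewrite exchange_big.
    rewrite exchange_big big1 // => k' _ /=.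
    under eq_bigr => i' _ do under eq_bigr => j' _ do rewrite mulmx_sumr.
    under eq_bigr => i' _ do rewrite exchange_big.
    rewrite exchange_big big1 // => l' _ /=.
    transitivity ((\sum_i' \sum_j' D i' j' *m g X i' j' k' l') *m (g X i j k' l')^t*);
      last by rewrite D0 mul0mx.
    rewrite mulmx_suml; apply: eq_bigr => i' _; rewrite mulmx_suml.
    by apply: eq_bigr => j' _; rewrite mulmxA.
  by move/eqP; rewrite subr_eq0 => /eqP.
have M' X i j n i' q m :
    \sum_k g X i j k n *m g X q i' m k = (i == i')%:R *: g X q j m n.
  transitivity (\sum_k \sum_l (\sum_p g X p j m n *m g X i p k l) *m
      (g X i' q k l)^t*).
    apply: eq_bigr => k _; rewrite (big_pick (i := m)) => [|l lm].
      by rewrite M eqxx scale1r S.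
    by rewrite M lm scale0r mul0mx.
  transitivity (\sum_p g X p j m n *m
      (\sum_k \sum_l g X i p k l *m (g X i' q k l)^t*)).
    under eq_bigr => k _ do under eq_bigr => l _ do rewrite mulmx_suml.
    under eq_bigr => k _ do rewrite exchange_big.
    rewrite exchange_big; apply: eq_bigr => p _ /=.
    rewrite mulmx_sumr; apply: eq_bigr => k _.
    by rewrite mulmx_sumr; apply: eq_bigr => l _; rewrite mulmxA.
  rewrite (big_pick (i := q)) => [|p pq].
    by rewrite coiso eqxx andbT mul_mx_scalar.
  by rewrite coiso pq andbF -scalemx1 scale0r mulmx0.
have gunits X i l j i' q k :
    \sum_m g X j i m l *m g X q i' k m = (i' == j)%:R *: g X q i k l.
  by rewrite M' eq_sym.
have ex (X : rep G) : exists s : {r : nat & 'I_h -> 'I_h -> 'M[C]_(r, F X)},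
    coisometric (projT2 s) /\
    forall i l j k, gram (projT2 s) i l j k = g X j i k l.
  have [r [a [ca ga]]] := @matrix_units_split C h o _ (fun i l j k => g X j i k l)
    (fun i l j k => S X j i k l) (gunits X).
  by exists (existT _ r a).
pose a X := projT1 (cid (ex X)); have aP X := projT2 (cid (ex X)).
have [|X i l j k|X k l|F' [b [ub bE]]] :=
    @reconstructed_functor (fun X => projT1 (a X)) (fun X => projT2 (a X))
      gam erefl gup.
- by move=> X; case: (aP X).
- by rewrite !cast_ord_id; case: (aP X).
- by rewrite -counit; apply: eq_bigr => i _; rewrite !cast_ord_id.
exists F', (upt_of b); split.
  split; last exact: leq_ltn_trans (ltn_ord o).
  by apply/is_uptP/(is_block_upt_ext _ ub) => X i j; rewrite upt_of_blk.
exists f; split=> //.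
have e X I J : upt_blk (upt_monoid (upt_of b)) X I J = upt_blk gam X I J.
  case: (comp_idxP I) => i k; case: (comp_idxP J) => j l.
  rewrite comp_upt_blk dual_upt_blk !upt_of_blk bE.
  by rewrite !cast_ord_id.
apply/is_modificationP => X i j; rewrite -(iffLR (is_modificationP _) fm).
by apply: eq_bigr => k _; rewrite e.
Qed.

End Reconstruction.

Lemma simple_frobenius_split (R : realType) (G : compact_quantum_group R)
    (F : fibre_functor G) (A : end_monoid_data F) : is_simple_frobenius A ->
  exists (F' : fibre_functor G) (al : upt_data F F'),
    nonzero_upt al /\ iso_end A (upt_monoid al).
Proof.
move=> sA; have [_ _ _ _ [h h0 [f [uf fmul fone]]]] := sA.
exact: (simple_reconstruction (Ordinal h0) sA uf fmul fone).
Qed.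

(** * Bimodules as algebras of operators *)

Section Bimodules.
Variables (R : realType) (G : compact_quantum_group R) (F : fibre_functor G).
Local Notation C := R[i].
Implicit Types A B D : end_monoid_data F.

(** Reduces identities between multilinear expressions to basis vectors. *)
Lemma cv_lin_ext n (W : lmodType C) (f g : 'cV[C]_n -> W) :
  (forall c x y, f (c *: x + y) = c *: f x + f y) ->
  (forall c x y, g (c *: x + y) = c *: g x + g y) ->
  (forall a, f (delta_mx a 0) = g (delta_mx a 0)) -> forall v, f v = g v.
Proof.
move=> lf lg e v.
have f0 : f 0 = 0 by have := lf (-1) 0 0; rewrite scaler0 addr0 scaleN1r addNr.
have g0 : g 0 = 0 by have := lg (-1) 0 0; rewrite scaler0 addr0 scaleN1r addNr.
rewrite [v]matrix_sum_delta.
under eq_bigr => i _ do rewrite big_ord1.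
elim/big_rec: _ => [|i x _ h]; first by rewrite f0 g0.
by rewrite lf lg e h.
Qed.

(** The operator m |-> v m w on M.  In terms of these operators the bimodule
    axioms involve no reordering of tensor factors. *)
Definition bact A B (M : bimod_data A B) (v : 'cV[C]_(upt_dim A))
    (w : 'cV[C]_(upt_dim B)) : 'M[C]_(upt_dim M) :=
  \matrix_(x, y) \sum_a \sum_b v a 0 * w b 0 * bm_act M x (idx (idx (a, y), b)).

Lemma bact_linl A B (M : bimod_data A B) w c x y :
  bact M (c *: x + y) w = c *: bact M x w + bact M y w.
Proof.
apply/matrixP => i j; rewrite !mxE mulr_sumr -big_split; apply: eq_bigr => a _ /=.
rewrite mulr_sumr -big_split; apply: eq_bigr => b _ /=.
by rewrite !mxE !mulrDl !mulrA.
Qed.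

Lemma bact_linr A B (M : bimod_data A B) v c x y :
  bact M v (c *: x + y) = c *: bact M v x + bact M v y.
Proof.
apply/matrixP => i j; rewrite !mxE mulr_sumr -big_split; apply: eq_bigr => a _ /=.
rewrite mulr_sumr -big_split; apply: eq_bigr => b _ /=.
by rewrite !mxE mulrDr mulrDl !mulrA [v a 0 * c]mulrC.
Qed.

Lemma bactZl A B (M : bimod_data A B) w c x : bact M (c *: x) w = c *: bact M x w.
Proof.
by apply/matrixP => i j; rewrite !mxE mulr_sumr; apply: eq_bigr => a _;
  rewrite mulr_sumr; apply: eq_bigr => b _; rewrite mxE !mulrA.
Qed.

Lemma bactZr A B (M : bimod_data A B) v c x : bact M v (c *: x) = c *: bact M v x.
Proof.
by apply/matrixP => i j; rewrite !mxE mulr_sumr; apply: eq_bigr => a _;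
  rewrite mulr_sumr; apply: eq_bigr => b _; rewrite mxE !mulrA [v a 0 * c]mulrC.
Qed.

Lemma bact0l A B (M : bimod_data A B) w : bact M 0 w = 0.
Proof. by rewrite -(scale0r (0 : 'cV[C]_(upt_dim A))) bactZl scale0r. Qed.

Lemma bact0r A B (M : bimod_data A B) v : bact M v 0 = 0.
Proof. by rewrite -(scale0r (0 : 'cV[C]_(upt_dim B))) bactZr scale0r. Qed.

Lemma bact_suml A B (M : bimod_data A B) w (I : Type) (r : seq I)
    (v : I -> 'cV[C]_(upt_dim A)) :
  bact M (\sum_(i <- r) v i) w = \sum_(i <- r) bact M (v i) w.
Proof.
elim: r => [|i r IH]; first by rewrite !big_nil bact0l.
by rewrite !big_cons -[v i]scale1r bact_linl IH !scale1r.
Qed.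

Lemma bact_sumr A B (M : bimod_data A B) v (I : Type) (r : seq I)
    (w : I -> 'cV[C]_(upt_dim B)) :
  bact M v (\sum_(i <- r) w i) = \sum_(i <- r) bact M v (w i).
Proof.
elim: r => [|i r IH]; first by rewrite !big_nil bact0r.
by rewrite !big_cons -[w i]scale1r bact_linr IH !scale1r.
Qed.

Lemma bact_delta A B (M : bimod_data A B) a b x y :
  bact M (delta_mx a 0) (delta_mx b 0) x y = bm_act M x (idx (idx (a, y), b)).
Proof.
rewrite mxE (big_pick (i := a)) => [|a' aa]; last first.
  by rewrite big1 // => b' _; rewrite mxE aa !mul0r.
rewrite (big_pick (i := b)) => [|b' bb]; last by rewrite !mxE bb mulr0 mul0r.
by rewrite !mxE !eqxx !mul1r.
Qed.

Definition mulv A (v w : 'cV[C]_(upt_dim A)) : 'cV[C]_(upt_dim A) :=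
  em_mul A *m (v *t w).

(** The form [em_cap] gives a conjugation for each of its arguments; starl enters
    the star axiom of a bimodule through the left action and starr through the
    right one.  On matrices both are the adjoint ([starl_pair], [starr_pair]). *)
Definition starl A (v : 'cV[C]_(upt_dim A)) : 'cV[C]_(upt_dim A) :=
  \col_b \sum_a (v a 0 * em_cap A 0 (idx (a, b)))^*.

Definition starr A (v : 'cV[C]_(upt_dim A)) : 'cV[C]_(upt_dim A) :=
  \col_a \sum_b (v b 0 * em_cap A 0 (idx (a, b)))^*.

Lemma mulv_linl A (w : 'cV[C]_(upt_dim A)) c x y :
  mulv (c *: x + y) w = c *: mulv x w + mulv y w.
Proof.
rewrite /mulv scalemxAr -mulmxDr; congr (_ *m _).
by apply/matrixP => i j; rewrite !mxE mulrDl mulrA.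
Qed.

Lemma mulv_linr A (w : 'cV[C]_(upt_dim A)) c x y :
  mulv w (c *: x + y) = c *: mulv w x + mulv w y.
Proof.
rewrite /mulv scalemxAr -mulmxDr; congr (_ *m _).
by apply/matrixP => i j; rewrite !mxE mulrDr mulrCA.
Qed.

Lemma mulv_delta A a b x :
  mulv (delta_mx a 0) (delta_mx b 0) x 0 = em_mul A x (idx (a, b)).
Proof.
rewrite mxE sum_idx (big_pick (i := a)) => [|a' aa]; last first.
  by rewrite big1 // => b' _; rewrite !mxE !mxtens_indexK aa mul0r mulr0.
rewrite (big_pick (i := b)) => [|b' bb]; last first.
  by rewrite !mxE !mxtens_indexK bb mulr0 mulr0.
by rewrite !mxE !mxtens_indexK !eqxx !mulr1.
Qed.

Lemma starl_lin A c (x y : 'cV[C]_(upt_dim A)) :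
  starl (c *: x + y) = c^* *: starl x + starl y.
Proof.
apply/matrixP => i j; rewrite !mxE mulr_sumr -big_split; apply: eq_bigr => a _ /=.
by rewrite !mxE mulrDl rmorphD -mulrA rmorphM.
Qed.

Lemma starr_lin A c (x y : 'cV[C]_(upt_dim A)) :
  starr (c *: x + y) = c^* *: starr x + starr y.
Proof.
apply/matrixP => i j; rewrite !mxE mulr_sumr -big_split; apply: eq_bigr => a _ /=.
by rewrite !mxE mulrDl rmorphD -mulrA rmorphM.
Qed.

Lemma starl_delta A a b : starl (delta_mx a 0 : 'cV[C]_(upt_dim A)) b 0 =
  (em_cap A 0 (idx (a, b)))^*.
Proof.
rewrite mxE (big_pick (i := a)) => [|a' aa]; last by rewrite mxE aa mul0r conjC0.
by rewrite mxE !eqxx mul1r.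
Qed.

Lemma starr_delta A a b : starr (delta_mx b 0 : 'cV[C]_(upt_dim A)) a 0 =
  (em_cap A 0 (idx (a, b)))^*.
Proof.
rewrite mxE (big_pick (i := b)) => [|a' aa]; last by rewrite mxE aa mul0r conjC0.
by rewrite mxE !eqxx mul1r.
Qed.

Lemma bact_mul_delta A B (M : bimod_data A B) :
  (forall i j k l, bact M (delta_mx i 0) (delta_mx l 0) *m bact M (delta_mx j 0) (delta_mx k 0) =
    bact M (mulv (delta_mx i 0) (delta_mx j 0)) (mulv (delta_mx k 0) (delta_mx l 0))) ->
  forall v w v' w', bact M v w *m bact M v' w' = bact M (mulv v v') (mulv w' w).
Proof.
move=> e v w v' w'.
apply: (cv_lin_ext (f := fun v => bact M v w *m bact M v' w')
  (g := fun v => bact M (mulv v v') (mulv w' w))) => [c x y|c x y|i].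
- by rewrite bact_linl mulmxDl scalemxAl.
- by rewrite mulv_linl bact_linl.
apply: (cv_lin_ext (f := fun w => bact M _ w *m bact M v' w')
  (g := fun w => bact M _ (mulv w' w))) => [c x y|c x y|l].
- by rewrite bact_linr mulmxDl scalemxAl.
- by rewrite mulv_linr bact_linr.
apply: (cv_lin_ext (f := fun v' => _ *m bact M v' w')
  (g := fun v' => bact M (mulv _ v') _)) => [c x y|c x y|j].
- by rewrite bact_linl mulmxDr scalemxAr.
- by rewrite mulv_linr bact_linl.
apply: (cv_lin_ext (f := fun w' => _ *m bact M _ w')
  (g := fun w' => bact M _ (mulv w' _))) => [c x y|c x y|k].
- by rewrite bact_linr mulmxDr scalemxAr.
- by rewrite mulv_linl bact_linr.
exact: e.
Qed.

Lemma bact_star_delta A B (M : bimod_data A B) :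
  (forall a b, bact M (delta_mx a 0) (delta_mx b 0) =
    (bact M (starl (delta_mx a 0)) (starr (delta_mx b 0)))^t*) ->
  forall v w, bact M v w = (bact M (starl v) (starr w))^t*.
Proof.
move=> e v w.
apply: (cv_lin_ext (f := fun v => bact M v w)
  (g := fun v => (bact M (starl v) (starr w))^t*)) => [c x y|c x y|a].
- by rewrite bact_linl.
- by rewrite starl_lin bact_linl raddfD map_mxD dagZ conjCK.
apply: (cv_lin_ext (f := fun w => bact M _ w)
  (g := fun w => (bact M _ (starr w))^t*)) => [c x y|c x y|b].
- by rewrite bact_linr.
- by rewrite starr_lin bact_linr raddfD map_mxD dagZ conjCK.
exact: e.
Qed.

(** The action w |-> bact M v w is by right multiplication, hence the reversed
    order in the first field. *)
Record is_bimod_action A B (M : bimod_data A B) : Prop := IsBimodAction {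
  action_mul : forall v w v' w', bact M v w *m bact M v' w' = bact M (mulv v v') (mulv w' w);
  action_one : bact M (em_one A) (em_one B) = 1%:M;
  action_star : forall v w, bact M v w = (bact M (starl v) (starr w))^t*
}.

Lemma tens3E m n p q r s (X : 'M[C]_(m, n)) (Y : 'M[C]_(p, q)) (Z : 'M[C]_(r, s))
   i j k i' j' k' :
  (X *t Y *t Z) (idx (idx (i, j), k)) (idx (idx (i', j'), k')) =
  X i i' * Y j j' * Z k k'.
Proof. by rewrite !tensmxE. Qed.

Lemma cast_bimod a b c d e (eq : (a * b * c * (d * e) = a * (b * c * d) * e)%N) i j k l m :
  cast_ord eq (idx (idx (idx (i, j), k), idx (l, m))) =
  idx (idx (i, idx (idx (j, k), l)), m).
Proof. by apply: val_inj; rewrite /= !mulnDl !mulnA !addnA. Qed.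

Lemma cast_bimodV a b c d e (eq : (a * (b * c * d) * e = a * b * c * (d * e))%N) i j k l m :
  cast_ord eq (idx (idx (i, idx (idx (j, k), l)), m)) =
  idx (idx (idx (i, j), k), idx (l, m)).
Proof. by apply: val_inj; rewrite /= !mulnDl !mulnA !addnA. Qed.

Lemma cast_11 b (e : (1 * b * 1 = b)%N) i j k : cast_ord e (idx (idx (i, j), k)) = j.
Proof. by apply: val_inj; rewrite /= !ord1 !muln1 addn0. Qed.

Lemma action_mulP A B (M : bimod_data A B) :
  (bm_act M *s (em_mul A *t (1%:M : 'M_(upt_dim M)) *t em_mul B) =s
    bm_act M *s ((1%:M : 'M_(upt_dim A)) *t bm_act M *t (1%:M : 'M_(upt_dim B)))) <->
  forall v w v' w', bact M v w *m bact M v' w' = bact M (mulv v v') (mulv w' w).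
Proof.
have L x i j y k l :
    (bm_act M *s (em_mul A *t (1%:M : 'M_(upt_dim M)) *t em_mul B)) x
      (idx (idx (idx (i, j), y), idx (k, l))) =
    bact M (mulv (delta_mx i 0) (delta_mx j 0)) (mulv (delta_mx k 0) (delta_mx l 0)) x y.
  rewrite strict_compE sum_idx [RHS]mxE sum_idx; apply: eq_bigr => c _.
  rewrite (big_pick (i := y)) => [|z zy]; last first.
    by rewrite big1 // => d _; rewrite tens3E one_mxE zy mulr0 mul0r mulr0.
  apply: eq_bigr => d _.
  by rewrite cast_ord_id tens3E !mulv_delta one_mxE eqxx mulr1 mulrC.
have Rr x i j y k l :
    (bm_act M *s ((1%:M : 'M_(upt_dim A)) *t bm_act M *t (1%:M : 'M_(upt_dim B)))) x
      (idx (idx (i, idx (idx (j, y), k)), l)) =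
    (bact M (delta_mx i 0) (delta_mx l 0) *m bact M (delta_mx j 0) (delta_mx k 0)) x y.
  rewrite strict_compE sum_idx sum_idx (big_pick (i := i)) => [|c ci]; last first.
    rewrite big1 // => z _; rewrite big1 // => d _.
    by rewrite tens3E one_mxE ci !mul0r mulr0.
  rewrite mxE; apply: eq_bigr => z _.
  rewrite (big_pick (i := l)) => [|c ci]; last first.
    by rewrite tens3E !one_mxE ci mulr0 mulr0.
  by rewrite cast_ord_id tens3E !one_mxE !eqxx mulr1 mul1r !bact_delta.
rewrite strict_eqP; split=> [e|e x c]; last first.
  case: (mxtens_indexP c) => c' c3; case: (mxtens_indexP c') => c1 y.
  case: (mxtens_indexP c1) => i j; case: (mxtens_indexP c3) => k l.
  by rewrite cast_ord_id cast_bimod L Rr e.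
have e' i j k l : bact M (delta_mx i 0) (delta_mx l 0) *m bact M (delta_mx j 0) (delta_mx k 0) =
    bact M (mulv (delta_mx i 0) (delta_mx j 0)) (mulv (delta_mx k 0) (delta_mx l 0)).
  apply/matrixP => x y; rewrite -Rr -L e.
  by rewrite cast_ord_id cast_bimod.
exact: bact_mul_delta.
Qed.

Lemma action_oneP A B (M : bimod_data A B) :
  (bm_act M *m (em_one A *t (1%:M : 'M_(upt_dim M)) *t em_one B) =s
    (1%:M : 'M[C]_(upt_dim M))) <-> bact M (em_one A) (em_one B) = 1%:M.
Proof.
have L x i y j : (bm_act M *m (em_one A *t (1%:M : 'M_(upt_dim M)) *t em_one B)) x
    (idx (idx (i, y), j)) = bact M (em_one A) (em_one B) x y.
  rewrite !mxE sum_idx sum_idx; apply: eq_bigr => c _.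
  rewrite (big_pick (i := y)) => [|z zy]; last first.
    by rewrite big1 // => d _; rewrite tens3E one_mxE zy mulr0 mul0r mulr0.
  by apply: eq_bigr => d _; rewrite tens3E !ord1 one_mxE eqxx mulr1 mulrC.
rewrite strict_eqP; split=> [e|e x c].
  apply/matrixP => x y; rewrite -(L x 0 y 0) e.
  by rewrite cast_ord_id cast_11.
case: (mxtens_indexP c) => c' j; case: (mxtens_indexP c') => i y.
by rewrite L e cast_ord_id cast_11.
Qed.

Lemma action_starP A B (M : bimod_data A B) :
  ((em_cap A *t (1%:M : 'M_(upt_dim M)) *t em_cap B) *s
    ((1%:M : 'M_(upt_dim A)) *t (bm_act M)^t* *t (1%:M : 'M_(upt_dim B))) =s bm_act M) <->
  forall v w, bact M v w = (bact M (starl v) (starr w))^t*.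
Proof.
have L i x j a y b : ((em_cap A *t (1%:M : 'M_(upt_dim M)) *t em_cap B) *s
    ((1%:M : 'M_(upt_dim A)) *t (bm_act M)^t* *t (1%:M : 'M_(upt_dim B))))
      (idx (idx (i, x), j)) (idx (idx (a, y), b)) =
    (bact M (starl (delta_mx a 0)) (starr (delta_mx b 0)))^t* x y.
  rewrite strict_compE sum_idx sum_idx (big_pick (i := a)) => [|c ci]; last first.
    rewrite big1 // => z _; rewrite big1 // => d _.
    by rewrite tens3E one_mxE ci !mul0r mulr0.
  rewrite [RHS]mxE [(_^T) x y]mxE [bact _ _ _ _ _]mxE rmorph_sum sum_idx sum_idx /=.
  apply: eq_bigr => c _.
  rewrite (big_pick (i := x)) => [|z zx]; last first.
    rewrite big1 // => d _; rewrite big1 // => d' _.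
    by rewrite cast_bimodV tens3E one_mxE eq_sym zx mulr0 !mul0r.
  rewrite rmorph_sum; apply: eq_bigr => d _ /=.
  rewrite (big_pick (i := b)) => [|c' ci]; last first.
    by rewrite tens3E !one_mxE ci mulr0 mulr0.
  rewrite cast_bimodV !tens3E !one_mxE !eqxx !mulr1 mul1r starl_delta starr_delta.
  by rewrite !rmorphM /= !conjCK !mxE !ord1.
rewrite strict_eqP; split=> [e|e c1 c2]; last first.
  case: (mxtens_indexP c1) => c' j; case: (mxtens_indexP c') => i x.
  case: (mxtens_indexP c2) => d' b; case: (mxtens_indexP d') => a y.
  by rewrite L -e bact_delta cast_11 cast_ord_id.
apply: bact_star_delta => a b.
apply/matrixP => x y; rewrite -(L 0 x 0) e bact_delta.
by rewrite cast_11 cast_ord_id.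
Qed.

Lemma is_bimodP A B (M : bimod_data A B) :
  is_bimod M <-> [/\ is_upt M,
    @is_modification _ _ F F (comp_upt (comp_upt A M) B) M (bm_act M) & is_bimod_action M].
Proof.
split.
  move=> [u m /action_mulP h1 /action_oneP h2 /action_starP h3].
  by split=> //; split.
move=> [u m [h1 h2 h3]]; split=> //.
- exact/action_mulP.
- exact/action_oneP.
- exact/action_starP.
Qed.

End Bimodules.

(** * Relative tensor products and transport along isomorphisms *)

Section RelativeTensor.
Variables (R : realType) (G : compact_quantum_group R) (F : fibre_functor G).
Local Notation C := R[i].
Implicit Types A B D : end_monoid_data F.
Local Notation e_ k := (delta_mx k 0).

Lemma cast_1x1y1 m n (e : (m * n = 1 * m * 1 * n * 1)%N) x y :
  cast_ord e (idx (x, y)) = idx (idx (idx (idx (ord0, x), ord0), y), ord0).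
Proof. by apply: val_inj; rewrite /= !muln1 !addn0 mul0n add0n. Qed.

Lemma cast_rel a m b c n d (e : (a * m * (b * c) * n * d = a * m * b * (c * n * d))%N)
    i x j k y l :
  cast_ord e (idx (idx (idx (idx (i, x), idx (j, k)), y), l)) =
  idx (idx (idx (i, x), j), idx (idx (k, y), l)).
Proof. by apply: val_inj; rewrite /= !mulnDl !mulnA !addnA. Qed.

Lemma cast_rel2 a m n d (e : (a * (m * n) * d = a * m * (n * d))%N) i x y l :
  cast_ord e (idx (idx (i, idx (x, y)), l)) = idx (idx (i, x), idx (y, l)).
Proof. by apply: val_inj; rewrite /= !mulnDl !mulnA !addnA. Qed.

Lemma bact_deltar A B (M : bimod_data A B) v b x y :
  bact M v (e_ b) x y = \sum_a v a 0 * bm_act M x (idx (idx (a, y), b)).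
Proof.
rewrite mxE; apply: eq_bigr => a _; rewrite (big_pick (i := b)) => [|c cb].
  by rewrite mxE !eqxx mulr1.
by rewrite mxE cb mulr0 mul0r.
Qed.

Lemma bact_deltal A B (M : bimod_data A B) w a x y :
  bact M (e_ a) w x y = \sum_b w b 0 * bm_act M x (idx (idx (a, y), b)).
Proof.
rewrite mxE (big_pick (i := a)) => [|c cb]; last first.
  by rewrite big1 // => b _; rewrite mxE cb !mul0r.
by apply: eq_bigr => b _; rewrite mxE !eqxx mul1r.
Qed.

Lemma rel_tensor_idemE A B D (M : bimod_data A B) (N : bimod_data B D) :
  rel_tensor_idem M N = \sum_b \sum_c em_cup B (idx (b, c)) 0 *:
    (bact M (em_one A) (e_ b) *t bact N (e_ c) (em_one D)).
Proof.
apply/matrixP => r s; case: (mxtens_indexP r) => x y; case: (mxtens_indexP s) => x' y'.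
rewrite summxE strict_castE cast_ord_id cast_1x1y1 strict_compE !sum_idx.
transitivity (\sum_b \sum_c \sum_a \sum_d em_cup B (idx (b, c)) 0 *
   (em_one A a 0 * bm_act M x (idx (idx (a, x'), b)) *
   (em_one D d 0 * bm_act N y (idx (idx (c, y'), d))))); last first.
  apply: eq_bigr => b _; rewrite summxE; apply: eq_bigr => c _.
  rewrite [RHS]mxE tensmxE bact_deltar bact_deltal mulr_suml mulr_sumr.
  by apply: eq_bigr => a _; rewrite mulr_sumr mulr_sumr.
transitivity (\sum_a \sum_b \sum_c \sum_d em_cup B (idx (b, c)) 0 *
   (em_one A a 0 * bm_act M x (idx (idx (a, x'), b)) *
   (em_one D d 0 * bm_act N y (idx (idx (c, y'), d))))); last first.
  rewrite exchange_big; apply: eq_bigr => b _ /=.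
  by rewrite exchange_big.
apply: eq_bigr => a _; rewrite (big_pick (i := x')) => [|z zx]; last first.
  rewrite big1 // => bc _; rewrite big1 // => y1 _; rewrite big1 // => d _.
  by rewrite !tensmxE one_mxE zx mulr0 !mul0r mulr0.
rewrite sum_idx; apply: eq_bigr => b _; apply: eq_bigr => c _.
rewrite (big_pick (i := y')) => [|z zy]; last first.
  by rewrite big1 // => d _; rewrite !tensmxE !one_mxE zy mulr0 mul0r mulr0.
apply: eq_bigr => d _.
rewrite cast_rel !tensmxE !one_mxE !eqxx !mulr1.
by ring.
Qed.

Lemma left_actE A B (M : bimod_data A B) x a y :
  left_act M x (idx (a, y)) = bact M (e_ a) (em_one B) x y.
Proof.
rewrite strict_castE cast_ord_id cast_1ridx mxE sum_idx sum_idx bact_deltal.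
rewrite (big_pick (i := a)) => [|z za]; last first.
  by rewrite big1 // => z' _; rewrite big1 // => b _;
    rewrite tens3E one_mxE za !mul0r mulr0.
rewrite (big_pick (i := y)) => [|z za]; last first.
  by rewrite big1 // => b _; rewrite tens3E !one_mxE za mulr0 mul0r mulr0.
apply: eq_bigr => b _.
by rewrite tens3E !one_mxE !eqxx !mul1r mulrC.
Qed.

Lemma right_actE A B (M : bimod_data A B) x b y :
  right_act M x (idx (y, b)) = bact M (em_one A) (e_ b) x y.
Proof.
rewrite strict_castE cast_ord_id cast_1lidx2 mxE sum_idx sum_idx bact_deltar.
apply: eq_bigr => a _; rewrite (big_pick (i := y)) => [|z za]; last first.
  by rewrite big1 // => c _; rewrite tens3E one_mxE za mulr0 mul0r mulr0.
rewrite (big_pick (i := b)) => [|z za]; last first.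
  by rewrite tens3E !one_mxE za !mulr0.
by rewrite tens3E !one_mxE !eqxx !mulr1 mulrC.
Qed.

(** Both sides are bilinear in v and w. *)
Lemma compress_delta A B D (M : bimod_data A B) (N : bimod_data B D)
    (P : bimod_data A D) (i : 'M[C]_(upt_dim M * upt_dim N, upt_dim P)) :
  (forall a d, bact P (e_ a) (e_ d) =
    i^t* *m (bact M (e_ a) (em_one B) *t bact N (em_one B) (e_ d)) *m i) ->
  forall v w, bact P v w =
    i^t* *m (bact M v (em_one B) *t bact N (em_one B) w) *m i.
Proof.
move=> e v w.
apply: (cv_lin_ext (f := fun v => bact P v w)
  (g := fun v => i^t* *m (bact M v (em_one B) *t bact N (em_one B) w) *m i))
  => [c x y|c x y|a].
- by rewrite bact_linl.
- rewrite bact_linl; have -> X Y Z : (c *: X + Y) *t Z = c *: (X *t Z) + (Y *t Z).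
    by apply/matrixP => r s; rewrite !mxE mulrDl mulrA.
  by rewrite mulmxDr mulmxDl -scalemxAr -scalemxAl.
apply: (cv_lin_ext (f := fun w => bact P _ w)
  (g := fun w => i^t* *m (bact M _ (em_one B) *t bact N (em_one B) w) *m i))
  => [c x y|c x y|d].
- by rewrite bact_linr.
- rewrite bact_linr; have -> X Y Z : Z *t (c *: X + Y) = c *: (Z *t X) + (Z *t Y).
    by apply/matrixP => r s; rewrite !mxE mulrDr mulrCA.
  by rewrite mulmxDr mulmxDl -scalemxAr -scalemxAl.
exact: e.
Qed.

Lemma rel_tensor_actP A B D (M : bimod_data A B) (N : bimod_data B D)
    (P : bimod_data A D) (i : 'M[C]_(upt_dim M * upt_dim N, upt_dim P)) :
  bm_act P = i^t* *m (left_act M *t right_act N) *s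
     ((1%:M : 'M_(upt_dim A)) *t i *t (1%:M : 'M_(upt_dim D))) <->
  forall v w, bact P v w =
    i^t* *m (bact M v (em_one B) *t bact N (em_one B) w) *m i.
Proof.
have L p a q d : (i^t* *m (left_act M *t right_act N) *s
     ((1%:M : 'M_(upt_dim A)) *t i *t (1%:M : 'M_(upt_dim D)))) p (idx (idx (a, q), d)) =
    (i^t* *m (bact M (e_ a) (em_one B) *t bact N (em_one B) (e_ d)) *m i) p q.
  rewrite strict_compE sum_idx sum_idx (big_pick (i := a)) => [|z za]; last first.
    rewrite big1 // => xy _; rewrite big1 // => d' _.
    by rewrite tens3E one_mxE za !mul0r mulr0.
  rewrite [RHS]mxE; apply: eq_bigr => xy _.
  rewrite (big_pick (i := d)) => [|z za]; last by rewrite tens3E !one_mxE za !mulr0.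
  rewrite tens3E !one_mxE !eqxx mulr1 mul1r; congr (_ * _).
  case: (mxtens_indexP xy) => x y; rewrite cast_rel2 !mxE.
  apply: eq_bigr => k _; congr (_ * _); case: (mxtens_indexP k) => x' y'.
  by rewrite !tensmxE left_actE right_actE.
split=> [e|e]; last first.
  apply/matrixP => p c; case: (mxtens_indexP c) => c' d; case: (mxtens_indexP c') => a q.
  by rewrite L -e bact_delta.
apply: compress_delta => a d.
by apply/matrixP => p q; rewrite bact_delta -L e.
Qed.

(** The projection onto the relative tensor product is the sum of m b (x) c n over
    the components b (x) c of the element [em_cup]. *)
Lemma is_rel_tensorP A B D (M : bimod_data A B) (N : bimod_data B D)
    (P : bimod_data A D) (i : 'M[C]_(upt_dim M * upt_dim N, upt_dim P)) :
  is_rel_tensor i <-> 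
  [/\ is_upt P, @is_modification _ _ F F P (comp_upt M N) i, i^t* *m i = 1%:M,
   i *m i^t* = \sum_b \sum_c em_cup B (idx (b, c)) 0 *:
    (bact M (em_one A) (e_ b) *t bact N (e_ c) (em_one D)) &
   forall v w, bact P v w =
    i^t* *m (bact M v (em_one B) *t bact N (em_one B) w) *m i].
Proof.
rewrite /is_rel_tensor rel_tensor_idemE; split.
  by move=> [h1 h2 h3 h4 /rel_tensor_actP h5].
by move=> [h1 h2 h3 h4 h5]; split=> //; apply/rel_tensor_actP.
Qed.

(** Restriction of scalars along f and g. *)
Definition bimod_along A B A' B' (f : 'M[C]_(upt_dim A', upt_dim A))
    (g : 'M[C]_(upt_dim B', upt_dim B)) (M : bimod_data A' B') : bimod_data A B :=
  @BimodData _ _ _ A B M (bm_act M *m (f *t (1%:M : 'M_(upt_dim M)) *t g)).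

Lemma bact_along A B A' B' (f : 'M[C]_(upt_dim A', upt_dim A))
    (g : 'M[C]_(upt_dim B', upt_dim B)) (M : bimod_data A' B') v w :
  bact (bimod_along f g M) v w = bact M (f *m v) (g *m w).
Proof.
apply/matrixP => x y.
transitivity (\sum_a \sum_b \sum_c \sum_d v a 0 * w b 0 *
    (bm_act M x (idx (idx (c, y), d)) * (f c a * g d b))).
  rewrite mxE; apply: eq_bigr => a _; apply: eq_bigr => b _.
  rewrite mxE sum_idx sum_idx mulr_sumr; apply: eq_bigr => c _.
  rewrite (big_pick (i := y)) => [|z zy]; last first.
    by rewrite big1 // => d _; rewrite tens3E one_mxE zy mulr0 mul0r mulr0.
  rewrite mulr_sumr; apply: eq_bigr => d _.
  by rewrite tens3E one_mxE eqxx mulr1.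
rewrite mxE.
under eq_bigr => a _ do rewrite exchange_big /=.
rewrite exchange_big; apply: eq_bigr => c _ /=.
under eq_bigr => a _ do rewrite exchange_big /=.
rewrite exchange_big; apply: eq_bigr => d _ /=.
rewrite !mxE mulr_suml mulr_suml; apply: eq_bigr => a _.
rewrite mulr_sumr mulr_suml; apply: eq_bigr => b _.
by ring.
Qed.

Section Hom.
Variables (A A' : end_monoid_data F) (f : 'M[C]_(upt_dim A', upt_dim A)).
Hypotheses (uf : is_unitary f) (fmul : f *m em_mul A = em_mul A' *m (f *t f))
  (fone : f *m em_one A = em_one A').

Lemma hom_mulv v w : f *m mulv v w = mulv (f *m v) (f *m w).
Proof. by rewrite /mulv mulmxA fmul -mulmxA (tensmx_mul f f v w). Qed.

Lemma hom_cap : em_cap A = em_cap A' *m (f *t f).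
Proof.
have [f1 f2] := uf.
by rewrite /em_cap -mulmxA -fmul -fone dagM -!mulmxA (mulmxA _ f) f1 mul1mx.
Qed.

Lemma hom_cup : (f *t f) *m em_cup A = em_cup A'.
Proof.
have [f1 f2] := uf.
have e : (f *t f) *m (em_mul A)^t* = (em_mul A')^t* *m f.
  have := congr1 (fun M => (f *t f) *m M^t* *m f) fmul.
  rewrite /= !dagM dag_tens !mulmxA -(mulmxA _ (f^t*)) f1 mulmx1 => ->.
  by rewrite tensmx_mul f2 tensmx11 mul1mx.
by rewrite /em_cup mulmxA e -mulmxA fone.
Qed.

(** For K and K' the forms [em_cap] this is the compatibility of f with the two
    conjugations; it uses f f^* = 1. *)
Lemma hom_form_conj (K : 'I_(upt_dim A) -> 'I_(upt_dim A) -> C)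
    (K' : 'I_(upt_dim A') -> 'I_(upt_dim A') -> C) (v : 'cV[C]_(upt_dim A)) b :
  (forall a c, K a c = \sum_d \sum_e K' d e * (f d a * f e c)) ->
  \sum_c f b c * \sum_a (v a 0 * K a c)^* = \sum_d ((f *m v) d 0 * K' d b)^*.
Proof.
move=> KE.
transitivity (\sum_a (v a 0 * \sum_c K a c * (f b c)^*)^*).
  under eq_bigr => c _ do rewrite mulr_sumr.
  rewrite exchange_big; apply: eq_bigr => a _ /=.
  rewrite mulr_sumr rmorph_sum; apply: eq_bigr => c _ /=.
  by rewrite !rmorphM /= conjCK; ring.
have E a : \sum_c K a c * (f b c)^* = \sum_d f d a * K' d b.
  transitivity (\sum_c \sum_d \sum_e K' d e * (f d a * f e c) * (f b c)^*).
    apply: eq_bigr => c _; rewrite KE mulr_suml.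
    by apply: eq_bigr => d _; rewrite mulr_suml.
  rewrite exchange_big; apply: eq_bigr => d _ /=.
  rewrite exchange_big (big_pick (i := b)) => [|e eb] /=.
    have /matrixP/(_ b b) := uf.2; rewrite one_mxE eqxx mxE => h.
    transitivity (K' d b * f d a * true%:R); last by rewrite mulr1 mulrC.
    rewrite -h mulr_sumr; apply: eq_bigr => c _.
    by rewrite !mxE; ring.
  have /matrixP/(_ e b) := uf.2; rewrite one_mxE eb mxE => h.
  transitivity (K' d e * f d a * false%:R); last by rewrite mulr0.
  rewrite -h mulr_sumr; apply: eq_bigr => c _.
  by rewrite !mxE; ring.
under eq_bigr => a _ do rewrite E mulr_sumr rmorph_sum.
rewrite exchange_big; apply: eq_bigr => d _ /=.
rewrite [(f *m v) _ _]mxE mulr_suml rmorph_sum; apply: eq_bigr => a _ /=.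
by congr (_^*); ring.
Qed.

Lemma hom_starl v : f *m starl v = starl (f *m v).
Proof.
apply/matrixP => b o; rewrite {o}ord1 mxE [RHS]mxE.
rewrite -(@hom_form_conj (fun a c => em_cap A 0 (idx (a, c)))
  (fun d e => em_cap A' 0 (idx (d, e)))) => [|a c].
  by apply: eq_bigr => c _; rewrite mxE.
rewrite hom_cap mxE sum_idx.
by apply: eq_bigr => d _; apply: eq_bigr => e _; rewrite tensmxE.
Qed.

Lemma hom_starr v : f *m starr v = starr (f *m v).
Proof.
apply/matrixP => b o; rewrite {o}ord1 mxE [RHS]mxE.
rewrite -(@hom_form_conj (fun a c => em_cap A 0 (idx (c, a)))
  (fun d e => em_cap A' 0 (idx (e, d)))) => [|a c].
  by apply: eq_bigr => c _; rewrite mxE.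
rewrite hom_cap mxE sum_idx exchange_big.
by apply: eq_bigr => d _; apply: eq_bigr => e _; rewrite tensmxE; ring.
Qed.

End Hom.

Lemma bimod_along_bimod A B A' B' (f : 'M[C]_(upt_dim A', upt_dim A))
    (g : 'M[C]_(upt_dim B', upt_dim B)) (M : bimod_data A' B') :
  is_unitary f -> is_modification f -> f *m em_mul A = em_mul A' *m (f *t f) ->
  f *m em_one A = em_one A' ->
  is_unitary g -> is_modification g -> g *m em_mul B = em_mul B' *m (g *t g) ->
  g *m em_one B = em_one B' ->
  is_bimod M -> is_bimod (bimod_along f g M).
Proof.
move=> uf mf fm fo ug mg gm go /is_bimodP[uM mM [a1 a2 a3]].
apply/is_bimodP; split=> //.
  apply: (mod_comp _ mM); apply: mod_tens => //.
  by apply: mod_tens => //; apply: mod_id.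
split.
- by move=> v w v' w'; rewrite !bact_along a1 !hom_mulv.
- by rewrite bact_along fo go.
- by move=> v w; rewrite !bact_along a3 hom_starl // hom_starr.
Qed.

Lemma rel_tensor_along A B D A' B' D' (f : 'M[C]_(upt_dim A', upt_dim A))
    (g : 'M[C]_(upt_dim B', upt_dim B)) (k : 'M[C]_(upt_dim D', upt_dim D))
    (M : bimod_data A' B') (N : bimod_data B' D') (P : bimod_data A' D') i :
  f *m em_one A = em_one A' -> k *m em_one D = em_one D' ->
  is_unitary g -> g *m em_mul B = em_mul B' *m (g *t g) ->
  g *m em_one B = em_one B' ->
  @is_rel_tensor _ _ _ _ _ _ M N P i ->
  @is_rel_tensor _ _ _ _ _ _ (bimod_along f g M) (bimod_along g k N)
    (bimod_along f k P) i.
Proof.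
move=> fo ko ug gm go /is_rel_tensorP[h1 h2 h3 h4 h5].
apply/is_rel_tensorP; split=> //; last first.
  by move=> v w; rewrite !bact_along go h5.
rewrite h4 -(hom_cup ug gm go).
have ge b : g *m e_ b = \sum_c g c b *: e_ c :> 'cV_(upt_dim B').
  apply/matrixP => x o; rewrite summxE mxE (big_pick (i := b)) => [|c cb].
    rewrite (big_pick (i := x)) => [|c cx]; first by rewrite !mxE !eqxx.
    by rewrite !mxE [x == c]eq_sym cx mulr0.
  by rewrite mxE cb mulr0.
transitivity (\sum_b \sum_c \sum_b' \sum_c' (g b b' * g c c' * em_cup B (idx (b', c')) 0) *:
  (bact M (em_one A') (e_ b) *t bact N (e_ c) (em_one D'))).
  apply: eq_bigr => b _; apply: eq_bigr => c _.
  rewrite mxE sum_idx scaler_suml; apply: eq_bigr => b' _.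
  by rewrite scaler_suml; apply: eq_bigr => c' _; rewrite tensmxE.
under [RHS]eq_bigr => b' _ do under eq_bigr => c' _ do
  rewrite !bact_along fo ko !ge bact_sumr bact_suml tens_suml scaler_sumr.
under [RHS]eq_bigr => b' _ do rewrite exchange_big.
rewrite [RHS]exchange_big; apply: eq_bigr => b _ /=.
under [RHS]eq_bigr => b' _ do under eq_bigr => c' _ do
  rewrite tens_sumr scaler_sumr.
under [RHS]eq_bigr => b' _ do rewrite exchange_big.
rewrite [RHS]exchange_big; apply: eq_bigr => c _ /=.
apply: eq_bigr => b' _; apply: eq_bigr => c' _.
rewrite bactZr bactZl tensZl tensZr !scalerA; congr (_ *: _).
by ring.
Qed.

Lemma bimod_iso_along A A' (f : 'M[C]_(upt_dim A', upt_dim A)) (P : bimod_data A' A') :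
  is_upt A -> is_upt A' ->
  is_unitary f -> is_modification f -> f *m em_mul A = em_mul A' *m (f *t f) ->
  bimod_iso P (regular_bimod A') -> bimod_iso (bimod_along f f P) (regular_bimod A).
Proof.
move=> uA uA' uf mf fm [g [[g1 g2] mg eg]]; have [f1 f2] := uf.
exists (f^t* *m g); split.
- split; rewrite dagM trmxCK.
    by rewrite mulmxA -(mulmxA _ f) f2 mulmx1.
  by rewrite mulmxA -(mulmxA _ g) g2 mulmx1.
- by apply: (mod_comp mg); apply: mod_dag.
rewrite /= !mulmxA -(mulmxA _ g) eg /=.
have fm' : f^t* *m em_mul A' = em_mul A *m (f^t* *t f^t*).
  have := congr1 (fun M => f^t* *m M *m (f^t* *t f^t*)) fm.
  rewrite /= !mulmxA f1 mul1mx -!mulmxA tensmx_mul f2 tensmx11 mulmx1.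
  by move=> ->.
rewrite !mulmxA fm' -!mulmxA; congr (_ *m _).
rewrite !tensmx_mul !mulmx1 !mul1mx; congr (_ *t _); last by rewrite f1.
by rewrite mulmxA fm' -mulmxA tensmx_mul f1.
Qed.

(** Restriction of scalars along unitary isomorphisms leaves relative tensor
    products unchanged and carries the regular bimodule to the regular bimodule. *)
Lemma morita_iso A B A' B' :
  is_upt A -> is_upt B -> is_upt A' -> is_upt B' ->
  iso_end A A' -> iso_end B B' -> morita_equiv A' B' -> morita_equiv A B.
Proof.
move=> uA uB uA' uB' [f [uf mf fm fo]] [g [ug mg gm go]].
move=> [M [N [bM bN [P [i [iP isoP]]] [Q [j [jQ isoQ]]]]]].
exists (bimod_along f g M), (bimod_along g f N); split.
- exact: bimod_along_bimod.
- exact: bimod_along_bimod.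
- exists (bimod_along f f P), i; split; first exact: rel_tensor_along.
  exact: bimod_iso_along.
- exists (bimod_along g g Q), j; split; first exact: rel_tensor_along.
  exact: bimod_iso_along.
Qed.

End RelativeTensor.

(** * The bimodule of two transformations *)

Section PairBimodules.
Variables (R : realType) (G : compact_quantum_group R).
Local Notation C := R[i].
Local Notation e_ k := (delta_mx k 0).

Lemma sum_delta_mx n : \sum_i delta_mx i i = (1%:M : 'M[C]_n).
Proof.
apply/matrixP => x y; rewrite summxE (big_pick (i := x)) => [|i ix].
  by rewrite !mxE eqxx eq_sym.
by rewrite mxE [x == i]eq_sym ix.
Qed.

Lemma delta_mx_conj m n (i : 'I_m) (j : 'I_n) : (delta_mx i j : 'M[C]_(m, n))^t* = delta_mx j i.
Proof. by rewrite trmx_delta map_delta_mx. Qed.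

Lemma mul_delta_mxZ m n p (i : 'I_m) (j k : 'I_n) (l : 'I_p) :
  delta_mx i j *m delta_mx k l = (j == k)%:R *: delta_mx i l :> 'M[C]_(m, p).
Proof. by rewrite mul_delta_mx_cond scaler_nat. Qed.

Lemma dagE m n (M : 'M[C]_(m, n)) i j : (M^t*) i j = (M j i)^*.
Proof. by rewrite !mxE. Qed.

Section PairAction.
Variables ha hb : nat.
Local Notation c := ((sqd R ha)^-1 * (sqd R hb)^-1).

(** The action (x (x) y^* ) (v (x) w^* ) (z (x) t^* ) = <y, v> <w, z> x (x) t^* up to
    the factor that makes the units act as the identity. *)
Definition pair_act : 'M[C]_(ha * hb, ha * ha * (ha * hb) * (hb * hb)) :=
  \matrix_(x, t)
    let a := mxtens_unindex (mxtens_unindex (mxtens_unindex t).1).1 in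
    let b := mxtens_unindex (mxtens_unindex t).2 in
    (c *: ((delta_mx a.1 a.2 : 'M_ha) *t (delta_mx b.2 b.1 : 'M_hb)))
      x (mxtens_unindex (mxtens_unindex t).1).2.

Lemma pair_actE x i j y k l : pair_act x (idx (idx (idx (i, j), y), idx (k, l))) =
  (c *: (delta_mx i j *t delta_mx l k)) x y.
Proof. by rewrite mxE !mxtens_indexK. Qed.

Lemma pair_act_in (V : lmodType C) (f : 'I_(ha * hb) -> V) i j p q k l :
  \sum_x pair_act x (idx (idx (idx (i, j), idx (p, q)), idx (k, l))) *: f x =
  (c * ((j == p)%:R * (k == q)%:R)) *: f (idx (i, l)).
Proof.
rewrite sum_idx (big_pick (i := i)) => [|u ui]; last first.
  rewrite big1 // => v _; rewrite pair_actE !mxE !mxtens_indexK /= ui.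
  by rewrite !mul0r mulr0 scale0r.
rewrite (big_pick (i := l)) => [|v vl]; last first.
  by rewrite pair_actE !mxE !mxtens_indexK /= vl !mulr0 scale0r.
rewrite pair_actE !mxE !mxtens_indexK /= !eqxx /=.
by rewrite [p == j]eq_sym [q == k]eq_sym.
Qed.

Lemma pair_act_out (V : lmodType C)
    (f : 'I_(ha * ha * (ha * hb) * (hb * hb)) -> V) p q :
  \sum_t pair_act (idx (p, q)) t *: f t =
  c *: \sum_j \sum_k f (idx (idx (idx (p, j), idx (j, k)), idx (k, q))).
Proof.
rewrite sum_idx sum_idx sum_idx (big_pick (i := p)) => [|u up]; last first.
  rewrite big1 // => v _; rewrite big1 // => z _; rewrite big1 // => b' _.
  case: (mxtens_indexP b') => k l; case: (mxtens_indexP z) => r s.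
  by rewrite pair_actE mxE tensmxE mxE eq_sym up mul0r mulr0 scale0r.
rewrite scaler_sumr; apply: eq_bigr => j _.
rewrite sum_idx (big_pick (i := j)) => [|r rj]; last first.
  rewrite big1 // => s _; rewrite big1 // => b' _.
  case: (mxtens_indexP b') => k l.
  by rewrite pair_actE mxE tensmxE !mxE rj andbF mul0r mulr0 scale0r.
rewrite scaler_sumr; apply: eq_bigr => k _.
rewrite sum_idx (big_pick (i := k)) => [|k2 kk]; last first.
  rewrite big1 // => l _.
  by rewrite pair_actE mxE tensmxE !mxE [k == _]eq_sym kk andbF !mulr0 scale0r.
rewrite (big_pick (i := q)) => [|l ql]; last first.
  by rewrite pair_actE mxE tensmxE !mxE [q == _]eq_sym ql !mulr0 scale0r.
by rewrite pair_actE mxE tensmxE !mxE !eqxx !mulr1.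
Qed.

End PairAction.

Section OneMonoid.
Variables (F1 F2 : fibre_functor G) (al : upt_data F1 F2).
Local Notation h := (upt_dim al).
Local Notation A := (upt_monoid al).
Hypothesis h0 : (0 < h)%N.

Lemma mulv_pair (i j k l : 'I_h) :
  mulv (A := A) (e_ (idx (i, j))) (e_ (idx (k, l))) =
  ((sqd R h)^-1 * (j == k)%:R) *: e_ (idx (i, l)).
Proof.
apply/matrixP => x o; rewrite {o}ord1 mulv_delta mxE.
case: (comp_idxP x) => x1 x2; rewrite [em_mul _]/(pair_mul R h).
rewrite pair_mulE mxE eqxx andbT eq_mxtens_index -mulnb natrM.
by rewrite !mulrA [_ * (j == k)%:R]mulrAC.
Qed.

Lemma cap_pair (i j k l : 'I_h) :
  em_cap A 0 (idx (idx (i, j), idx (k, l))) = (j == k)%:R * (i == l)%:R.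
Proof.
rewrite mxE sum_idx (big_pick (i := i)) => [|p pi]; last first.
  rewrite big1 // => q _; rewrite [em_mul _]/(pair_mul R h) pair_mulE pi.
  by rewrite !mul0r !mulr0.
rewrite (big_pick (i := l)) => [|q ql]; last first.
  by rewrite [em_mul _]/(pair_mul R h) pair_mulE ql !mulr0.
rewrite [em_mul _]/(pair_mul R h) pair_mulE dagE [em_one _]/(pair_one R h).
rewrite pair_oneE !eqxx rmorphM /= sqd_conj conjC_nat mul1r mulr1.
by rewrite mulrACA mulfV ?sqd_neq0 // mul1r mulrC.
Qed.

Lemma cup_pair (i j k l : 'I_h) :
  em_cup A (idx (idx (i, j), idx (k, l))) 0 = (j == k)%:R * (i == l)%:R.
Proof.
rewrite -cap_pair /em_cap mxE [RHS]mxE; apply: eq_bigr => x _.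
rewrite [em_mul _]/(pair_mul R h) !dagE mulrC pair_mul_conj; congr (_ * _).
case: (mxtens_indexP x) => p q; rewrite [em_one _]/(pair_one R h).
by rewrite pair_oneE rmorphM /= sqd_conj conjC_nat.
Qed.

Lemma starl_pair (i j : 'I_h) : starl (A := A) (e_ (idx (i, j))) = e_ (idx (j, i)).
Proof.
apply/matrixP => x o; rewrite {o}ord1 starl_delta [RHS]mxE eqxx andbT.
case: (comp_idxP x) => k l; rewrite cap_pair rmorphM /= !conjC_nat -natrM mulnb.
by rewrite eq_mxtens_index [k == j]eq_sym [l == i]eq_sym.
Qed.

Lemma starr_pair (i j : 'I_h) : starr (A := A) (e_ (idx (i, j))) = e_ (idx (j, i)).
Proof.
apply/matrixP => x o; rewrite {o}ord1 starr_delta [RHS]mxE eqxx andbT.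
case: (comp_idxP x) => k l; rewrite cap_pair rmorphM /= !conjC_nat -natrM mulnb.
by rewrite eq_mxtens_index andbC.
Qed.

Lemma one_pair : em_one A = sqd R h *: \sum_(i < h) e_ (idx (i, i)).
Proof.
apply/matrixP => x o; rewrite {o}ord1 [em_one A]/(pair_one R h) [RHS]mxE summxE.
case: (comp_idxP x) => k l; rewrite pair_oneE; congr (_ * _).
rewrite (big_pick (i := k)) => [|i ik]; last first.
  by rewrite mxE eq_mxtens_index eq_sym ik.
by rewrite mxE eq_mxtens_index !eqxx andbT eq_sym.
Qed.

End OneMonoid.

Section TwoMonoids.
Variables (F F' : fibre_functor G) (al be : upt_data F F').
Local Notation ha := (upt_dim al).
Local Notation hb := (upt_dim be).
Local Notation A := (upt_monoid al).
Local Notation B := (upt_monoid be).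
Local Notation c := ((sqd R ha)^-1 * (sqd R hb)^-1).

(** The bimodule al (x) be^* . *)
Definition pair_bimod : bimod_data A B :=
  @BimodData _ _ _ A B (comp_upt al (dual_upt be)) (pair_act ha hb).

Lemma pair_bactE (i j : 'I_ha) (k l : 'I_hb) :
  bact pair_bimod (e_ (idx (i, j))) (e_ (idx (k, l))) =
  c *: (delta_mx i j *t delta_mx l k).
Proof.
by apply/matrixP => x y; rewrite bact_delta pair_actE.
Qed.

Hypothesis ha0 : (0 < ha)%N.
Hypothesis hb0 : (0 < hb)%N.

Lemma pair_bact_onel (k l : 'I_hb) :
  bact pair_bimod (em_one A) (e_ (idx (k, l))) =
  (sqd R hb)^-1 *: (1%:M *t delta_mx l k).
Proof.
rewrite one_pair bactZl bact_suml.
under eq_bigr => i _ do rewrite pair_bactE.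
rewrite -scaler_sumr -tens_suml sum_delta_mx scalerA mulrA mulfV ?mul1r //.
exact: sqd_neq0.
Qed.

Lemma pair_bact_oner (i j : 'I_ha) :
  bact pair_bimod (e_ (idx (i, j))) (em_one B) =
  (sqd R ha)^-1 *: (delta_mx i j *t 1%:M).
Proof.
rewrite one_pair bactZr bact_sumr.
under eq_bigr => k _ do rewrite pair_bactE.
rewrite -scaler_sumr -tens_sumr sum_delta_mx scalerA mulrCA mulfV ?mulr1 //.
exact: sqd_neq0.
Qed.

Hypotheses (ua : is_upt al) (ub : is_upt be).
Hypotheses (da : is_dual_unitary (upt_blk al)) (db : is_dual_unitary (upt_blk be)).

(** The middle factors contract by the relation [dual_coiso] for al and for be. *)
Lemma pair_bimod_mod :
  @is_modification _ _ F F (comp_upt (comp_upt A pair_bimod) B) pair_bimod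
    (bm_act pair_bimod).
Proof.
apply/is_modificationP => X x t.
case: (comp_idxP x) => p q; case: (comp_idxP t) => t1 b.
case: (comp_idxP t1) => a y; case: (comp_idxP a) => i' j'.
case: (comp_idxP b) => k' l'; case: (comp_idxP y) => p' q'.
pose K := upt_blk (pair_bimod) X.
have KE u v u' v' : K (idx (u, v)) (idx (u', v')) =
    (upt_blk be X v v')^t* *m upt_blk al X u u'.
  by rewrite /K comp_upt_blk dual_upt_blk.
have AE u v u' v' : upt_blk A X (idx (u, v)) (idx (u', v')) =
    (upt_blk al X v v')^t* *m upt_blk al X u u'.
  by rewrite comp_upt_blk dual_upt_blk.
have BE u v u' v' : upt_blk B X (idx (u, v)) (idx (u', v')) =
    (upt_blk be X v v')^t* *m upt_blk be X u u'.
  by rewrite comp_upt_blk dual_upt_blk.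
rewrite (pair_act_in (K (idx (p, q)))) KE.
rewrite (pair_act_out (fun z => upt_blk (comp_upt (comp_upt A pair_bimod) B) X z _)).
rewrite -scalerA; congr (_ *: _).
transitivity (((upt_blk be X q l')^t* *m
    (\sum_k upt_blk be X k k' *m (upt_blk be X k q')^t*)) *m
    ((\sum_j upt_blk al X j p' *m (upt_blk al X j j')^t*) *m
    upt_blk al X p i')).
  rewrite (dual_coiso da) (dual_coiso db) mul_mx_scalar mul_scalar_mx.
  rewrite -scalemxAl -scalemxAr !scalerA; congr (_ *: _).
  by rewrite [p' == j']eq_sym; ring.
rewrite mulmx_sumr mulmx_suml exchange_big; apply: eq_bigr => k _ /=.
rewrite mulmx_suml mulmx_sumr; apply: eq_bigr => j _.
by rewrite !comp_upt_blk !dual_upt_blk !mulmxA.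
Qed.

Lemma pair_bimod_bimod : is_bimod pair_bimod.
Proof.
apply/is_bimodP; split.
- by apply: comp_upt_is_upt => //; apply: dual_upt_is_upt.
- exact: pair_bimod_mod.
split.
- apply: bact_mul_delta => a a' b' b.
  case: (comp_idxP a) => i j; case: (comp_idxP a') => i' j'.
  case: (comp_idxP b') => k' l'; case: (comp_idxP b) => k l.
  rewrite !mulv_pair bactZl bactZr !pair_bactE -scalemxAl -scalemxAr tensmx_mul.
  rewrite !mul_delta_mxZ tensZl tensZr !scalerA.
  by rewrite [l' == k]eq_sym; congr (_ *: _); ring.
- rewrite {1}one_pair bactZl bact_suml.
  transitivity (sqd R ha *: ((sqd R ha)^-1 *: (1%:M *t 1%:M : 'M[C]_(ha * hb)))).
    congr (_ *: _); rewrite -[X in X *t _]sum_delta_mx tens_suml scaler_sumr.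
    by apply: eq_bigr => i _; rewrite pair_bact_oner.
  by rewrite scalerA mulfV ?sqd_neq0 // scale1r tensmx11.
- apply: bact_star_delta => a b.
  case: (comp_idxP a) => i j; case: (comp_idxP b) => k l.
  rewrite starl_pair // starr_pair // !pair_bactE dagZ dag_tens !delta_mx_conj.
  by rewrite rmorphM /= !fmorphV /= !sqd_conj.
Qed.

End TwoMonoids.
End PairBimodules.

(** * Transformations with a common target are Morita equivalent *)

Section PairTensor.
Variables (R : realType) (G : compact_quantum_group R).
Local Notation C := R[i].
Local Notation e_ k := (delta_mx k 0).
Variables (F F' : fibre_functor G) (al be : upt_data F F').
Local Notation ha := (upt_dim al).
Local Notation hb := (upt_dim be).
Local Notation A := (upt_monoid al).
Local Notation B := (upt_monoid be).
Hypotheses (ha0 : (0 < ha)%N) (hb0 : (0 < hb)%N).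
Hypotheses (ua : is_upt al) (ub : is_upt be).
Hypotheses (da : is_dual_unitary (upt_blk al)) (db : is_dual_unitary (upt_blk be)).

(** The isometry al (x) al^* -> (al (x) be^* ) (x) (be (x) al^* ) that inserts the
    normalised coevaluation of H_be. *)
Definition insertion : 'M[C]_(ha * hb * (hb * ha), ha * ha) :=
  \matrix_(r, c)
    let x := mxtens_unindex (mxtens_unindex r).1 in
    let y := mxtens_unindex (mxtens_unindex r).2 in
    let z := mxtens_unindex c in
    (sqd R hb)^-1 * ((x.1 == z.1)%:R * (x.2 == y.1)%:R * (y.2 == z.2)%:R).

Lemma insertionE p q r s i j : insertion (idx (idx (p, q), idx (r, s))) (idx (i, j)) =
  (sqd R hb)^-1 * ((p == i)%:R * (q == r)%:R * (s == j)%:R).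
Proof. by rewrite mxE !mxtens_indexK. Qed.

Lemma insertion_sum (V : lmodType C) (f : 'I_(ha * hb * (hb * ha)) -> V) i j :
  \sum_t insertion t (idx (i, j)) *: f t =
  (sqd R hb)^-1 *: \sum_k f (idx (idx (i, k), idx (k, j))).
Proof.
rewrite sum_idx sum_idx (big_pick (i := i)) => [|p pi]; last first.
  rewrite big1 // => q _; rewrite sum_idx big1 // => r _; rewrite big1 // => s _.
  by rewrite insertionE pi !mul0r mulr0 scale0r.
rewrite scaler_sumr; apply: eq_bigr => k _.
rewrite sum_idx (big_pick (i := k)) => [|r rk]; last first.
  by rewrite big1 // => s _; rewrite insertionE [k == r]eq_sym rk mulr0 mul0r mulr0 scale0r.
rewrite (big_pick (i := j)) => [|s sj]; last first.
  by rewrite insertionE sj !mulr0 scale0r.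
by rewrite insertionE !eqxx !mulr1.
Qed.

Lemma insertion_conj x y : (insertion x y)^* = insertion x y.
Proof.
case: (mxtens_indexP x) => a b; case: (mxtens_indexP y) => i j.
case: (mxtens_indexP a) => p q; case: (mxtens_indexP b) => r s.
by rewrite insertionE -!natrM rmorphM /= conjC_nat fmorphV /= sqd_conj.
Qed.

Lemma insertion_compress (X1 : 'M[C]_(ha * hb)) (X2 : 'M[C]_(hb * ha)) i j i' j' :
  (insertion^t* *m (X1 *t X2) *m insertion) (idx (i, j)) (idx (i', j')) =
  (sqd R hb)^-1 * (sqd R hb)^-1 *
  \sum_q \sum_q' X1 (idx (i, q)) (idx (i', q')) * X2 (idx (q, j)) (idx (q', j')).
Proof.
rewrite mxE.
transitivity (\sum_t insertion t (idx (i', j')) *: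
    ((insertion^t* *m (X1 *t X2)) (idx (i, j)) t : C^o)).
  by apply: eq_bigr => t _; rewrite mulrC.
rewrite insertion_sum /= -mulrA; congr (_ * _).
rewrite [in RHS]exchange_big mulr_sumr; apply: eq_bigr => q' _ /=.
rewrite mxE.
transitivity (\sum_t insertion t (idx (i, j)) *:
    ((X1 *t X2) t (idx (idx (i', q'), idx (q', j'))) : C^o)).
  by apply: eq_bigr => t _; rewrite dagE insertion_conj.
rewrite insertion_sum /=; congr (_ * _); apply: eq_bigr => q _.
by rewrite tensmxE.
Qed.

Lemma insertion_isometry : insertion^t* *m insertion = 1%:M.
Proof.
have hh : sqd R hb * sqd R hb = hb%:R := sqdK R hb.
apply/matrixP => x y; case: (mxtens_indexP x) => i j; case: (mxtens_indexP y) => i' j'.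
have := insertion_compress 1%:M 1%:M i j i' j'; rewrite tensmx11 mulmx1 => ->.
transitivity ((sqd R hb)^-1 * (sqd R hb)^-1 *
    \sum_(q < hb) ((i == i')%:R * (j == j')%:R) : C).
  congr (_ * _); apply: eq_bigr => q _.
  rewrite (big_pick (i := q)) => [|q' qq].
    by rewrite !mx_delta eqxx mulr1 mul1r.
  by rewrite !mx_delta [q == q']eq_sym qq mulr0 mul0r.
rewrite sumr_const card_ord -[X in _ * X = _]mulr_natr -hh mx_delta.
have s0 := sqd_neq0 R hb0; by field; rewrite s0.
Qed.

(** Here the common target is used: in the middle, the blocks of be cancel
    against their adjoints. *)
Lemma insertion_mod :
  @is_modification _ _ F F A (comp_upt (pair_bimod al be) (pair_bimod be al)) insertion.
Proof.
apply/is_modificationP => X x y.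
case: (comp_idxP x) => x1 x2; case: (comp_idxP x1) => p q.
case: (comp_idxP x2) => r s; case: (comp_idxP y) => i j.
rewrite (insertion_sum (fun k =>
  upt_blk (comp_upt (pair_bimod al be) (pair_bimod be al)) X (idx (idx (p, q), idx (r, s))) k)).
transitivity (((sqd R hb)^-1 * (q == r)%:R) *:
    ((upt_blk al X s j)^t* *m upt_blk al X p i)).
  rewrite -scalerA; congr (_ *: _).
  transitivity ((upt_blk al X s j)^t* *m (\sum_k upt_blk be X r k *m
     (upt_blk be X q k)^t*) *m upt_blk al X p i).
    rewrite mulmx_sumr mulmx_suml; apply: eq_bigr => k _.
    by rewrite !comp_upt_blk !dual_upt_blk !mulmxA.
  have [_ coiso _ _ _] := iffLR (is_uptP be) ub.
  by rewrite coiso mul_mx_scalar -scalemxAl eq_sym.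
rewrite sum_idx (big_pick (i := p)) => [|u up]; last first.
  rewrite big1 // => v _.
  by rewrite insertionE eq_sym up !mul0r mulr0 scale0r.
rewrite (big_pick (i := s)) => [|u us]; last first.
  by rewrite insertionE [s == u]eq_sym us !mulr0 scale0r.
by rewrite insertionE !eqxx mul1r mulr1 comp_upt_blk dual_upt_blk.
Qed.

Lemma insertion_range : insertion *m insertion^t* =
  \sum_b \sum_c em_cup B (idx (b, c)) 0 *:
    (bact (pair_bimod al be) (em_one A) (e_ b) *t
     bact (pair_bimod be al) (e_ c) (em_one A)).
Proof.
transitivity (\sum_k \sum_l ((sqd R hb)^-1 * (sqd R hb)^-1) *:
  (((1%:M : 'M[C]_ha) *t (delta_mx l k : 'M[C]_hb)) *t
   ((delta_mx l k : 'M[C]_hb) *t (1%:M : 'M[C]_ha)))); last first.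
  rewrite [in RHS]sum_idx; apply: eq_bigr => k _; apply: eq_bigr => l _.
  rewrite sum_idx (big_pick (i := l)) => [|m ml]; last first.
    by rewrite big1 // => n _; rewrite (cup_pair hb0) [l == m]eq_sym ml mul0r scale0r.
  rewrite (big_pick (i := k)) => [|n nk]; last first.
    by rewrite (cup_pair hb0) [k == n]eq_sym nk mulr0 scale0r.
  rewrite (cup_pair hb0) !eqxx mul1r scale1r.
  rewrite pair_bact_onel // pair_bact_oner //.
  by rewrite tensZl tensZr scalerA.
apply/matrixP => x y; case: (mxtens_indexP x) => x1 x2; case: (mxtens_indexP x1) => p q.
case: (mxtens_indexP x2) => r s; case: (mxtens_indexP y) => y1 y2.
case: (mxtens_indexP y1) => p' q'; case: (mxtens_indexP y2) => r' s'.
rewrite summxE.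
under [RHS]eq_bigr => k _ do rewrite summxE.
transitivity ((sqd R hb)^-1 * (sqd R hb)^-1 *
    ((p == p')%:R * (q == r)%:R * (q' == r')%:R * (s == s')%:R)).
  rewrite mxE sum_idx (big_pick (i := p)) => [|u up]; last first.
    by rewrite big1 // => v _; rewrite insertionE eq_sym up !mul0r mulr0 mul0r.
  rewrite (big_pick (i := s)) => [|u us]; last first.
    by rewrite insertionE [s == u]eq_sym us !mulr0 mul0r.
  rewrite dagE insertion_conj !insertionE !eqxx /= [p' == p]eq_sym [s' == s]eq_sym.
  by rewrite mul1r mulr1; ring.
rewrite (big_pick (i := q')) => [|k kq]; last first.
  rewrite big1 // => l _; rewrite mxE !tensmxE !mxE [q' == k]eq_sym kq andbF.
  by rewrite mulr0 !mul0r mulr0.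
rewrite (big_pick (i := q)) => [|l lq]; last first.
  rewrite mxE !tensmxE !mxE [q == l]eq_sym lq /=.
  by rewrite mulr0 !mul0r mulr0.
rewrite mxE !tensmxE !mxE !eqxx /= [r == q]eq_sym [r' == q']eq_sym.
by rewrite -mulnb natrM; ring.
Qed.

Lemma regular_bactE i j k l :
  bact (regular_bimod A) (e_ (idx (i, j))) (e_ (idx (k, l))) =
  ((sqd R ha)^-1 * (sqd R ha)^-1) *: (delta_mx i j *t delta_mx l k).
Proof.
apply/matrixP => x y; rewrite bact_delta /= mul1r_tens.
case: (comp_idxP x) => x1 x2; case: (comp_idxP y) => m n.
rewrite [RHS]mxE tensmxE [delta_mx i j _ _]mxE [delta_mx l k _ _]mxE.
rewrite sum_idx (big_pick (i := x1)) => [|u ux]; last first.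
  by rewrite big1 // => v _; rewrite pair_mulE
    [x1 == u]eq_sym ux !mul0r mulr0 mul0r.
rewrite (big_pick (i := n)) => [|v vn]; last first.
  by rewrite !pair_mulE vn !mulr0.
rewrite !pair_mulE !eqxx -!mulnb !natrM.
by rewrite [j == m]eq_sym trueR; ring.
Qed.

Lemma pair_rel_tensor :
  @is_rel_tensor _ _ F A B A (pair_bimod al be) (pair_bimod be al)
    (regular_bimod A) insertion.
Proof.
apply/is_rel_tensorP; split.
- by apply: comp_upt_is_upt => //; apply: dual_upt_is_upt.
- exact: insertion_mod.
- exact: insertion_isometry.
- exact: insertion_range.
apply: compress_delta => a d.
case: (comp_idxP a) => i j; case: (comp_idxP d) => k l.
rewrite regular_bactE pair_bact_oner // pair_bact_onel //.
rewrite tensZl tensZr scalerA -scalemxAr -scalemxAl; congr (_ *: _).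
apply/matrixP => x y; case: (mxtens_indexP x) => i1 j1; case: (mxtens_indexP y) => i2 j2.
rewrite insertion_compress tensmxE.
transitivity ((sqd R hb)^-1 * (sqd R hb)^-1 *
    \sum_(q < hb) (delta_mx i j i1 i2 * delta_mx l k j1 j2) : C).
  have hh : sqd R hb * sqd R hb = hb%:R := sqdK R hb.
  rewrite sumr_const card_ord -[X in _ = _ * X]mulr_natr -hh.
  have s0 := sqd_neq0 R hb0; by field; rewrite s0.
congr (_ * _); apply: eq_bigr => q _.
rewrite (big_pick (i := q)) => [|q' qq].
  by rewrite !tensmxE !one_mxE eqxx mulr1 mul1r.
by rewrite !tensmxE !one_mxE [q == q']eq_sym qq mulr0 mul0r.
Qed.

End PairTensor.

Lemma bimod_iso_refl (R : realType) (G : compact_quantum_group R)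
    (F : fibre_functor G) (A B : end_monoid_data F) (M : bimod_data A B) :
  bimod_iso M M.
Proof.
exists 1%:M; split; first exact: unitary1.
  exact: mod_id.
by rewrite !tensmx11 mul1mx mulmx1.
Qed.

Lemma morita_same_target (R : realType) (G : compact_quantum_group R)
    (F F' : fibre_functor G) (al be : upt_data F F') :
  nonzero_upt al -> nonzero_upt be ->
  is_dual_unitary (upt_blk al) -> is_dual_unitary (upt_blk be) ->
  morita_equiv (upt_monoid al) (upt_monoid be).
Proof.
move=> [ua ha0] [ub hb0] da db.
exists (pair_bimod al be), (pair_bimod be al); split.
- exact: pair_bimod_bimod.
- exact: pair_bimod_bimod.
- exists (regular_bimod (upt_monoid al)), (insertion al be).
  by split; [apply: pair_rel_tensor | apply: bimod_iso_refl].
- exists (regular_bimod (upt_monoid be)), (insertion be al).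
  by split; [apply: pair_rel_tensor | apply: bimod_iso_refl].
Qed.

(** * Bimodules over matrix monoids *)

Section MatrixUnits.
Variables (R : realType) (G : compact_quantum_group R).
Local Notation C := R[i].
Local Notation e_ k := (delta_mx k 0).

Section OneBimodule.
Variables (F F1 F2 : fibre_functor G) (al : upt_data F F1) (be : upt_data F F2).
Local Notation ha := (upt_dim al).
Local Notation hb := (upt_dim be).
Local Notation A := (upt_monoid al).
Local Notation B := (upt_monoid be).
Hypotheses (ha0 : (0 < ha)%N) (hb0 : (0 < hb)%N).
Variable M : bimod_data A B.
Hypothesis (bM : is_bimod M).

(** Normalised so that these operators multiply as products of matrix units of the
    left and of the right monoid. *)
Definition munit (i j : 'I_ha) (k l : 'I_hb) : 'M[C]_(upt_dim M) :=
  (sqd R ha * sqd R hb) *: bact M (e_ (idx (i, j))) (e_ (idx (k, l))).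

Let aM : is_bimod_action M. Proof. by have [_ _ h] := iffLR (is_bimodP M) bM. Qed.

Lemma munitM i j k l i' j' k' l' :
  munit i j k l *m munit i' j' k' l' =
  ((j == i')%:R * (l' == k)%:R) *: munit i j' k' l.
Proof.
have s0 := sqd_neq0 R ha0; have t0 := sqd_neq0 R hb0.
rewrite /munit -scalemxAl -scalemxAr (action_mul aM) !mulv_pair bactZl bactZr.
rewrite !scalerA; congr (_ *: _).
by field; rewrite ?s0 ?t0.
Qed.

Lemma munit_dag i j k l : (munit i j k l)^t* = munit j i l k.
Proof.
rewrite /munit (action_star aM) starl_pair // starr_pair // dagZ trmxCK.
by rewrite rmorphM /= !sqd_conj.
Qed.

Lemma munit_sum : \sum_i \sum_k munit i i k k = 1%:M.
Proof.
rewrite -(action_one aM) !one_pair bactZl bact_suml scaler_sumr.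
apply: eq_bigr => i _; rewrite bactZr bact_sumr !scaler_sumr.
by apply: eq_bigr => k _; rewrite scalerA.
Qed.

Variables (o : 'I_ha) (o' : 'I_hb).

Lemma munit_trace i j k l :
  \tr (munit i j k l) = (i == j)%:R * (k == l)%:R * \tr (munit o o o' o').
Proof.
transitivity (\tr (munit i o o' l *m munit o j k o')).
  by rewrite munitM !eqxx mul1r scale1r.
rewrite mxtrace_mulC munitM linearZ /=.
by rewrite [j == i]eq_sym [l == k]eq_sym.
Qed.

Lemma trace_onel k l : \tr (bact M (em_one A) (e_ (idx (k, l)))) =
  (sqd R hb)^-1 * ha%:R * (k == l)%:R * \tr (munit o o o' o').
Proof.
have s0 := sqd_neq0 R ha0; have t0 := sqd_neq0 R hb0.
rewrite one_pair bactZl bact_suml.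
transitivity (\sum_(i < ha) (sqd R hb)^-1 * ((k == l)%:R * \tr (munit o o o' o'))).
  rewrite linearZ /= raddf_sum mulr_sumr; apply: eq_bigr => i _ /=.
  have := munit_trace i i k l; rewrite eqxx mul1r => <-.
  rewrite /munit linearZ /=.
  by field; rewrite ?s0 ?t0.
by rewrite sumr_const card_ord -[LHS]mulr_natr; ring.
Qed.

Lemma trace_oner i j : \tr (bact M (e_ (idx (i, j))) (em_one B)) =
  (sqd R ha)^-1 * hb%:R * (i == j)%:R * \tr (munit o o o' o').
Proof.
have s0 := sqd_neq0 R ha0; have t0 := sqd_neq0 R hb0.
rewrite one_pair bactZr bact_sumr.
transitivity (\sum_(k < hb) (sqd R ha)^-1 * ((i == j)%:R * \tr (munit o o o' o'))).
  rewrite linearZ /= raddf_sum mulr_sumr; apply: eq_bigr => k _ /=.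
  have := munit_trace i j k k; rewrite eqxx mulr1 => <-.
  rewrite /munit linearZ /=.
  by field; rewrite ?s0 ?t0.
by rewrite sumr_const card_ord -[LHS]mulr_natr; ring.
Qed.

Lemma munit_split : exists r (W : 'M[C]_(upt_dim M, r)),
  [/\ W^t* *m W = 1%:M, W *m W^t* = munit o o o' o' & \tr (munit o o o' o') = r%:R].
Proof.
have [||r [W [W1 W2]]] := @dagger_split C _ (munit o o o' o').
- by rewrite munitM !eqxx mul1r scale1r.
- exact: munit_dag.
exists r, W; split=> //.
by rewrite -W2 mxtrace_mulC W1 mxtrace1.
Qed.

(** When the projection [munit o o o' o'] has rank one, with range spanned by W,
    the vectors xi i l = munit i o o' l W form an orthonormal basis of M on which
    the matrix units act as on H_al (x) H_be^* . *)
Lemma munit_basis (W : 'M[C]_(upt_dim M, 1)) :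
  W^t* *m W = 1%:M -> W *m W^t* = munit o o o' o' ->
  exists V : 'M[C]_(upt_dim M, ha * hb), is_unitary V /\
    V^t* *m bm_act M *m (1%:M *t V *t 1%:M) = pair_act R ha hb.
Proof.
move=> W1 W2.
pose xi i l := munit i o o' l *m W.
pose V : 'M[C]_(upt_dim M, ha * hb) :=
  \matrix_(x, t) xi (mxtens_unindex t).1 (mxtens_unindex t).2 x 0.
have VE x i l : V x (idx (i, l)) = xi i l x 0 by rewrite mxE mxtens_indexK.
have xi_dot i l (X : 'M_(upt_dim M)) p q :
    (V^t* *m X *m V) (idx (i, l)) (idx (p, q)) = ((xi i l)^t* *m X *m xi p q) 0 0.
  rewrite !mxE; apply: eq_bigr => y _; rewrite VE; congr (_ * _).
  rewrite !mxE; apply: eq_bigr => x _.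
  by rewrite !dagE VE.
have xi_act i j k l p q : munit i j k l *m xi p q =
    ((j == p)%:R * (q == k)%:R) *: xi i l.
  by rewrite /xi mulmxA munitM -scalemxAl.
have xi_xi i l p q : (xi i l)^t* *m xi p q = ((i == p)%:R * (q == l)%:R) *: 1%:M.
  rewrite {1}/xi dagM munit_dag -mulmxA xi_act -scalemxAr /xi -W2.
  by rewrite -mulmxA W1 mulmx1 W1.
have V1 : V^t* *m V = 1%:M.
  apply/matrixP => a b; case: (mxtens_indexP a) => i l; case: (mxtens_indexP b) => p q.
  have := xi_dot i l 1%:M p q; rewrite !mulmx1 => ->.
  rewrite xi_xi mx_delta mxE mxE eqxx mulr1 [q == l]eq_sym.
  by [].
have V2 : V *m V^t* = 1%:M.
  rewrite -munit_sum; apply/matrixP => x y; rewrite mxE sum_idx summxE.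
  apply: eq_bigr => i _; rewrite summxE; apply: eq_bigr => l _.
  transitivity ((xi i l *m (xi i l)^t*) x y).
    by rewrite [RHS]mxE big_ord1 !dagE !VE.
  rewrite {2}/xi dagM mulmxA munit_dag /xi -(mulmxA _ W) W2 !munitM.
  by rewrite !eqxx !mulr1 -scalemxAl !scale1r munitM !eqxx mulr1 scale1r.
exists V; split; first by split.
apply/matrixP => x t; case: (mxtens_indexP x) => i l.
case: (mxtens_indexP t) => t1 b; case: (mxtens_indexP t1) => a y.
case: (mxtens_indexP a) => i' j'; case: (mxtens_indexP b) => k' l'.
case: (mxtens_indexP y) => p q.
transitivity ((V^t* *m bact M (e_ (idx (i', j'))) (e_ (idx (k', l'))) *m V)
    (idx (i, l)) (idx (p, q))).
  rewrite mxE sum_idx sum_idx (big_pick (i := idx (i', j'))) => [|u uu]; last first.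
    rewrite big1 // => v _; rewrite big1 // => z _.
    by rewrite tens3E one_mxE uu !mul0r mulr0.
  rewrite [RHS]mxE; apply: eq_bigr => z _.
  rewrite (big_pick (i := idx (k', l'))) => [|u uu]; last first.
    by rewrite tens3E !one_mxE uu !mulr0.
  rewrite tens3E !one_mxE !eqxx mul1r mulr1; congr (_ * _).
  rewrite !mxE; apply: eq_bigr => z' _.
  by rewrite bact_delta.
have s0 := sqd_neq0 R ha0; have t0 := sqd_neq0 R hb0.
have -> : bact M (e_ (idx (i', j'))) (e_ (idx (k', l'))) =
    ((sqd R ha)^-1 * (sqd R hb)^-1) *: munit i' j' k' l'.
  rewrite /munit scalerA -[LHS]scale1r; congr (_ *: _).
  by field; rewrite ?s0 ?t0.
rewrite -scalemxAr -scalemxAl mxE xi_dot -mulmxA xi_act -scalemxAr xi_xi.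
rewrite pair_actE [RHS]mxE tensmxE !mxE eqxx mulr1; congr (_ * _).
by rewrite -!mulnb !natrM [p == j']eq_sym [l' == l]eq_sym; ring.
Qed.

End OneBimodule.

Lemma mxtrace_tens m n (X : 'M[C]_m) (Y : 'M[C]_n) : \tr (X *t Y) = \tr X * \tr Y.
Proof.
rewrite /mxtrace sum_idx mulr_suml; apply: eq_bigr => i _.
by rewrite mulr_sumr; apply: eq_bigr => j _; rewrite tensmxE.
Qed.

End MatrixUnits.

(** * Morita equivalent monoids have isomorphic targets *)

Section MoritaIso.
Variables (R : realType) (G : compact_quantum_group R).
Local Notation C := R[i].
Local Notation e_ k := (delta_mx k 0).
Variables (F F1 F2 : fibre_functor G) (al : upt_data F F1) (be : upt_data F F2).
Local Notation ha := (upt_dim al).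
Local Notation hb := (upt_dim be).
Local Notation A := (upt_monoid al).
Local Notation B := (upt_monoid be).
Hypotheses (ua : is_upt al) (ub : is_upt be).
Hypotheses (da : is_dual_unitary (upt_blk al)) (db : is_dual_unitary (upt_blk be)).
Variables (o : 'I_ha) (o' : 'I_hb).
Local Notation a := (upt_blk al).
Local Notation b := (upt_blk be).

(** phi is determined by its compositions with the blocks of al and be, whose
    orthogonality relations turn each property of the transformation s into the
    corresponding property of phi. *)
Lemma ff_iso_of_factor (s : block_family F F (ha * hb))
    (phi : forall X, 'M[C]_(F2 X, F1 X)) :
  is_block_upt s ->
  (forall X Y (f : rep_hom X Y), ff_hom F2 f *m phi X = phi Y *m ff_hom F1 f) ->
  (forall X i l p q, s X (idx (i, l)) (idx (p, q)) =
     (b X l q)^t* *m phi X *m a X i p) ->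
  ff_iso F1 F2.
Proof.
move=> [iso coiso _ mul un] phin sE.
have [aiso acoiso _ amul aun] := iffLR (is_uptP al) ua.
have [biso bcoiso _ bmul bun] := iffLR (is_uptP be) ub.
have [aiso' acoiso'] := da; have [biso' bcoiso'] := db.
have sb X : \sum_l b X l o' *m (b X l o')^t* = 1%:M.
  by have := bcoiso' X o' o'; rewrite eqxx.
have sa X : \sum_p a X o p *m (a X o p)^t* = 1%:M.
  by have := acoiso X o o; rewrite eqxx.
(* By sa and sb these products recover Z. *)
have cancel X (Z Z' : 'M[C]_(F2 X, F1 X)) :
    (forall l p, (b X l o')^t* *m Z *m a X o p = (b X l o')^t* *m Z' *m a X o p) ->
    Z = Z'.
  move=> e; rewrite -[Z]mul1mx -[Z']mul1mx -(sb X) !mulmx_suml.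
  apply: eq_bigr => l _; rewrite -!mulmxA -[Z]mulmx1 -[Z']mulmx1 -(sa X).
  congr (_ *m _); rewrite !mulmx_sumr; apply: eq_bigr => p _.
  by rewrite !mulmxA e.
have phi1 X : (phi X)^t* *m phi X = 1%:M.
  have e1 j p : \sum_i (a X i j)^t* *m ((phi X)^t* *m phi X) *m a X i p = (j == p)%:R%:M.
    have := iso X (idx (j, o')) (idx (p, o')).
    rewrite eq_mxtens_index eqxx andbT sum_idx => <-.
    apply: eq_bigr => i _.
    transitivity ((a X i j)^t* *m ((phi X)^t* *m
        (\sum_l b X l o' *m (b X l o')^t*) *m phi X) *m a X i p).
      by rewrite sb mulmx1.
    rewrite !(mulmx_sumr, mulmx_suml); apply: eq_bigr => l _.
    by rewrite !sE !dagM trmxCK !mulmxA.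
  have e2 i p : (phi X)^t* *m phi X *m a X i p = a X i p.
    transitivity (\sum_j a X i j *m
        \sum_k (a X k j)^t* *m ((phi X)^t* *m phi X) *m a X k p).
      under eq_bigr => j _ do rewrite mulmx_sumr.
      rewrite exchange_big (big_pick (i := i)) => [|k ki] /=.
        under eq_bigr => j _ do rewrite !mulmxA.
        rewrite -!mulmx_suml; have := acoiso X i i; rewrite eqxx => ->.
        by rewrite mul1mx.
      under eq_bigr => j _ do rewrite !mulmxA.
      by rewrite -!mulmx_suml acoiso eq_sym ki -scalemx1 scale0r !mul0mx.
    under eq_bigr => j _ do rewrite e1.
    by rewrite sum_delta_mulr.
  rewrite -[LHS]mulmx1 -(sa X) mulmx_sumr; apply: eq_bigr => p _.
  by rewrite mulmxA e2.
have phi2 X : phi X *m (phi X)^t* = 1%:M.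
  have e1 l q : \sum_k (b X l k)^t* *m (phi X *m (phi X)^t*) *m b X q k = (l == q)%:R%:M.
    have := coiso X (idx (o, l)) (idx (o, q)).
    rewrite eq_mxtens_index eqxx andTb sum_idx => <-.
    rewrite exchange_big; apply: eq_bigr => k _ /=.
    transitivity ((b X l k)^t* *m (phi X *m
        (\sum_j a X o j *m (a X o j)^t*) *m (phi X)^t*) *m b X q k).
      by rewrite sa mulmx1.
    rewrite !(mulmx_sumr, mulmx_suml); apply: eq_bigr => j _.
    by rewrite !sE !dagM trmxCK !mulmxA.
  have e2 q k : phi X *m (phi X)^t* *m b X q k = b X q k.
    transitivity (\sum_l b X l k *m
        \sum_m (b X l m)^t* *m (phi X *m (phi X)^t*) *m b X q m).
      under eq_bigr => l _ do rewrite mulmx_sumr.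
      rewrite exchange_big (big_pick (i := k)) => [|m mk] /=.
        under eq_bigr => l _ do rewrite !mulmxA.
        rewrite -!mulmx_suml; have := bcoiso' X k k; rewrite eqxx => ->.
        by rewrite mul1mx.
      under eq_bigr => l _ do rewrite !mulmxA.
      by rewrite -!mulmx_suml bcoiso' eq_sym mk -scalemx1 scale0r !mul0mx.
    under eq_bigr => l _ do rewrite e1.
    by rewrite sum_delta_mulr.
  rewrite -[LHS]mulmx1 -(sb X) mulmx_sumr; apply: eq_bigr => l _.
  by rewrite mulmxA e2.
exists phi; split=> //.
- move=> X Y; have [m1 m1'] := ff_mult_unitary F1 X Y.
  have [m2 m2'] := ff_mult_unitary F2 X Y.
  have [m0 m0'] := ff_mult_unitary F X Y.
  suff e : phi (tensor_rep X Y) =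
      ff_mult F2 X Y *m (phi X *t phi Y) *m (ff_mult F1 X Y)^t*.
    by rewrite e -mulmxA m1 mulmx1.
  apply: cancel => l p.
  have am : \sum_j a X o j *t a Y j p =
      (ff_mult F1 X Y)^t* *m a (tensor_rep X Y) o p *m ff_mult F X Y.
    by rewrite -mulmxA amul mulmxA m1 mul1mx.
  have bm : (\sum_k b X l k *t b Y k o')^t* =
      (ff_mult F X Y)^t* *m (b (tensor_rep X Y) l o')^t* *m ff_mult F2 X Y.
    have -> : \sum_k b X l k *t b Y k o' =
        (ff_mult F2 X Y)^t* *m b (tensor_rep X Y) l o' *m ff_mult F X Y.
      by rewrite -mulmxA bmul mulmxA m2 mul1mx.
    by rewrite !dagM trmxCK mulmxA.
  rewrite -sE -[LHS]mulmx1 -m0' mulmxA mul sum_idx.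
  transitivity (ff_mult F X Y *m ((\sum_k b X l k *t b Y k o')^t* *m
     (phi X *t phi Y) *m (\sum_j a X o j *t a Y j p)) *m (ff_mult F X Y)^t*).
    congr (_ *m _ *m _).
    rewrite dag_sum mulmx_suml mulmx_suml exchange_big; apply: eq_bigr => k _ /=.
    rewrite mulmx_sumr; apply: eq_bigr => j _.
    by rewrite !sE dag_tens !tensmx_mul.
  rewrite am bm !mulmxA m0' mul1mx.
  by rewrite -(mulmxA _ (ff_mult F X Y) ((ff_mult F X Y)^t*)) m0' mulmx1.
have [u0 u0'] := ff_unit_unitary F; have [u2 u2'] := ff_unit_unitary F2.
have := un (idx (o, o')) (idx (o, o')).
rewrite eqxx scale1r sE -(mulmxA _ (a _ _ _) (ff_unit F)) aun eqxx scale1r.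
have -> : (b (unit_rep G) o' o')^t* = ff_unit F *m (ff_unit F2)^t*.
  have := bun o' o'; rewrite eqxx scale1r => <-.
  by rewrite dagM mulmxA u0' mul1mx.
move/(congr1 (mulmx (ff_unit F2 *m (ff_unit F)^t*))).
rewrite -!mulmxA !mulmxA -(mulmxA _ _ (ff_unit F)) u0 mulmx1.
by rewrite u2' mul1mx.
Qed.

(** That the action is a modification expresses the blocks of si through those at
    the single index (o, o'): s^(il,pq) = (b^lq)^* phi a^ip, where phi is the
    sum of b^ko' s^(jk,oo') (a^jo)^* over j and k. *)
Lemma ff_iso_of_pair
    (sg : forall X, 'M[C]_(ha * hb * F X, F X * (ha * hb))) (si := UptData sg) :
  is_upt si ->
  @is_modification _ _ F F (comp_upt (comp_upt A si) B) si (pair_act R ha hb) ->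
  ff_iso F1 F2.
Proof.
move=> us /is_modificationP mact.
have c0 : (sqd R ha)^-1 * (sqd R hb)^-1 != 0.
  rewrite mulf_neq0 // invr_eq0 sqd_neq0 //.
    exact: leq_ltn_trans (ltn_ord o).
  exact: leq_ltn_trans (ltn_ord o').
have us' := iffLR (is_uptP si) us.
pose s : block_family F F (ha * hb) := upt_blk si.
pose phi X := \sum_j \sum_k b X k o' *m s X (idx (j, k)) (idx (o, o')) *m (a X j o)^t*.
have [_ _ snat _ _] := us'.
have [_ _ anat _ _] := iffLR (is_uptP al) ua.
have [_ _ bnat _ _] := iffLR (is_uptP be) ub.
apply: (@ff_iso_of_factor s phi) => //.
  move=> X Y f; rewrite /phi mulmx_sumr mulmx_suml; apply: eq_bigr => j _.
  rewrite mulmx_sumr mulmx_suml; apply: eq_bigr => k _.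
  rewrite !mulmxA bnat -(mulmxA _ (ff_hom F f)) snat mulmxA -!mulmxA.
  do 2 congr (_ *m _).
  have := anat Y X (dag_hom f) j o; rewrite !ff_dag => /(congr1 (fun M => M^t*)).
  by rewrite !dagM !trmxCK.
move=> X i l p q.
have := mact X (idx (i, l)) (idx (idx (idx (p, o), idx (o, o')), idx (o', q))).
rewrite (pair_act_in (s X (idx (i, l)))).
rewrite (pair_act_out (fun z => upt_blk (comp_upt (comp_upt A si) B) X z _)).
rewrite !eqxx !mulr1 => /(scalerI c0) ->.
rewrite /phi mulmx_sumr mulmx_suml; apply: eq_bigr => j _.
rewrite mulmx_sumr mulmx_suml; apply: eq_bigr => k _.
by rewrite !comp_upt_blk !dual_upt_blk !mulmxA.
Qed.

End MoritaIso.

Section Morita.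
Variables (R : realType) (G : compact_quantum_group R).
Local Notation C := R[i].
Local Notation e_ k := (delta_mx k 0).
Variables (F F1 F2 : fibre_functor G) (al : upt_data F F1) (be : upt_data F F2).
Local Notation ha := (upt_dim al).
Local Notation hb := (upt_dim be).
Local Notation A := (upt_monoid al).
Local Notation B := (upt_monoid be).

(** The dimension of P is the trace of the projection onto the relative tensor
    product, and each trace of an operator of the action is a multiple of the
    trace of one minimal projection. *)
Lemma rel_tensor_trace (o : 'I_ha) (o' : 'I_hb) (M : bimod_data A B) (N : bimod_data B A)
    (P : bimod_data A A) i :
  is_bimod M -> is_bimod N -> @is_rel_tensor _ _ F A B A M N P i ->
  (upt_dim P)%:R = ha%:R * ha%:R * (\tr (munit M o o o' o') * \tr (munit N o' o' o o)).
Proof.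
move=> bM bN /is_rel_tensorP[_ _ i1 i2 _].
have ha0 : (0 < ha)%N := leq_ltn_trans (leq0n _) (ltn_ord o).
have hb0 : (0 < hb)%N := leq_ltn_trans (leq0n _) (ltn_ord o').
have t0 := sqd_neq0 R hb0.
rewrite -(mxtrace1 _ (upt_dim P)) -i1 mxtrace_mulC i2.
transitivity (\sum_(k < hb) \sum_(l < hb) (k == l)%:R *
   ((sqd R hb)^-1 * ha%:R * ((sqd R hb)^-1 * ha%:R) *
   (\tr (munit M o o o' o') * \tr (munit N o' o' o o)))).
  rewrite raddf_sum [LHS]sum_idx; apply: eq_bigr => k _; apply: eq_bigr => l _ /=.
  rewrite raddf_sum /= sum_idx (big_pick (i := l)) => [|m ml]; last first.
    by rewrite big1 // => n _; rewrite (cup_pair hb0) [l == m]eq_sym ml mul0r scale0r linear0.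
  rewrite (big_pick (i := k)) => [|n nk]; last first.
    by rewrite (cup_pair hb0) [k == n]eq_sym nk mulr0 scale0r linear0.
  rewrite (cup_pair hb0) !eqxx mul1r scale1r mxtrace_tens.
  rewrite (trace_onel ha0 hb0 bM o o') (trace_oner hb0 ha0 bN o' o).
  rewrite [l == k]eq_sym; case: (k == l); rewrite ?mulr1 ?mul1r.
    by ring.
  by rewrite !(mulr0, mul0r).
transitivity (\sum_(k < hb) ((sqd R hb)^-1 * ha%:R * ((sqd R hb)^-1 * ha%:R) *
   (\tr (munit M o o o' o') * \tr (munit N o' o' o o)))).
  by apply: eq_bigr => k _; rewrite sum_deltal.
have hh : sqd R hb * sqd R hb = hb%:R := sqdK R hb.
rewrite sumr_const card_ord -[LHS]mulr_natr -hh.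
by field; rewrite ?t0.
Qed.

(** For P isomorphic to the regular bimodule, [rel_tensor_trace] says that the
    ranks r and r' of the minimal projections of M and N satisfy
    r r' = 1, hence r = 1 and [munit_basis] applies to M. *)
Lemma morita_ff_iso :
  nonzero_upt al -> nonzero_upt be ->
  is_dual_unitary (upt_blk al) -> is_dual_unitary (upt_blk be) ->
  morita_equiv A B -> ff_iso F1 F2.
Proof.
move=> [ua ha0] [ub hb0] da db [M [N [bM bN [P [i [iP [f [[f1 f2] _ _]]]]] _]]].
pose o := Ordinal ha0; pose o' := Ordinal hb0.
have := rel_tensor_trace o o' bM bN iP.
have [r [W [W1 W2 trM]]] := munit_split ha0 hb0 bM o o'.
have [r' [_ [_ _ trN]]] := munit_split hb0 ha0 bN o' o.
rewrite trM trN -(mxtrace1 _ (upt_dim P)) -f1 mxtrace_mulC f2 mxtrace1 => e.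
have r1 : r = 1%N.
  have : (ha * ha * (r * r') == ha * ha * 1)%N.
    by rewrite -(eqr_nat C) muln1 !natrM -e /= natrM.
  by rewrite eqn_pmul2l ?muln_gt0 ?ha0 // muln_eq1 => /andP[/eqP].
subst r.
have [V [[V1 V2] VE]] := munit_basis ha0 hb0 bM W1 W2.
have [uM mM _] := iffLR (is_bimodP M) bM.
have uV : is_unitary (V^t*) by split; rewrite trmxCK.
have usi : is_upt (conj_upt (V^t*)) by apply: conj_upt_is_upt.
have mV : @is_modification _ _ F F M (conj_upt (V^t*)) (V^t*) by apply: conj_upt_mod.
have mV' : @is_modification _ _ F F (conj_upt (V^t*)) M V.
  by have := mod_dag uM usi mV; rewrite trmxCK.
apply: (ff_iso_of_pair ua ub da db o o' usi); rewrite -VE.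
have m1 := mod_tens (mod_tens (@mod_id _ _ _ _ A) mV') (@mod_id _ _ _ _ B).
by have := mod_comp (mod_comp m1 mM) mV; rewrite mulmxA.
Qed.
End Morita.

(** * Isomorphisms of fibre functors *)

Section FibreFunctorIso.
Variables (R : realType) (G : compact_quantum_group R).
Local Notation C := R[i].
Implicit Types F : fibre_functor G.

Lemma ff_iso_refl F : ff_iso F F.
Proof.
exists (fun X => 1%:M); split.
- by move=> X; apply: unitary1.
- by move=> X Y f; rewrite mulmx1 mul1mx.
- by move=> X Y; rewrite tensmx11 mulmx1 mul1mx.
- by rewrite mul1mx.
Qed.

Lemma ff_iso_sym F1 F2 : ff_iso F1 F2 -> ff_iso F2 F1.
Proof.
move=> [phi [uni nat mul un]]; exists (fun X => (phi X)^t*); split.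
- by move=> X; have [p1 p2] := uni X; split; rewrite trmxCK.
- move=> X Y f; have [p1 p2] := uni Y; have [q1 q2] := uni X.
  rewrite -[LHS]mul1mx -p1 -mulmxA [phi Y *m _]mulmxA -nat.
  by rewrite -mulmxA q2 mulmx1.
- move=> X Y; have [p1 p2] := uni (tensor_rep X Y).
  have [x1 x2] := uni X; have [y1 y2] := uni Y.
  have := congr1 (fun M => (phi (tensor_rep X Y))^t* *m M *m
    ((phi X)^t* *t (phi Y)^t*)) (mul X Y).
  rewrite /= !mulmxA p1 mul1mx => ->.
  by rewrite -!mulmxA tensmx_mul x2 y2 tensmx11 mulmx1.
- by have [p1 p2] := uni (unit_rep G); rewrite -un mulmxA p1 mul1mx.
Qed.

Lemma ff_iso_trans F1 F2 F3 : ff_iso F1 F2 -> ff_iso F2 F3 -> ff_iso F1 F3.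
Proof.
move=> [phi [uni nat mul un]] [psi [uni' nat' mul' un']].
exists (fun X => psi X *m phi X); split.
- move=> X; have [p1 p2] := uni X; have [q1 q2] := uni' X; split; rewrite dagM.
    by rewrite mulmxA -(mulmxA _ _ (psi X)) q1 mulmx1.
  by rewrite mulmxA -(mulmxA _ (phi X)) p2 mulmx1.
- by move=> X Y f; rewrite mulmxA nat' -mulmxA nat mulmxA.
- by move=> X Y; rewrite -mulmxA mul mulmxA mul' -mulmxA tensmx_mul.
- by rewrite -mulmxA un.
Qed.

Lemma upt_post_iso F F1 F2 (al : upt_data F F1) (phi : forall X, 'M[C]_(F2 X, F1 X)) :
  (forall X, is_unitary (phi X)) ->
  (forall X Y (f : rep_hom X Y), ff_hom F2 f *m phi X = phi Y *m ff_hom F1 f) ->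
  (forall X Y, phi (tensor_rep X Y) *m ff_mult F1 X Y =
        ff_mult F2 X Y *m (phi X *t phi Y)) ->
  phi (unit_rep G) *m ff_unit F1 = ff_unit F2 -> is_upt al ->
  is_upt (upt_of (fun X i j => phi X *m upt_blk al X i j) : upt_data F F2).
Proof.
move=> uni nat mul un /is_uptP[aiso acoiso anat amul aun].
apply/is_uptP; apply: (is_block_upt_ext (a := fun X i j => phi X *m upt_blk al X i j)).
  by move=> X i j; rewrite upt_of_blk.
split.
- move=> X j k; rewrite -aiso; apply: eq_bigr => i _.
  by have [p1 p2] := uni X; rewrite dagM mulmxA -(mulmxA _ _ (phi X)) p1 mulmx1.
- move=> X i j; have [p1 p2] := uni X.
  transitivity (phi X *m (\sum_k upt_blk al X i k *m (upt_blk al X j k)^t*) *m (phi X)^t*).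
    rewrite mulmx_sumr mulmx_suml; apply: eq_bigr => k _.
    by rewrite dagM !mulmxA.
  by rewrite acoiso scalar_mxC -mulmxA p2 mulmx1.
- by move=> X Y f i j; rewrite mulmxA nat -mulmxA anat mulmxA.
- move=> X Y i j; rewrite -mulmxA amul mulmxA mul -mulmxA mulmx_sumr.
  by congr (_ *m _); apply: eq_bigr => k _; rewrite tensmx_mul.
- by move=> i j; rewrite -mulmxA aun -scalemxAr un.
Qed.

(** phi cancels in alpha (x) alpha^* , so the identity matrix is the isomorphism. *)
Lemma upt_monoid_post_iso F F1 F2 (al : upt_data F F1)
    (phi : forall X, 'M[C]_(F2 X, F1 X)) :
  (forall X, is_unitary (phi X)) ->
  iso_end (upt_monoid al)
    (upt_monoid (upt_of (fun X i j => phi X *m upt_blk al X i j) : upt_data F F2)).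
Proof.
move=> uni; exists 1%:M; split.
- exact: unitary1.
- move=> X; rewrite !tensmx11 mulmx1 mul1mx; apply/blkP => a b.
  case: (comp_idxP a) => i k; case: (comp_idxP b) => j l.
  have [p1 _] := uni X.
  transitivity (upt_blk (upt_monoid (upt_of
    (fun X i j => phi X *m upt_blk al X i j) : upt_data F F2)) X
      (idx (i, k)) (idx (j, l))); first by [].
  transitivity (upt_blk (upt_monoid al) X (idx (i, k)) (idx (j, l))); last by [].
  rewrite !comp_upt_blk !dual_upt_blk !upt_of_blk dagM.
  by rewrite mulmxA -(mulmxA _ _ (phi X)) p1 mulmx1.
- by rewrite tensmx11 mulmx1 mul1mx.
- by rewrite mul1mx.
Qed.

End FibreFunctorIso.

(** * Maps between quotients *)

Section QuotientMaps.

Lemma class_of_eq T (E : T -> T -> Prop) x y :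
  (forall u v, E u v -> E v u) -> (forall u v w, E u v -> E v w -> E u w) ->
  E x y -> class_of E x = class_of E y.
Proof.
move=> sym tr xy; apply: eq_exist; apply/funext => z; apply/propext.
by split; apply: tr => //; apply: sym.
Qed.

Lemma class_ofP T (E : T -> T -> Prop) (c : quotient E) : exists x, class_of E x = c.
Proof. by case: c => c [x xc]; exists x; apply: eq_exist. Qed.

Lemma class_of_inj T (E : T -> T -> Prop) x y :
  (forall u, E u u) -> class_of E x = class_of E y -> E x y.
Proof. by move=> rfl /(congr1 sval) /= ->. Qed.

Lemma quotient_map T U (E : T -> T -> Prop) (D : U -> U -> Prop) (L : T -> U -> Prop) :
  (forall x, E x x) ->
  (forall u v, D u v -> D v u) -> (forall u v w, D u v -> D v w -> D u w) ->
  (forall x, exists u, L x u) ->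
  (forall x y u v, L x u -> L y v -> E x y -> D u v) ->
  exists Phi : quotient E -> quotient D,
    forall x u, L x u -> Phi (class_of E x) = class_of D u.
Proof.
move=> rfl sym tr ex LED.
have /choice[Phi PhiE] : forall c : quotient E, exists d : quotient D,
    forall x u, L x u -> class_of E x = c -> d = class_of D u.
  move=> c; have [x <-] := class_ofP c; have [u xu] := ex x.
  exists (class_of D u) => y v yv /(class_of_inj rfl) yx.
  by apply: class_of_eq => //; apply: sym; apply: LED yx.
by exists Phi => x u xu; apply: PhiE xu _.
Qed.

(** L relates the two sides of the correspondence.  A relation that is total on
    both sides and compatible with E and D makes D an equivalence too, and
    descends to mutually inverse maps of quotients. *)
Lemma quotient_bijection T U (E : T -> T -> Prop) (D : U -> U -> Prop)
    (L : T -> U -> Prop) :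
  (forall x, E x x) -> (forall x y, E x y -> E y x) ->
  (forall x y z, E x y -> E y z -> E x z) ->
  (forall x, exists u, L x u) -> (forall u, exists x, L x u) ->
  (forall x y u v, L x u -> L y v -> E x y <-> D u v) ->
  exists Phi : quotient E -> quotient D, bijective Phi /\
    forall x u, L x u -> Phi (class_of E x) = class_of D u.
Proof.
move=> rfl sym tr ex ex' LED.
have Drfl u : D u u.
  by have [x xu] := ex' u; apply/(LED _ _ _ _ xu xu).
have Dsym u v : D u v -> D v u.
  have [x xu] := ex' u; have [y yv] := ex' v.
  by move/(LED _ _ _ _ xu yv)/sym/(LED _ _ _ _ yv xu).
have Dtr u v w : D u v -> D v w -> D u w.
  have [x xu] := ex' u; have [y yv] := ex' v; have [z zw] := ex' w.
  move=> /(LED _ _ _ _ xu yv) xy /(LED _ _ _ _ yv zw) yz.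
  by apply/(LED _ _ _ _ xu zw); apply: tr yz.
have [Phi PhiE] := quotient_map rfl Dsym Dtr ex
  (fun x y u v xu yv => iffLR (LED x y u v xu yv)).
have [Psi PsiE] := @quotient_map _ _ _ _ (fun u x => L x u) Drfl sym tr ex'
  (fun u v x y xu yv => iffRL (LED x y u v xu yv)).
exists Phi; split=> //; exists Psi => c.
  have [x <-] := class_ofP c; have [u xu] := ex x.
  by rewrite (PhiE _ _ xu) (PsiE _ _ xu).
have [u <-] := class_ofP c; have [x xu] := ex' u.
by rewrite (PsiE _ _ xu) (PhiE _ _ xu).
Qed.

End QuotientMaps.

(** * The correspondence *)

Section Correspondence.
Variables (R : realType) (G : compact_quantum_group R).
Local Notation F := (canonical_ff G).

(** On classes this relation is the graph of the correspondence. *)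
Definition realizes (F' : fibre_functor G) (A : end_monoid_data F) : Prop :=
  exists al : upt_data F F', nonzero_upt al /\ iso_end A (upt_monoid al).

Lemma canonical_dual_unitary (F' : fibre_functor G) (al : upt_data F F') :
  nonzero_upt al -> is_dual_unitary (upt_blk al).
Proof. by move=> [/is_uptP ua h0]; apply: upt_dual_unitary. Qed.

Lemma iso_end_refl (A : end_monoid_data F) : iso_end A A.
Proof.
exists 1%:M; split; first exact: unitary1.
- exact: mod_id.
- by rewrite tensmx11 mulmx1 mul1mx.
- by rewrite mul1mx.
Qed.

Lemma iso_end_monoid_upt (F' : fibre_functor G) (al : upt_data F F') :
  nonzero_upt al -> is_upt (upt_monoid al).
Proof.
move=> nal; have [] // := upt_monoid_simple nal (canonical_dual_unitary nal).
Qed.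

Lemma realizes_morita (F1 F2 : fibre_functor G) (A B : end_monoid_data F) : is_upt A -> is_upt B ->
  realizes F1 A -> realizes F2 B -> ff_iso F1 F2 <-> morita_equiv A B.
Proof.
move=> uA uB [al [nal Aal]] [be [nbe Bbe]].
have da := canonical_dual_unitary nal; have db := canonical_dual_unitary nbe.
have ua := iso_end_monoid_upt nal; have ub := iso_end_monoid_upt nbe.
split=> [[phi [uni nat mul un]]|mAB].
  apply: (morita_iso uA uB ua ub Aal Bbe).
  have [uptal h0] := nal.
  pose al' : upt_data F F2 := upt_of (fun X i j => phi X *m upt_blk al X i j).
  have nal' : nonzero_upt al' by split=> //; apply: upt_post_iso.
  have ua' := iso_end_monoid_upt nal'.
  apply: (morita_iso ua ub ua' ub (upt_monoid_post_iso al uni) (iso_end_refl _)).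
  exact: morita_same_target nal' nbe (canonical_dual_unitary nal') db.
apply: (morita_ff_iso nal nbe da db).
apply: (morita_iso ua ub uA uB _ _ mAB); exact: iso_end_sym.
Qed.

End Correspondence.

Theorem corollary5p16 (R : realType) (G : compact_quantum_group R) :
  exists Phi : quotient (@accessible_iso R G (canonical_ff G)) ->
               quotient (@simple_morita R G (canonical_ff G)),
    bijective Phi /\
    forall (F' : accessible_ff (canonical_ff G))
           (al : upt_data (canonical_ff G) F'),
      nonzero_upt al ->
      exists A : simple_frobenius (canonical_ff G),
        sf_data A = upt_monoid al /\
        Phi (class_of (@accessible_iso R G (canonical_ff G)) F') =
          class_of (@simple_morita R G (canonical_ff G)) A.
Proof.
have ex (F' : accessible_ff (canonical_ff G)) (al : upt_data (canonical_ff G) F') :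
    nonzero_upt al -> exists A : simple_frobenius (canonical_ff G),
      sf_data A = upt_monoid al /\ realizes F' A.
  move=> nal.
  exists (SimpleFrobenius (upt_monoid_simple nal (canonical_dual_unitary nal))).
  by split=> //; exists al; split=> //; apply: iso_end_refl.
have [] := @quotient_bijection _ _
    (@accessible_iso R G (canonical_ff G)) (@simple_morita R G (canonical_ff G))
    (fun F' A => realizes F' A)
    (fun F' => ff_iso_refl F') (fun F1 F2 => @ff_iso_sym _ _ F1 F2)
    (fun F1 F2 F3 => @ff_iso_trans _ _ F1 F2 F3).
- move=> F'; have [al nal] := acc_upt F'.
  by have [A [_ FA]] := ex F' al nal; exists A.
- move=> A; have [F' [al [nal Aal]]] := simple_frobenius_split (sf_simple A).
  by exists (AccessibleFF (ex_intro _ al nal)), al.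
- move=> F1 F2 A B; have [uA _ _ _ _] := sf_simple A.
  by have [uB _ _ _ _] := sf_simple B; apply: realizes_morita.
move=> Phi [bij PhiE]; exists Phi; split=> // F' al nal.
by have [A [AE FA]] := ex F' al nal; exists A; split=> //; apply: PhiE.
Qed.
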